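(* Let $M\subset\mathbb{C}^2$ be a smooth real hypersurface given by $\rho=0$ with $d\rho\neq 0$ on $M$, and let $n\ge 3$. Then the properties $\det A_n(\rho)=0$ and $\det D_n(\rho)=0$ at points of $M$ are independent of the choice of the defining function $\rho$ as well as of the choice of the holomorphic coordinates $Z=(z,w)\in\mathbb{C}^2$. More precisely, let $a$ be any nonzero (nowhere vanishing) real smooth function, let $\rho^*=a\rho$ be another defining function, and let $Z^*=(z^*,w^* )$, $Z^*=H(Z)$, be another (formal) holomorphic coordinate system, with Jacobian determinant $\delta=\det H_Z$. Let $L^*$, $A_n^*$, $D_n^*$ be defined by the same formulas as $L$, $A_n=A_n(\rho)$, $D_n=D_n(\rho)$, with $\rho$ replaced by $\rho^*$ (expressed in the coordinates $Z^*$) and $Z=(z,w)$ replaced by $Z^*=(z^*,w^* )$. Then at corresponding points of $M$ $$\delta^{\,n^2-1}\,\bar\delta^{\,(n-1)(2n-1)}\,\det A_n^* = a^{(2n-1)^2}\det A_n,$$ $$|\delta|^{\,n(n+1)}\det D_n^* = a^{\frac{3n(n+1)}{2}}\det D_n .$$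
   Context: Coordinates on $\mathbb{C}^2$ are $Z=(z,w)$. For a smooth real function $\rho$, subscripts denote partial derivatives, and $$L=-\rho_w\,\partial_z+\rho_z\,\partial_w,\qquad \bar L=-\rho_{\bar w}\,\partial_{\bar z}+\rho_{\bar z}\,\partial_{\bar w},$$ $$\rho_{Z^2}(L,L)=\rho_{zz}\rho_w^2-2\rho_{zw}\rho_z\rho_w+\rho_{ww}\rho_z^2 .$$ For $n\ge3$, $A_n=A_n(\rho)$ is the $(2n-1)\times(2n-1)$ matrix whose columns are indexed by $j=0,\dots,2n-2$; its first $n+1$ rows, indexed by $k=0,\dots,n$, have entries $\bar L^j(\rho_z^k\rho_w^{n-k})$, and its last $n-2$ rows, indexed by $s=0,\dots,n-3$, have entries $\bar L^j(\rho_z^s\rho_w^{n-3-s}\rho_{Z^2}(L,L))$. The matrix $D_n=D_n(\rho)$ is the upper left $(n+1)\times(n+1)$ block of $A_n$, i.e. $D_n=(\bar L^j(\rho_z^k\rho_w^{n-k}))_{0\le j\le n,\,0\le k\le n}$. If the coordinate change $H$ is only formal at a reference point of $M$, derivatives of $\rho$ are taken from its Taylor series at that point (note that $\det A_n$, $\det D_n$ at a point depend only on a finite jet of $\rho$ there). *)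

(* Defs.v *)
From HB Require Import structures.
From mathcomp Require Import all_boot all_order all_algebra.
From mathcomp Require Import boolp.
From mathcomp Require mpoly.

Set Implicit Arguments.
Unset Strict Implicit.
Unset Printing Implicit Defensive.

Import GRing.Theory.
Local Open Scope ring_scope.

(* mpoly is imported inside this module only: its notations are incompatible
   with those of the analysis files required below. *)
Module FPS.
Import mpoly.

Section Fps.
Variables (n : nat) (K : comNzRingType).

Record fps := Fps { coef_of :> 'X_{1..n} -> K }.

HB.instance Definition _ := gen_eqMixin fps.
HB.instance Definition _ := gen_choiceMixin fps.

Implicit Types f g h : fps.

Lemma fpsP f g : f =1 g -> f = g.
Proof. by case: f g => [f] [g] /= /funext ->. Qed.

Definition taylor_poly N f : {mpoly K[n]} :=
  \sum_(m : 'X_{1..n < N.+1}) f m *: 'X_[m].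

Definition addf f g := Fps (fun m => f m + g m).
Definition oppf f := Fps (fun m => - f m).
Definition zerof := Fps (fun=> 0).
Definition onef := Fps (fun m => (m == 0%MM)%:R).

Definition mulf f g := Fps (fun m =>
  \sum_(k : 'X_{1..n < (mdeg m).+1, (mdeg m).+1} | m == (k.1 + k.2)%MM)
    f k.1 * g k.2).

Lemma taylor_poly_coef N f m : (mdeg m <= N)%N -> (taylor_poly N f)@_m = f m.
Proof. by move=> mN; rewrite mcoeff_mpoly. Qed.

Lemma mulf_taylor_poly N f g m : (mdeg m <= N)%N ->
  mulf f g m = (taylor_poly N f * taylor_poly N g)@_m.
Proof.
move=> mN; rewrite mcoeffM /=; apply: eq_bigr => k _.
by rewrite !taylor_poly_coef //; apply: leq_trans mN; rewrite -ltnS bmdeg.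
Qed.

Lemma mcoeffM_low N (p q p' q' : {mpoly K[n]}) m :
  (forall k, (mdeg k <= N)%N -> p@_k = p'@_k) ->
  (forall k, (mdeg k <= N)%N -> q@_k = q'@_k) -> (mdeg m <= N)%N ->
  (p * q)@_m = (p' * q')@_m.
Proof.
move=> pp' qq' mN; rewrite !mcoeffM; apply: eq_bigr => k _.
by congr (_ * _); [apply: pp' | apply: qq']; apply: leq_trans mN;
   rewrite -ltnS bmdeg.
Qed.

Fact addfA : associative addf.
Proof. by move=> f g h; apply: fpsP => m /=; rewrite addrA. Qed.
Fact addfC : commutative addf.
Proof. by move=> f g; apply: fpsP => m /=; rewrite addrC. Qed.
Fact add0f : left_id zerof addf.
Proof. by move=> f; apply: fpsP => m /=; rewrite add0r. Qed.
Fact addNf : left_inverse zerof oppf addf.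
Proof. by move=> f; apply: fpsP => m /=; rewrite addNr. Qed.

HB.instance Definition _ :=
  GRing.isZmodule.Build fps addfA addfC add0f addNf.

Fact mulfA : associative mulf.
Proof.
move=> f g h; apply: fpsP => m.
rewrite !(mulf_taylor_poly _ _ (leqnn (mdeg m))).
transitivity ((taylor_poly (mdeg m) f * (taylor_poly (mdeg m) g * taylor_poly (mdeg m) h))@_m).
  apply: (@mcoeffM_low (mdeg m)) => // k km.
  by rewrite taylor_poly_coef // (mulf_taylor_poly _ _ km).
rewrite mulrA; apply: (@mcoeffM_low (mdeg m)) => // k km.
by rewrite taylor_poly_coef // (mulf_taylor_poly _ _ km).
Qed.

Fact mulfC : commutative mulf.
Proof.
by move=> f g; apply: fpsP => m; rewrite !(mulf_taylor_poly _ _ (leqnn _)) mulrC.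
Qed.

Fact mul1f : left_id onef mulf.
Proof.
move=> f; apply: fpsP => m; rewrite (mulf_taylor_poly _ _ (leqnn _)).
rewrite -[RHS](taylor_poly_coef f (leqnn (mdeg m))) -[in RHS](mul1r (taylor_poly _ f)).
apply: (@mcoeffM_low (mdeg m)) => // k km.
by rewrite taylor_poly_coef // mcoeff1.
Qed.

Fact mulfDl : left_distributive mulf addf.
Proof.
move=> f g h; apply: fpsP => m /=; rewrite -big_split.
by apply: eq_bigr => k _; rewrite mulrDl.
Qed.

Fact onef_neq0 : onef != 0.
Proof.
apply/eqP => /(congr1 (fun f : fps => f 0%MM)) /= /eqP.
by rewrite eqxx oner_eq0.
Qed.

HB.instance Definition _ :=
  GRing.Zmodule_isComNzRing.Build fps mulfA mulfC mul1f mulfDl onef_neq0.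

Definition fderiv (i : 'I_n) f := Fps (fun m => f (m + U_(i))%MM *+ (m i).+1).

Definition fps_const f : K := f 0%MM.

Definition fps_centered f := Fps (fun m => if m == 0%MM then 0 else f m).

End Fps.

(* Substitution of the series s_i, which must have zero constant term, for the
   variables of F: the coefficient of a monomial of degree d then depends only
   on the Taylor polynomials of degree d. *)
Definition fps_subst n k (K : comNzRingType)
    (s : 'I_n -> fps k K) (F : fps n K) : fps k K :=
  Fps (fun m =>
    (taylor_poly (mdeg m) F \mPo [tuple taylor_poly (mdeg m) (s i) | i < n])@_m).

Definition mexp n (m : 'X_{1..n}) (i : 'I_n) : nat := m i.

(* Exchange of the exponents of (z, w) and (zbar, wbar). *)
Definition mswap (m : 'X_{1..4}) : 'X_{1..4} :=
  [multinom m (inord ((i + 2) %% 4)) | i < 4].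

End FPS.

Export FPS.

Section Operators.

Record wirtinger (S : comPzRingType) :=
  Wirtinger { d_z : S -> S; d_w : S -> S; d_zb : S -> S; d_wb : S -> S }.

Variables (S : comPzRingType) (d : wirtinger S).
Implicit Types rho f : S.

Definition Lbar rho f : S := - d_wb d rho * d_zb d f + d_zb d rho * d_wb d f.

(* rho_{Z^2}(L, L) for L = - rho_w d_z + rho_z d_w. *)
Definition rhoZ2LL rho : S :=
  d_z d (d_z d rho) * d_w d rho ^+ 2
  - 2%:R * d_w d (d_z d rho) * d_z d rho * d_w d rho
  + d_w d (d_w d rho) * d_z d rho ^+ 2.

(* Column 0 of A_n: the index s of the last n - 2 rows is i - (n + 1). *)
Definition A_col0 n rho (i : nat) : S :=
  if (i <= n)%N then d_z d rho ^+ i * d_w d rho ^+ (n - i)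
  else let s := (i - n.+1)%N in
       d_z d rho ^+ s * d_w d rho ^+ (n - 3 - s) * rhoZ2LL rho.

Definition A_mx n rho : 'M[S]_(2 * n - 1) :=
  \matrix_(i, j) iter j (Lbar rho) (A_col0 n rho i).

Definition D_mx n rho : 'M[S]_(n.+1) :=
  \matrix_(k, j) iter j (Lbar rho) (d_z d rho ^+ k * d_w d rho ^+ (n - k)).

Definition jacobian_det (h1 h2 : S) : S :=
  d_z d h1 * d_w d h2 - d_w d h1 * d_z d h2.

Definition dbar_closed (f : S) := d_zb d f = 0 /\ d_wb d f = 0.

End Operators.

From mathcomp Require Import all_classical all_reals all_analysis.
From mathcomp Require Import complex.
Import numFieldNormedType.Exports.
Local Open Scope classical_set_scope.
Local Open Scope complex_scope.

(* C^2 with its real coordinates (Re z, Im z, Re w, Im w). *)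
Notation C2 R := ('rV[R]_4).

Section Smooth.
Variable R : realType.
Implicit Types (U V M : set (C2 R)) (p : C2 R).

Definition z_of p : R[i] := p 0 (inord 0) +i* p 0 (inord 1).
Definition w_of p : R[i] := p 0 (inord 2) +i* p 0 (inord 3).

Definition partial (i : 'I_4) (f : C2 R -> R) : C2 R -> R :=
  fun p => 'D_(delta_mx 0 i) f p.

(* C^infinity: a function is C^infinity on an open set iff all its iterated
   partial derivatives are (Frechet) differentiable there. *)
Definition smooth U (f : C2 R -> R) :=
  forall (s : seq 'I_4) p, U p -> differentiable (foldr partial f s) p.

Definition cpartial (i : 'I_4) (f : C2 R -> R[i]) : C2 R -> R[i] :=
  fun p => partial i (fun q => complex.Re (f q)) p
           +i* partial i (fun q => complex.Im (f q)) p.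

Definition csmooth U (f : C2 R -> R[i]) :=
  smooth U (fun q => complex.Re (f q)) /\ smooth U (fun q => complex.Im (f q)).

Definition wirtinger_fun : wirtinger (C2 R -> R[i]) := Wirtinger
  (fun f p => (cpartial (inord 0) f p - 'i * cpartial (inord 1) f p) / 2%:R)
  (fun f p => (cpartial (inord 2) f p - 'i * cpartial (inord 3) f p) / 2%:R)
  (fun f p => (cpartial (inord 0) f p + 'i * cpartial (inord 1) f p) / 2%:R)
  (fun f p => (cpartial (inord 2) f p + 'i * cpartial (inord 3) f p) / 2%:R).

Definition toC (f : C2 R -> R) : C2 R -> R[i] := fun p => (f p)%:C.

(* Real smoothness and the Cauchy-Riemann equations. *)
Definition holomorphic U (f : C2 R -> R[i]) :=
  csmooth U f /\
  forall p, U p -> d_zb wirtinger_fun f p = 0 /\ d_wb wirtinger_fun f p = 0.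

Definition holomorphic_map U (H : C2 R -> C2 R) :=
  holomorphic U (z_of \o H) /\ holomorphic U (w_of \o H).

(* H is a holomorphic coordinate system on U, with image V. *)
Definition holomorphic_coordinates U V (H : C2 R -> C2 R) :=
  [/\ open U, open V, holomorphic_map U H, H @` U = V &
      exists G : C2 R -> C2 R,
        holomorphic_map V G /\ forall p, U p -> G (H p) = p].

Definition defining_function U M (rho : C2 R -> R) :=
  [/\ open U, smooth U rho, M = U `&` [set p | rho p = 0] &
      forall p, M p -> exists v, 'd rho p v != 0].

Definition detA n (rho : C2 R -> R) p : R[i] :=
  (\det (A_mx wirtinger_fun n (toC rho))) p.
Definition detD n (rho : C2 R -> R) p : R[i] :=
  (\det (D_mx wirtinger_fun n (toC rho))) p.
Definition jac (H : C2 R -> C2 R) p : R[i] :=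
  jacobian_det wirtinger_fun (z_of \o H) (w_of \o H) p.

End Smooth.

Section Formal.
Variable R : realType.
Local Notation fps4 := (fps 4 R[i]).

(* The variables 0, 1, 2, 3 are z, w, zbar, wbar, relative to a base point. *)
Definition wirtinger_fps : wirtinger fps4 := Wirtinger
  (fderiv (inord 0)) (fderiv (inord 1))
  (fderiv (inord 2)) (fderiv (inord 3)).

Definition taylor (f : C2 R -> R[i]) (p : C2 R) : fps4 :=
  let d := wirtinger_fun R in
  Fps (fun m =>
    let e k := mexp m (inord k) in
    iter (e 0%N) (d_z d) (iter (e 1%N) (d_w d)
      (iter (e 2%N) (d_zb d) (iter (e 3%N) (d_wb d) f))) p
    / ((e 0%N)`! * (e 1%N)`! * (e 2%N)`! * (e 3%N)`!)%:R).

Definition fps_conj (f : fps4) : fps4 := Fps (fun m => (f (mswap m))^*).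

(* z* = h1(Z), w* = h2(Z) are power series in Z = (z, w) alone; their constant
   terms are the coordinates of the image of the base point. *)
Definition formal_coordinates (h1 h2 : fps4) :=
  [/\ dbar_closed wirtinger_fps h1, dbar_closed wirtinger_fps h2 &
      fps_const (jacobian_det wirtinger_fps h1 h2) != 0].

(* The pullback of a series F in (Z*, Zbar* ), centered at the image point. *)
Definition formal_pullback (h1 h2 : fps4) (F : fps4) : fps4 :=
  fps_subst
    (fun i : 'I_4 => fps_centered
       (nth h1 [:: h1; h2; fps_conj h1; fps_conj h2] i)) F.

Definition fdetA n (F : fps4) : R[i] :=
  fps_const (\det (A_mx wirtinger_fps n F)).
Definition fdetD n (F : fps4) : R[i] :=
  fps_const (\det (D_mx wirtinger_fps n F)).
Definition fjac (h1 h2 : fps4) : R[i] :=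
  fps_const (jacobian_det wirtinger_fps h1 h2).

End Formal.

(* Main.v *)
Require Import Defs.
From HB Require Import structures.
From mathcomp Require Import all_boot all_order all_algebra.
From mathcomp Require Import boolp.
From mathcomp Require mpoly.
From mathcomp Require Import ring lra zify.
Import Order.TTheory GRing.Theory Num.Theory.

Set Implicit Arguments.
Unset Strict Implicit.
Unset Printing Implicit Defensive.

Local Open Scope ring_scope.

(** Modulo functions vanishing on [M], the whole construction transforms by
    multiplication with units, and [L] and [Lbar] are tangent to [M], so they do
    not see the functions that are dropped.

    Pull everything back to the source of the coordinate change and let [F] be
    the pulled back defining function, [r] the old one.  Whether [F = a r] or
    [F] is another defining function of [M], the first derivatives of [F] are
    [a] times those of [r] modulo an ideal [I] that is stable under [L] and
    [Lbar] of [r] and is killed by evaluation at the base point.  Three facts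
    follow, all modulo [I].  The operator [Lbar] of [F] is [c Lbar] with
    [c = a / conj delta] ([pull_Lbar]).  The gradient of [F] is [a] times a
    matrix of holomorphic functions, of determinant [1 / delta], applied to
    [(x, y) = (r_z, r_w)] ([pull_z], [pull_w]).  Lastly
    [rhoZ2LL F = a^3 (delta^-2 rhoZ2LL r + C)], where [C] is a cubic form in
    [x, y] with holomorphic coefficients: it is the term by which the Hessian
    fails to be a tensor ([pull_rhoZ2LL]).

    Hence the first column of the new matrix is [a^n T] times the first column
    of the old one.  For [D_n], [T] is the [n]-th symmetric power of the
    gradient matrix; for [A_n] it is block triangular with blocks [Sym^n] and
    [delta^-2 Sym^(n-3)].  The entries of [T] are holomorphic, so [Lbar] treats
    them as constants, and the powers [(c Lbar)^j] of a scaled derivation differ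
    from the [Lbar^j] by a triangular change of columns with diagonal
    [c^j a^n] ([det_pullback]).  The determinant of the symmetric power is a
    power of the determinant ([det_sym_coef]); counting exponents gives the two
    formulas ([det_D_pullback], [det_A_pullback]).

    This algebra is carried out in the ring of formal power series at a point,
    which serves the formal coordinate changes directly
    ([formal_transformation]).  Smooth data enter through their Taylor series:
    [taylor] is multiplicative, commutes with the Wirtinger derivatives, and
    turns composition with [H] into substitution of series ([taylorM],
    [taylor_fderiv], [taylor_comp]), each by comparison of derivatives, degree
    by degree.  For two defining functions of the same [M], the ideal [I] is
    controlled by the fact that a smooth function vanishing on [M] has
    differential proportional to that of the defining function along [M]
    ([tangent_vanish], [tangent_ideal_vanish]). *)

(** * Determinants of matrices with entries indexed by natural numbers *)

Section MatrixOfNatFunction.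
Variable R : comNzRingType.
Implicit Types (E : nat -> nat -> R).

(** Entries are functions of natural numbers so that the equality
    [2 * n - 1 = n.+1 + (n - 2)] of dimensions needs no cast. *)
Definition nat_mx N E : 'M[R]_N := \matrix_(i, j) E i j.

Lemma det_nat_mx_lblock a b E :
  (forall i j, (i < a)%N -> (a <= j < a + b)%N -> E i j = 0) ->
  \det (nat_mx (a + b) E) =
    \det (nat_mx a E) * \det (nat_mx b (fun i j => E (a + i)%N (a + j)%N)).
Proof.
move=> E0; rewrite -(det_lblock _ (\matrix_(i, j) E (a + i)%N j)).
congr (\det _); apply/matrixP => i j; rewrite mxE.
by case: (split_ordP i) => i' ->; case: (split_ordP j) => j' ->;
  rewrite ?block_mxEul ?block_mxEur ?block_mxEdl ?block_mxEdr !mxE //=;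
  apply: E0 => //; rewrite leq_addr ltn_add2l /=.
Qed.

Lemma det_nat_mx_utrig N E : (forall i j, (j < i < N)%N -> E i j = 0) ->
  \det (nat_mx N E) = \prod_(i < N) E i i.
Proof.
move=> E0; rewrite -det_tr det_trig.
  by apply: eq_bigr => i _; rewrite !mxE.
by apply/is_trig_mxP => i j ij; rewrite !mxE E0 // ij ltn_ord.
Qed.

End MatrixOfNatFunction.

(** * Symmetric powers of a two by two matrix *)

Section SymmetricPower.

(** Row [i] of the [n]-th symmetric power of the matrix with rows [(al, be)]
    and [(ga, ep)], on the basis of monomials, dehomogenised. *)
Definition sym_coef (R : comNzRingType) (al be ga ep : R) n i k : R :=
  ((al *: 'X + be%:P) ^+ i * (ga *: 'X + ep%:P) ^+ (n - i))`_k.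

Lemma size_lin (R : comNzRingType) (a b : R) : (size (a *: 'X + b%:P)%R <= 2)%N.
Proof.
rewrite (leq_trans (size_polyD _ _)) // geq_max.
rewrite (leq_trans (size_scale_leq _ _)) ?size_polyX //.
by rewrite (leq_trans (size_polyC_leq1 _)).
Qed.

Lemma size_lin_exp (R : comNzRingType) (a b : R) i :
  (size ((a *: 'X + b%:P) ^+ i)%R <= i.+1)%N.
Proof.
rewrite (leq_trans (size_poly_exp_leq _ _)) // ltnS.
rewrite -[leqRHS]mul1n leq_mul2r; apply/orP; right.
by have := size_lin a b; case: (size _).
Qed.

Lemma size_sym_poly (R : comNzRingType) (al be ga ep : R) n i : (i <= n)%N ->
  (size ((al *: 'X + be%:P) ^+ i * (ga *: 'X + ep%:P) ^+ (n - i))%R <= n.+1)%N.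
Proof.
move=> ni; rewrite (leq_trans (size_polyMleq _ _)) //.
have h1 := size_lin_exp al be i; have h2 := size_lin_exp ga ep (n - i).
have := leq_add h1 h2; rewrite addSn addnS subnKC //.
by case: (_ + _)%N.
Qed.

(** Every index lies in exactly [n] of the pairs. *)
Lemma prod_lt_pairs (R : comNzRingType) n (v : 'I_n.+1 -> R) :
  \prod_(i < n.+1) \prod_(j < n.+1 | (i < j)%N) (v i * v j) =
  \prod_(i < n.+1) v i ^+ n.
Proof.
under eq_bigr do rewrite big_split /=.
rewrite big_split /= [X in _ * X](exchange_big_dep predT) //= -big_split /=.
apply: eq_bigr => i _; rewrite !prodr_const -exprD; congr (_ ^+ _).
change (#|[pred j : 'I_n.+1 | (i < j)%N]| + #|[pred j : 'I_n.+1 | (j < i)%N]|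
  = n)%N.
transitivity #|predC1 i|; last by rewrite cardC1 card_ord.
rewrite -cardUI addnC [X in (X + _)%N]eq_card0 ?add0n => [|j]; last first.
  by rewrite !inE; case: ltngtP.
by apply: eq_card => j; rewrite !inE -(inj_eq val_inj) /=; case: ltngtP.
Qed.

Lemma prod_lt_pairs_const (R : comNzRingType) n (D : R) :
  \prod_(i < n.+1) \prod_(j < n.+1 | (i < j)%N) D = D ^+ 'C(n.+1, 2).
Proof.
under eq_bigr do rewrite prodr_const.
rewrite -expr_sum -bin2_sum big_mkord; congr (_ ^+ _).
rewrite (reindex_inj rev_ord_inj) /=; apply: eq_bigr => i _.
change (#|[pred j : 'I_n.+1 | (n - i < j)%N]| = i); rewrite -[RHS]card_ord.
have lt_j (j : 'I_i) : (n - i + j.+1 < n.+1)%N.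
  by have := ltn_ord i; have := ltn_ord j; lia.
rewrite -(card_imset _ (f := fun j : 'I_i => Ordinal (lt_j j))); last first.
  by move=> j k [/eqP]; rewrite eqn_add2l eqSS => /eqP /val_inj.
apply: eq_card => k; rewrite inE; apply/idP/imsetP => [ik | [j _ ->]]; last first.
  by rewrite /= addnS ltnS leq_addr.
have kj : (k - (n - i).+1 < i)%N.
  by have := ltn_ord k; have := ltn_ord i; lia.
exists (Ordinal kj) => //; apply: val_inj => /=.
by lia.
Qed.

(** Multiplying by a Vandermonde matrix on the right evaluates the rows at its
    nodes [t j]; this gives a second Vandermonde matrix, on the images of the
    nodes under the homography [(al t + be) / (ga t + ep)], with columns scaled
    by [(ga t + ep)^n].  A difference of images is the difference of the nodes
    times the determinant, up to these denominators, which cancel. *)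
Lemma det_sym_coef (K : numFieldType) (al be ga ep : K) n :
  al * ep - be * ga != 0 ->
  \det (nat_mx n.+1 (sym_coef al be ga ep n)) =
    (al * ep - be * ga) ^+ 'C(n.+1, 2).
Proof.
set D := _ - _ => D0.
(* Nodes avoiding the pole of the homography. *)
have [t [t_inj v_neq0]] : exists t : nat -> K,
    injective t /\ forall j, ga * t j + ep != 0.
  have [g0|g0] := eqVneq ga 0.
    exists (fun j => j%:R); split; first by move=> i j /eqP; rewrite eqr_nat => /eqP.
    move=> j; rewrite g0 mul0r add0r; apply: contra_neq D0 => e0.
    by rewrite /D g0 e0 !mulr0 subrr.
  exists (fun j => (j.+1%:R - ep) / ga); split.
    move=> i j /(mulIf (invr_neq0 g0)) /addIr /eqP.
    by rewrite eqr_nat => /eqP [].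
  by move=> j; rewrite mulrC divfK // subrK pnatr_eq0.
pose v j := ga * t j + ep.
pose s j := (al * t j + be) / v j.
pose rt : 'rV[K]_n.+1 := \row_j t j; pose rs : 'rV[K]_n.+1 := \row_j s j.
have TV : nat_mx n.+1 (sym_coef al be ga ep n) *m Vandermonde n.+1 rt =
    Vandermonde n.+1 rs *m diag_mx (\row_j v j ^+ n).
  apply/matrixP => i j; rewrite mul_mx_diag !mxE.
  under eq_bigr do rewrite !mxE /sym_coef.
  rewrite -(horner_coef_wide (t j) (size_sym_poly _ _ _ _ _)) -1?ltnS //.
  rewrite hornerM !horner_exp !hornerE exprMn exprVn -/(v j).
  have vn : v j ^+ i \is a GRing.unit by rewrite unitfE expf_neq0 ?v_neq0.
  rewrite -mulrA; congr (_ * _).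
  by rewrite -[n in v j ^+ n](@subnKC i) -1?ltnS // exprD mulKr.
have := congr1 determinant TV.
rewrite !det_mulmx !det_Vandermonde det_diag.
have V0 : \prod_(i < n.+1) \prod_(j < n.+1 | (i < j)%N) (rt 0 j - rt 0 i) != 0.
  apply/prodf_neq0 => i _; apply/prodf_neq0 => j ij; rewrite !mxE subr_eq0.
  by apply/eqP => /t_inj ji; rewrite ji ltnn in ij.
move=> dTV; apply: (mulIf V0); rewrite dTV.
under [X in _ * X]eq_bigr do rewrite mxE.
rewrite -prod_lt_pairs -prod_lt_pairs_const -!big_split /=.
apply: eq_bigr => i _; rewrite -!big_split; apply: eq_bigr => j _ /=.
rewrite !mxE /s.
have vi0 := v_neq0 i; have vj0 := v_neq0 j; rewrite -!/(v _) in vi0 vj0.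
apply: (@etrans _ _ ((al * t j + be) * v i - (al * t i + be) * v j)).
  by field; rewrite vi0 vj0.
by rewrite /v /D; ring.
Qed.

End SymmetricPower.

(** * Derivations, and the operators L and Lbar *)

Section Derivations.
Variable S : comPzRingType.

Record derivation (D : S -> S) : Prop := Derivation {
  derD : forall f g, D (f + g) = D f + D g;
  derM : forall f g, D (f * g) = D f * g + f * D g }.

Variables (D : S -> S) (DD : derivation D).

Lemma der0 : D 0 = 0.
Proof. by apply: (addrI (D 0)); rewrite -(derD DD) !addr0. Qed.

Lemma der1 : D 1 = 0.
Proof.
have := derM DD 1 1; rewrite !mulr1 mul1r => /(congr1 (fun v => v - D 1)).
by rewrite addrK subrr.
Qed.

Lemma derN f : D (- f) = - D f.
Proof. by apply: (addrI (D f)); rewrite -(derD DD) !subrr der0. Qed.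

Lemma derB f g : D (f - g) = D f - D g.
Proof. by rewrite (derD DD) derN. Qed.

Lemma der_sum N (f : 'I_N -> S) : D (\sum_i f i) = \sum_i D (f i).
Proof. exact: (big_morph D (derD DD) der0). Qed.

Lemma der_invr f g : f * g = 1 -> D f = 0 -> D g = 0.
Proof.
move=> fg1 Df; have := derM DD f g; rewrite fg1 der1 Df mul0r add0r => /esym fDg.
by rewrite -[LHS]mul1r -fg1 mulrAC fDg mul0r.
Qed.

Record commuting_wirtinger (d : wirtinger S) : Prop := CommutingWirtinger {
  der_z : derivation (d_z d);
  der_w : derivation (d_w d);
  der_zb : derivation (d_zb d);
  der_wb : derivation (d_wb d);
  der_zw : forall f, d_z d (d_w d f) = d_w d (d_z d f);
  der_zzb : forall f, d_z d (d_zb d f) = d_zb d (d_z d f);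
  der_zwb : forall f, d_z d (d_wb d f) = d_wb d (d_z d f);
  der_wzb : forall f, d_w d (d_zb d f) = d_zb d (d_w d f);
  der_wwb : forall f, d_w d (d_wb d f) = d_wb d (d_w d f) }.

Definition bar_wirtinger (d : wirtinger S) : wirtinger S :=
  Wirtinger (d_zb d) (d_wb d) (d_z d) (d_w d).

(** Conjugation exchanges [L] and [Lbar], so facts about one serve for both. *)
Definition Lhol (d : wirtinger S) := Lbar (bar_wirtinger d).

Lemma LbarD_der (d : wirtinger S) rho :
  derivation (d_zb d) -> derivation (d_wb d) -> derivation (Lbar d rho).
Proof.
by move=> [zD zM] [wD wM]; split=> f g; rewrite /Lbar ?(zD, wD, zM, wM); ring.
Qed.

Lemma Lbar_self (d : wirtinger S) rho : Lbar d rho rho = 0.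
Proof. by rewrite /Lbar; ring. Qed.

(** In this form first derivatives are differentiated along [L] only, so the
    transformation of the Hessian term follows from those of [L] and of the
    gradient. *)
Lemma rhoZ2LL_Lhol (d : wirtinger S) rho :
  d_z d (d_w d rho) = d_w d (d_z d rho) ->
  rhoZ2LL d rho =
    Lhol d rho (d_w d rho) * d_z d rho - Lhol d rho (d_z d rho) * d_w d rho.
Proof. by move=> zw; rewrite /rhoZ2LL /Lhol /Lbar /= zw; ring. Qed.

End Derivations.

Section DbarClosed.
Variables (S : comPzRingType) (d : wirtinger S) (dW : commuting_wirtinger d).

Lemma dbar_closedD f g : dbar_closed d f -> dbar_closed d g ->
  dbar_closed d (f + g).
Proof.
move=> [fz fw] [gz gw].
by split; rewrite (derD (der_zb dW), derD (der_wb dW)) ?fz ?gz ?fw ?gw addr0.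
Qed.

Lemma dbar_closedM f g : dbar_closed d f -> dbar_closed d g ->
  dbar_closed d (f * g).
Proof.
move=> [fz fw] [gz gw].
by split; rewrite (derM (der_zb dW), derM (der_wb dW)) ?fz ?gz ?fw ?gw
  mul0r mulr0 addr0.
Qed.

Lemma dbar_closedN f : dbar_closed d f -> dbar_closed d (- f).
Proof.
move=> [fz fw].
by split; rewrite (derN (der_zb dW), derN (der_wb dW)) ?fz ?fw oppr0.
Qed.

Lemma dbar_closed0 : dbar_closed d 0.
Proof. by split; rewrite (der0 (der_zb dW), der0 (der_wb dW)). Qed.

Lemma dbar_closed1 : dbar_closed d 1.
Proof. by split; rewrite (der1 (der_zb dW), der1 (der_wb dW)). Qed.

Lemma dbar_closed_z f : dbar_closed d f -> dbar_closed d (d_z d f).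
Proof.
move=> [fz fw]; split.
  by rewrite -(der_zzb dW) fz (der0 (der_z dW)).
by rewrite -(der_zwb dW) fw (der0 (der_z dW)).
Qed.

Lemma dbar_closed_w f : dbar_closed d f -> dbar_closed d (d_w d f).
Proof.
move=> [fz fw]; split.
  by rewrite -(der_wzb dW) fz (der0 (der_w dW)).
by rewrite -(der_wwb dW) fw (der0 (der_w dW)).
Qed.

Lemma dbar_closed_invr f g : f * g = 1 -> dbar_closed d f -> dbar_closed d g.
Proof.
move=> fg [fz fw].
by split; [apply: (der_invr (der_zb dW) fg) | apply: (der_invr (der_wb dW) fg)].
Qed.

(** This is why holomorphic factors can be taken out of the columns. *)
Lemma Lbar_dbar_closed rho f : dbar_closed d f -> Lbar d rho f = 0.
Proof. by move=> [fz fw]; rewrite /Lbar fz fw !mulr0 addr0. Qed.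

End DbarClosed.

(** * Binary forms in the gradient *)

Section BinaryForms.
Variables (S : comNzRingType) (x y : S).

Implicit Types p q : {poly S}.

(** The homogenisation of [p] in degree [n], evaluated at [(x, y)]. *)
Definition binary_form n (p : {poly S}) : S :=
  \sum_(k < n.+1) p`_k * (x ^+ k * y ^+ (n - k)).

Lemma binary_formD n p q :
  binary_form n (p + q) = binary_form n p + binary_form n q.
Proof.
by rewrite -big_split; apply: eq_bigr => k _; rewrite coefD mulrDl.
Qed.

Lemma binary_formZ n c p : binary_form n (c *: p) = c * binary_form n p.
Proof. by rewrite mulr_sumr; apply: eq_bigr => k _; rewrite coefZ mulrA. Qed.

Lemma binary_formX n p : binary_form n.+1 (p * 'X) = x * binary_form n p.
Proof.
rewrite /binary_form big_ord_recl coefMX mul0r add0r mulr_sumr.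
by apply: eq_bigr => k _; rewrite coefMX /= subSS exprS; ring.
Qed.

Lemma binary_form_raise n p : (size p <= n.+1)%N ->
  binary_form n.+1 p = y * binary_form n p.
Proof.
move=> sp; rewrite /binary_form big_ord_recr /= nth_default // mul0r addr0.
rewrite mulr_sumr; apply: eq_bigr => k _.
by rewrite subSn -1?ltnS // exprS; ring.
Qed.

Lemma binary_form0 p : binary_form 0 p = p`_0.
Proof. by rewrite /binary_form big_ord_recl big_ord0 subnn !mulr1 addr0. Qed.

Lemma binary_form_lin n a b p : (size p <= n.+1)%N ->
  binary_form n.+1 ((a *: 'X + b%:P) * p) = (a * x + b * y) * binary_form n p.
Proof.
move=> sp; rewrite mulrDl -scalerAl ['X * p]mulrC mul_polyC.
by rewrite binary_formD !binary_formZ binary_formX binary_form_raise //; ring.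
Qed.

Lemma binary_form_lin_exp n a b i p : (size p <= n.+1)%N ->
  binary_form (i + n) ((a *: 'X + b%:P) ^+ i * p) =
    (a * x + b * y) ^+ i * binary_form n p.
Proof.
move=> sp; elim: i => [|i IH]; first by rewrite !mul1r.
rewrite exprS -mulrA addSn binary_form_lin ?IH 1?exprS ?mulrA //.
rewrite (leq_trans (size_polyMleq _ _)) //.
have := size_lin_exp a b i; move: (size _) (size p) sp => u v; lia.
Qed.

Lemma binary_form_sym al be ga ep n i : (i <= n)%N ->
  (al * x + be * y) ^+ i * (ga * x + ep * y) ^+ (n - i) =
  \sum_(k < n.+1) sym_coef al be ga ep n i k * (x ^+ k * y ^+ (n - k)).
Proof.
move=> ni; rewrite -[RHS]/(binary_form n ((al *: 'X + be%:P) ^+ i *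
  (ga *: 'X + ep%:P) ^+ (n - i))).
have := binary_form_lin_exp al be i (size_lin_exp ga ep (n - i)).
rewrite subnKC // => ->; congr (_ * _).
have := @binary_form_lin_exp 0 ga ep (n - i) 1.
rewrite size_poly1 addn0 mulr1 => -> //.
by rewrite binary_form0 coef1 mulr1.
Qed.

(** Only the existence of coefficients matters for the cubic term of the Hessian:
    it fills the off-diagonal block of a triangular matrix. *)
Definition form_in (Q : S -> Prop) n (v : S) :=
  exists2 p : nat -> S, (forall k, Q (p k)) &
    v = \sum_(k < n.+1) p k * (x ^+ k * y ^+ (n - k)).

Variables (Q : S -> Prop) (Q0 : Q 0) (QD : forall a b, Q a -> Q b -> Q (a + b))
  (QM : forall a b, Q a -> Q b -> Q (a * b)).

Lemma form_inD n u v : form_in Q n u -> form_in Q n v -> form_in Q n (u + v).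
Proof.
move=> [p Qp ->] [q Qq ->]; exists (fun k => p k + q k); first by move=> k; exact: QD.
by rewrite -big_split; apply: eq_bigr => k _ /=; rewrite -mulrDl.
Qed.

Lemma form_inZ n c v : Q c -> form_in Q n v -> form_in Q n (c * v).
Proof.
move=> Qc [p Qp ->]; exists (fun k => c * p k); first by move=> k; exact: QM.
by rewrite mulr_sumr; apply: eq_bigr => k _; rewrite mulrA.
Qed.

Lemma form_in_const c : Q c -> form_in Q 0 c.
Proof.
move=> Qc; exists (fun=> c) => //.
by rewrite big_ord_recl big_ord0 subnn !mulr1 addr0.
Qed.

Lemma form_inX n v : form_in Q n v -> form_in Q n.+1 (x * v).
Proof.
move=> [p Qp ->]; exists (fun k => if k is k'.+1 then p k' else 0).
  by case.
rewrite [RHS]big_ord_recl /= mul0r add0r mulr_sumr.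
by apply: eq_bigr => k _ /=; rewrite subSS exprS; ring.
Qed.

Lemma form_inY n v : form_in Q n v -> form_in Q n.+1 (y * v).
Proof.
move=> [p Qp ->]; exists (fun k => if (k <= n)%N then p k else 0).
  by move=> k; case: ifP.
rewrite [RHS]big_ord_recr /= ltnn mul0r addr0 mulr_sumr.
apply: eq_bigr => k _ /=; rewrite -ltnS ltn_ord subSn -1?ltnS // exprS; ring.
Qed.

Lemma form_in_lin n a b v : Q a -> Q b -> form_in Q n v ->
  form_in Q n.+1 ((a * x + b * y) * v).
Proof.
move=> Qa Qb fv; rewrite mulrDl -!mulrA.
by apply: form_inD; apply: form_inZ => //; [apply: form_inX | apply: form_inY].
Qed.

Lemma form_in_lin_exp n a b i v : Q a -> Q b -> form_in Q n v ->
  form_in Q (i + n) ((a * x + b * y) ^+ i * v).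
Proof.
move=> Qa Qb fv; elim: i => [|i IH]; first by rewrite mul1r.
by rewrite exprS -mulrA addSn; apply: form_in_lin.
Qed.

End BinaryForms.

(** * Transformation of the determinants modulo a tangential ideal *)

Record is_ideal (S : comPzRingType) (I : S -> Prop) : Prop := IsIdeal {
  ideal0 : I 0;
  idealD : forall f g, I f -> I g -> I (f + g);
  idealM : forall f g, I f -> I (g * f) }.

Section IteratedScaledDerivation.
Variables (S : comPzRingType) (D : S -> S) (DD : derivation D) (c u : S).

(** The coefficients of [(c D)^j \o u] on the powers of [D].  They form a
    triangular array whose diagonal is the only part that determinants see. *)
Fixpoint scaled_iter_coef j : nat -> S :=
  if j is j'.+1 then fun l =>
    c * (D (scaled_iter_coef j' l)
         + (if l is l'.+1 then scaled_iter_coef j' l' else 0))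
  else fun l => if l == 0 then u else 0.

Lemma scaled_iter_coef_gt j l : (j < l)%N -> scaled_iter_coef j l = 0.
Proof.
elim: j l => [|j IH] [|l] //= jl.
by rewrite !IH ?(der0 DD) ?addr0 ?mulr0 // ltnW.
Qed.

Lemma scaled_iter_coef_diag j : scaled_iter_coef j j = c ^+ j * u.
Proof.
elim: j => [|j IH] /=; first by rewrite mul1r.
by rewrite scaled_iter_coef_gt // (der0 DD) add0r IH exprS mulrA.
Qed.

Lemma scaled_iterE N j g : (j < N)%N ->
  iter j (fun f => c * D f) (u * g) =
    \sum_(l < N) scaled_iter_coef j l * iter l D g.
Proof.
case: N => // N; elim: j => [|j IH] jN.
  rewrite big_ord_recl /= big1 ?addr0 // => i _; exact: mul0r.
rewrite iterS IH 1?ltnW // (der_sum DD).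
under eq_bigr do rewrite (derM DD).
rewrite big_split /= [X in _ + X]big_ord_recr /= scaled_iter_coef_gt //.
rewrite mul0r addr0.
under [RHS]eq_bigr do rewrite -mulrA mulrDl.
rewrite -mulr_sumr big_split /=; congr (c * (_ + _)).
by rewrite [RHS]big_ord_recl mul0r add0r.
Qed.

Lemma iter_scaled_lin N j (T : nat -> S) (g : nat -> S) :
  (forall k, (k < N)%N -> D (T k) = 0) ->
  iter j (fun f => c * D f) (\sum_(k < N) T k * g k) =
    \sum_(k < N) T k * iter j (fun f => c * D f) (g k).
Proof.
move=> T0; elim: j => // j IH; rewrite iterS IH (der_sum DD) mulr_sumr.
by apply: eq_bigr => k _; rewrite (derM DD) T0 // mul0r add0r mulrCA.
Qed.

End IteratedScaledDerivation.

Section Pullback.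
Variables (K : numFieldType) (S S' : comNzRingType).
Variables (d : wirtinger S) (d' : wirtinger S').
Variables (P : {rmorphism S' -> S}) (kappa : {rmorphism S -> K}).
Variables (h1 h2 k1 k2 r a e eb : S) (F : S') (I : S -> Prop).

Hypothesis dW : commuting_wirtinger d.
Hypothesis F_zw : d_z d' (d_w d' F) = d_w d' (d_z d' F).
Hypothesis (h1_hol : dbar_closed d h1) (h2_hol : dbar_closed d h2).

Hypothesis chain_z : forall f,
  d_z d (P f) = P (d_z d' f) * d_z d h1 + P (d_w d' f) * d_z d h2.
Hypothesis chain_w : forall f,
  d_w d (P f) = P (d_z d' f) * d_w d h1 + P (d_w d' f) * d_w d h2.
Hypothesis chain_zb : forall f,
  d_zb d (P f) = P (d_zb d' f) * d_zb d k1 + P (d_wb d' f) * d_zb d k2.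
Hypothesis chain_wb : forall f,
  d_wb d (P f) = P (d_zb d' f) * d_wb d k1 + P (d_wb d' f) * d_wb d k2.

Let delta := jacobian_det d h1 h2.
Let deltab := jacobian_det (bar_wirtinger d) k1 k2.
Hypothesis (e_inv : delta * e = 1) (eb_inv : deltab * eb = 1).

Hypothesis (I_ideal : is_ideal I).
Hypothesis (I_Lbar : forall f, I f -> I (Lbar d r f)).
Hypothesis (I_Lhol : forall f, I f -> I (Lhol d r f)).
Hypothesis (I_kappa : forall f, I f -> kappa f = 0).

Hypothesis I_z : I (d_z d (P F) - a * d_z d r).
Hypothesis I_w : I (d_w d (P F) - a * d_w d r).
Hypothesis I_zb : I (d_zb d (P F) - a * d_zb d r).
Hypothesis I_wb : I (d_wb d (P F) - a * d_wb d r).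

Local Notation "f ≡ g" := (I (f - g)) (at level 70).
Local Notation x := (d_z d r).
Local Notation y := (d_w d r).
Local Notation L := (Lhol d r).
Local Notation Lb := (Lbar d r).
Local Notation c := (a * eb).

Let Lb_der : derivation Lb.
Proof. exact: LbarD_der _ (der_zb dW) (der_wb dW). Qed.
Let L_der : derivation L.
Proof. exact: (@LbarD_der _ (bar_wirtinger d) _ (der_z dW) (der_w dW)). Qed.

Let eqI_refl f : f ≡ f.
Proof. by rewrite subrr; apply: ideal0. Qed.

Let eqI_eq f g : f = g -> f ≡ g.
Proof. by move=> ->. Qed.

Let eqI_trans g f h : f ≡ g -> g ≡ h -> f ≡ h.
Proof.
move=> fg gh; have -> : f - h = (f - g) + (g - h) by ring.
exact: idealD.
Qed.

Let eqI_D f g f' g' : f ≡ f' -> g ≡ g' -> f + g ≡ f' + g'.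
Proof.
move=> fg gh; have -> : f + g - (f' + g') = (f - f') + (g - g') by ring.
exact: idealD.
Qed.

Let eqI_M f g f' g' : f ≡ f' -> g ≡ g' -> f * g ≡ f' * g'.
Proof.
move=> fg gh.
have -> : f * g - (f' * g') = g * (f - f') + f' * (g - g') by ring.
by apply: (idealD I_ideal); apply: (idealM I_ideal).
Qed.

Let eqI_B f g f' g' : f ≡ f' -> g ≡ g' -> f - g ≡ f' - g'.
Proof.
move=> fg gh; rewrite -[- g]mulN1r -[- g']mulN1r.
by apply: eqI_D => //; apply: eqI_M.
Qed.

Let eqI_X f f' n : f ≡ f' -> f ^+ n ≡ f' ^+ n.
Proof.
move=> ff; elim: n => [|n IH]; first exact: eqI_refl.
by rewrite !exprS; apply: eqI_M.
Qed.

Let eqI_L f f' : f ≡ f' -> L f ≡ L f'.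
Proof. by move=> ff; rewrite -(derB L_der); apply: I_Lhol. Qed.

Let eqI_Lb f f' : f ≡ f' -> Lb f ≡ Lb f'.
Proof. by move=> ff; rewrite -(derB Lb_der); apply: I_Lbar. Qed.

Let eqI_kappa f g : f ≡ g -> kappa f = kappa g.
Proof. by move=> /I_kappa /eqP; rewrite rmorphB subr_eq0 => /eqP. Qed.

(** Both sides are two by two determinants of derivatives; the chain rule
    multiplies such a determinant by the Jacobian [deltab], which [eb] inverts. *)
Lemma pull_Lbar f : P (Lbar d' F f) ≡ c * Lb (P f).
Proof.
apply: (@eqI_trans (eb * Lbar d (P F) (P f))).
  apply: eqI_eq; rewrite -[LHS]mul1r -eb_inv /Lbar !(chain_zb, chain_wb).
  by rewrite rmorphD !rmorphM rmorphN /deltab /jacobian_det /=; ring.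
rewrite [_ * eb]mulrC -mulrA; apply: eqI_M => //.
have -> : a * Lb (P f) = - (a * d_wb d r) * d_zb d (P f)
    + a * d_zb d r * d_wb d (P f) by rewrite /Lbar; ring.
rewrite /Lbar; apply: eqI_D; apply: eqI_M => //.
by rewrite -mulN1r -[- (a * _)]mulN1r; apply: eqI_M.
Qed.

Lemma pull_Lhol f : P (Lhol d' F f) ≡ e * a * L (P f).
Proof.
apply: (@eqI_trans (e * Lhol d (P F) (P f))).
  apply: eqI_eq; rewrite -[LHS]mul1r -e_inv /Lhol /Lbar /= !(chain_z, chain_w).
  by rewrite rmorphD !rmorphM rmorphN /delta /jacobian_det /=; ring.
rewrite -mulrA; apply: eqI_M => //.
have -> : a * L (P f) = - (a * d_w d r) * d_z d (P f)
    + a * d_z d r * d_w d (P f) by rewrite /Lhol /Lbar /=; ring.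
rewrite /Lhol /Lbar /=; apply: eqI_D; apply: eqI_M => //.
by rewrite -mulN1r -[- (a * _)]mulN1r; apply: eqI_M.
Qed.

Lemma pull_iter_Lbar j f g : P f ≡ g ->
  P (iter j (Lbar d' F) f) ≡ iter j (fun v => c * Lb v) g.
Proof.
move=> fg; elim: j => //= j IH; apply: eqI_trans (pull_Lbar _) _.
by apply: eqI_M => //; apply: eqI_Lb.
Qed.

(** The new matrix is congruent to [T * old * W], where [W] is the triangular
    array of [scaled_iter_coef]. *)
Lemma det_pullback N (f : nat -> S') (g : nat -> S) (T : nat -> nat -> S) u :
  (forall i, (i < N)%N -> P (f i) ≡ \sum_(k < N) T i k * (u * g k)) ->
  (forall i k, (i < N)%N -> (k < N)%N -> Lb (T i k) = 0) ->
  kappa (P (\det (nat_mx N (fun i j => iter j (Lbar d' F) (f i))))) =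
    kappa (\det (nat_mx N T)) * (kappa c ^+ 'C(N, 2) * kappa u ^+ N)
    * kappa (\det (nat_mx N (fun i j => iter j Lb (g i)))).
Proof.
move=> fT T0; pose W l j := scaled_iter_coef Lb c u j l.
have detW : kappa (\det (nat_mx N W)) = kappa c ^+ 'C(N, 2) * kappa u ^+ N.
  rewrite det_nat_mx_utrig; last first.
    by move=> i j /andP[ji _]; apply: scaled_iter_coef_gt.
  under eq_bigr do rewrite /W scaled_iter_coef_diag //.
  rewrite rmorph_prod -bin2_sum big_mkord.
  under eq_bigr do rewrite rmorphM rmorphXn.
  by rewrite big_split /= prodr_const card_ord -expr_sum.
rewrite -detW -mulrA [X in _ * X]mulrC -!rmorphM -!det_mulmx -!det_map_mx.
congr (\det _); apply/matrixP => i j; rewrite 3!mxE [in RHS]mxE.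
apply: eqI_kappa; rewrite mxE.
apply: eqI_trans (pull_iter_Lbar _ (fT _ (ltn_ord i))) _; apply: eqI_eq.
rewrite (iter_scaled_lin Lb_der _ _ (fun k => u * g k)); last first.
  by move=> k; apply: T0.
apply: eq_bigr => k _; rewrite !mxE (scaled_iterE Lb_der _ _ _ (ltn_ord j)).
by congr (_ * _); apply: eq_bigr => l _; rewrite !mxE mulrC.
Qed.

Local Notation al := (e * d_w d h2).
Local Notation be := (- (e * d_z d h2)).
Local Notation ga := (- (e * d_w d h1)).
Local Notation ep := (e * d_z d h1).

Let e_hol : dbar_closed d e.
Proof.
apply: (dbar_closed_invr dW e_inv); apply: (dbar_closedD dW).
  by apply: (dbar_closedM dW); [apply: (dbar_closed_z dW) | apply: (dbar_closed_w dW)].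
apply: (dbar_closedN dW).
by apply: (dbar_closedM dW); [apply: (dbar_closed_w dW) | apply: (dbar_closed_z dW)].
Qed.

Let al_hol : dbar_closed d al.
Proof. exact (dbar_closedM dW e_hol (dbar_closed_w dW h2_hol)). Qed.
Let be_hol : dbar_closed d be.
Proof.
exact (dbar_closedN dW (dbar_closedM dW e_hol (dbar_closed_z dW h2_hol))).
Qed.
Let ga_hol : dbar_closed d ga.
Proof.
exact (dbar_closedN dW (dbar_closedM dW e_hol (dbar_closed_w dW h1_hol))).
Qed.
Let ep_hol : dbar_closed d ep.
Proof. exact (dbar_closedM dW e_hol (dbar_closed_z dW h1_hol)). Qed.

Let sub_det : al * ep - be * ga = e.
Proof.
by rewrite -[RHS]mulr1 -e_inv /delta /jacobian_det; ring.
Qed.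

(** Cramer rule for the chain rule of the first derivatives. *)
Lemma pull_z : P (d_z d' F) ≡ a * (al * x + be * y).
Proof.
have -> : P (d_z d' F) = al * d_z d (P F) + be * d_w d (P F).
  rewrite -[LHS]mul1r -e_inv chain_z chain_w /delta /jacobian_det; ring.
rewrite mulrDr [a * (al * x)]mulrCA [a * (be * y)]mulrCA.
by apply: eqI_D; apply: eqI_M.
Qed.

Lemma pull_w : P (d_w d' F) ≡ a * (ga * x + ep * y).
Proof.
have -> : P (d_w d' F) = ga * d_z d (P F) + ep * d_w d (P F).
  rewrite -[LHS]mul1r -e_inv chain_z chain_w /delta /jacobian_det; ring.
rewrite mulrDr [a * (ga * x)]mulrCA [a * (ep * y)]mulrCA.
by apply: eqI_D; apply: eqI_M.
Qed.

Lemma pull_monomial n i : (i <= n)%N ->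
  P (d_z d' F ^+ i * d_w d' F ^+ (n - i)) ≡
    a ^+ n * ((al * x + be * y) ^+ i * (ga * x + ep * y) ^+ (n - i)).
Proof.
move=> ni; rewrite rmorphM !rmorphXn.
rewrite (_ : a ^+ n * _ = (a * (al * x + be * y)) ^+ i
   * (a * (ga * x + ep * y)) ^+ (n - i)); last first.
  by rewrite !exprMn -{1}(subnKC ni) exprD; ring.
by apply: eqI_M; apply: eqI_X; [apply: pull_z | apply: pull_w].
Qed.

(** In [L q * p - L p * q] the terms with [L a] cancel.  When [L] falls on the
    coefficients of the linear forms [p, q] it yields a cubic form; when it falls
    on [x, y] it yields [L y * x - L x * y], which is [rhoZ2LL r], times the
    determinant of the coefficients. *)
Lemma pull_rhoZ2LL : exists2 C, form_in x y (dbar_closed d) 3 C &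
  P (rhoZ2LL d' F) ≡ a ^+ 3 * (C + e ^+ 2 * rhoZ2LL d r).
Proof.
pose p := al * x + be * y; pose q := ga * x + ep * y.
pose C := e * ((L ga * x + L ep * y) * p - (L al * x + L be * y) * q).
have Q0 := dbar_closed0 dW; have Q1 := dbar_closed1 dW.
have QD := dbar_closedD dW.
have QM := dbar_closedM dW; have QN := dbar_closedN dW.
exists C.
  have lin1 f g : dbar_closed d f -> dbar_closed d g ->
      form_in x y (dbar_closed d) 1 (f * x + g * y).
    move=> ff gg; rewrite -[_ + _]mulr1.
    by apply: form_in_lin => //; apply: form_in_const.
  have linL f g h : dbar_closed d f -> dbar_closed d g ->
      form_in x y (dbar_closed d) 1 h ->
      form_in x y (dbar_closed d) 3 ((L f * x + L g * y) * h).
    have LE v : L v = d_w d v * x + - d_z d v * y by rewrite /Lhol /Lbar /=; ring.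
    move=> ff gg hh; rewrite !LE [_ * x]mulrC [_ * y]mulrC mulrDl -!mulrA.
    by apply: form_inD => //; [apply: form_inX | apply: form_inY] => //;
      apply: form_in_lin => //; rewrite ?QN //;
      [apply: dbar_closed_w | apply: QN; apply: dbar_closed_z |
       apply: dbar_closed_w | apply: QN; apply: dbar_closed_z].
  apply: form_inZ => //; apply: form_inD => //.
    by apply: linL => //; apply: lin1.
  rewrite -mulN1r; apply: form_inZ => //; first exact: QN.
  by apply: linL => //; apply: lin1.
rewrite rhoZ2LL_Lhol //.
rewrite (@rhoZ2LL_Lhol _ d) ?(der_zw dW) // rmorphB !rmorphM.
apply: (@eqI_trans (e * a * L (a * q) * (a * p) - e * a * L (a * p) * (a * q))).
  have Lpull f g : P f ≡ g -> P (Lhol d' F f) ≡ e * a * L g.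
    move=> fg; apply: eqI_trans (pull_Lhol _) _.
    by apply: eqI_M => //; apply: eqI_L.
  by apply: eqI_B; apply: eqI_M;
    [apply: Lpull; apply: pull_w | apply: pull_z
    |apply: Lpull; apply: pull_z | apply: pull_w].
apply: eqI_eq; rewrite /C -/x -/y.
rewrite (_ : e ^+ 2 = e * (al * ep - be * ga)); last by rewrite sub_det.
rewrite !(derM L_der) /p /q !(derD L_der) !(derM L_der).
move: (L a) (L al) (L be) (L ga) (L ep) (L x) (L y) => *.
by move: al be ga ep x y => *; ring.
Qed.

Let kappa_e : kappa delta * kappa e = 1.
Proof. by rewrite -rmorphM e_inv rmorph1. Qed.

Let kappa_eb : kappa deltab * kappa eb = 1.
Proof. by rewrite -rmorphM eb_inv rmorph1. Qed.

Let kappa_eX n : kappa delta ^+ n * kappa e ^+ n = 1.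
Proof. by rewrite -exprMn kappa_e expr1n. Qed.

Let kappa_ebX n : kappa deltab ^+ n * kappa eb ^+ n = 1.
Proof. by rewrite -exprMn kappa_eb expr1n. Qed.

Let sym_hol n i k : dbar_closed d (sym_coef al be ga ep n i k).
Proof.
have [Q0 Q1] := (dbar_closed0 dW, dbar_closed1 dW).
pose hol_poly (p : {poly S}) := forall k, dbar_closed d p`_k.
have holM p q : hol_poly p -> hol_poly q -> hol_poly (p * q).
  move=> hp hq j; rewrite coefM; elim/big_ind: _ => // [f g|l _].
    exact: dbar_closedD.
  exact: dbar_closedM.
have holX p j : hol_poly p -> hol_poly (p ^+ j).
  move=> hp; elim: j => [|j IH]; last by rewrite exprS; apply: holM.
  by rewrite expr0 => l; rewrite coef1; case: eqP.
have hol_lin f g : dbar_closed d f -> dbar_closed d g ->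
    hol_poly (f *: 'X + g%:P).
  move=> ff gg j; rewrite coefD coefZ coefX coefC.
  apply: dbar_closedD => //; last by case: eqP.
  by apply: dbar_closedM => //; case: eqP.
by rewrite /sym_coef; apply: holM; apply: holX; apply: hol_lin.
Qed.

Let kappa_det_sym n :
  kappa (\det (nat_mx n.+1 (sym_coef al be ga ep n))) = kappa e ^+ 'C(n.+1, 2).
Proof.
have ke : kappa al * kappa ep - kappa be * kappa ga = kappa e.
  by rewrite -!rmorphM -rmorphB sub_det.
rewrite -det_map_mx -[in RHS]ke -det_sym_coef; last first.
  rewrite ke; apply/eqP => e0; by have /eqP := kappa_e; rewrite e0 mulr0 eq_sym oner_eq0.
congr (\det _); apply/matrixP => i k; rewrite !mxE /sym_coef -coef_map.
rewrite (rmorphM (map_poly kappa)) !(rmorphXn (map_poly kappa)).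
by rewrite !(rmorphD (map_poly kappa)) /= !map_polyZ !map_polyX !map_polyC.
Qed.

Theorem det_D_pullback n :
  kappa delta ^+ 'C(n.+1, 2) * kappa deltab ^+ 'C(n.+1, 2)
    * kappa (P (\det (D_mx d' n F))) =
  kappa a ^+ (3 * 'C(n.+1, 2)) * kappa (\det (D_mx d n r)).
Proof.
rewrite [D_mx d' n F](_ : _ = nat_mx n.+1 (fun i j => iter j (Lbar d' F)
  (d_z d' F ^+ i * d_w d' F ^+ (n - i)))) //.
rewrite (@det_pullback _ _ (fun k => x ^+ k * y ^+ (n - k))
  (sym_coef al be ga ep n) (a ^+ n)); last first.
- by move=> i k _ _; apply: Lbar_dbar_closed.
- move=> i; rewrite ltnS => ni; apply: eqI_trans (pull_monomial ni) _.
  apply: eqI_eq; rewrite binary_form_sym // mulr_sumr.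
  by apply: eq_bigr => k _; rewrite mulrCA.
rewrite kappa_det_sym !(rmorphM, rmorphXn) exprMn -exprM.
have -> : (3 * 'C(n.+1, 2) = 'C(n.+1, 2) + n * n.+1)%N.
  by have := mul_bin_diag n.+1 1; rewrite bin1; lia.
rewrite exprD.
have := kappa_eX 'C(n.+1, 2); have := kappa_ebX 'C(n.+1, 2).
move: (kappa e ^+ _) (kappa delta ^+ _) (kappa eb ^+ _) (kappa deltab ^+ _).
move=> E0 E1 E2 E3 E32 E10.
rewrite (_ : E1 * E3 * _ = (E1 * E0) * (E3 * E2) * (kappa a ^+ 'C(n.+1, 2)
  * kappa a ^+ (n * n.+1) * kappa (\det (D_mx d n r)))) //; last by ring.
by rewrite E10 E32 !mul1r.
Qed.

(** The last rows are, modulo the first [n + 1] rows with holomorphic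
    coefficients, the symmetric power of degree [n - 3] scaled by [delta^-2]. *)
Theorem det_A_pullback n : (3 <= n)%N ->
  kappa delta ^+ (n ^ 2 - 1) * kappa deltab ^+ ((n - 1) * (2 * n - 1))
    * kappa (P (\det (A_mx d' n F))) =
  kappa a ^+ ((2 * n - 1) ^ 2) * kappa (\det (A_mx d n r)).
Proof.
case: n => [|[|[|m]]] // _; set n := m.+3.
have [C holC pullC] := pull_rhoZ2LL.
pose p := al * x + be * y; pose q := ga * x + ep * y.
have /choice [cubic cubicP] : forall s, exists t : nat -> S, (s <= m)%N ->
    (forall k, dbar_closed d (t k)) /\ p ^+ s * q ^+ (m - s) * C =
       \sum_(k < n.+1) t k * (x ^+ k * y ^+ (n - k)).
  move=> s; have [sm|] := leqP s m; last by exists (fun=> 0).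
  have := form_in_lin_exp (dbar_closed0 dW) (dbar_closedD dW)
     (dbar_closedM dW) s al_hol be_hol (form_in_lin_exp (dbar_closed0 dW)
     (dbar_closedD dW) (dbar_closedM dW) (m - s) ga_hol ep_hol holC).
  rewrite addnA subnKC // addn3 => -[t tQ tE]; exists t => _.
  by split=> //; rewrite -mulrA.
pose T i k := if (i <= n)%N then
    (if (k <= n)%N then sym_coef al be ga ep n i k else 0)
  else (if (k <= n)%N then cubic (i - n.+1)%N k
        else e ^+ 2 * sym_coef al be ga ep m (i - n.+1) (k - n.+1)).
have N1 : (2 * n - 1 = n.+1 + m.+1)%N by rewrite /n; lia.
rewrite [A_mx d' n F](_ : _ = nat_mx (2 * n - 1) (fun i j =>
  iter j (Lbar d' F) (A_col0 d' n F i))) //.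
rewrite (@det_pullback _ _ (A_col0 d n r) T (a ^+ n)); last first.
- move=> i k iN kN; apply: Lbar_dbar_closed; rewrite /T.
  case: leqP => // ni; case: leqP => // nk; first by apply: dbar_closed0.
    have [|t _] := cubicP (i - n.+1)%N; last exact: t.
    by rewrite N1 in iN; lia.
  by apply: dbar_closedM => //; apply: dbar_closedM.
- move=> i; rewrite N1 => iN; rewrite big_split_ord /= /T /A_col0.
  have [ni|ni] := leqP i n.
    apply: eqI_trans (pull_monomial ni) _; apply: eqI_eq.
    rewrite binary_form_sym // mulr_sumr [X in _ + X]big1 ?addr0 => [|k _].
      by apply: eq_bigr => k _; rewrite -ltnS ltn_ord; ring.
    by rewrite leqNgt leq_addr mul0r.
  have sm : (i - n.+1 <= m)%N by lia.
  set s := (i - n.+1)%N in sm *.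
  have n3 : (n - 3 = m)%N by rewrite /n; lia.
  rewrite n3.
  apply: (@eqI_trans (a ^+ m * (p ^+ s * q ^+ (m - s))
      * (a ^+ 3 * (C + e ^+ 2 * rhoZ2LL d r)))).
    rewrite rmorphM; apply: eqI_M => //; exact: pull_monomial.
  apply: eqI_eq; have [_ Cs] := cubicP s sm.
  rewrite (_ : _ * _ = a ^+ n * (p ^+ s * q ^+ (m - s) * C
     + e ^+ 2 * (p ^+ s * q ^+ (m - s)) * rhoZ2LL d r)); last first.
    by rewrite /n -[m.+3]addn3 exprD; ring.
  rewrite Cs mulrDr mulr_sumr; congr (_ + _).
    by apply: eq_bigr => k _; rewrite -ltnS ltn_ord; ring.
  rewrite binary_form_sym // mulr_sumr mulr_suml mulr_sumr.
  apply: eq_bigr => k _; rewrite leqNgt leq_addr /= addKn; ring.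
have -> : kappa (\det (nat_mx (2 * n - 1) T)) =
    kappa e ^+ 'C(n.+1, 2) * (kappa e ^+ (2 * m.+1) * kappa e ^+ 'C(m.+1, 2)).
  rewrite N1 det_nat_mx_lblock; last first.
    by move=> i j ilt /andP[jge _]; rewrite /T -ltnS ilt leqNgt jge.
  rewrite rmorphM; congr (_ * _).
    rewrite -kappa_det_sym; congr (kappa (\det _)).
    by apply/matrixP => i j; rewrite !mxE /T -!(ltnS _ n) !ltn_ord.
  rewrite -kappa_det_sym exprM -rmorphXn -rmorphXn -rmorphM -detZ.
  congr (kappa (\det _)); apply/matrixP => i j.
  have nle k : (n.+1 + k <= n)%N = false by rewrite leqNgt leq_addr.
  by rewrite !mxE /T !nle !addKn.
rewrite -!exprD !(rmorphM, rmorphXn) exprMn -exprM.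
have -> : ('C(n.+1, 2) + (2 * m.+1 + 'C(m.+1, 2)) = n ^ 2 - 1)%N.
  have := mul_bin_diag n.+1 1; have := mul_bin_diag m.+1 1.
  by rewrite !bin1 /n; lia.
have -> : ('C(2 * n - 1, 2) = (n - 1) * (2 * n - 1))%N.
  by have := mul_bin_diag (2 * n - 1) 1; rewrite bin1 /n; lia.
have -> : ((2 * n - 1) ^ 2 = (n - 1) * (2 * n - 1) + n * (2 * n - 1))%N.
  by rewrite /n; lia.
rewrite exprD.
set E := ((n - 1) * _)%N; set G := (n ^ 2 - 1)%N.
have := kappa_eX G; have := kappa_ebX E.
move: (kappa e ^+ _) (kappa delta ^+ _) (kappa eb ^+ _) (kappa deltab ^+ _).
move=> E0 E1 E2 E3 E32 E10.
rewrite (_ : E1 * E3 * _ = (E1 * E0) * (E3 * E2) * (kappa a ^+ E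
  * kappa a ^+ (n * (2 * n - 1)) * kappa (\det (A_mx d n r)))) //; last by ring.
by rewrite E10 E32 !mul1r.
Qed.

End Pullback.

(** * Formal power series *)

Module FormalSeries.
Import mpoly.

Section Truncation.
Variables (n : nat) (K : comNzRingType).
Implicit Types (p q : {mpoly K[n]}) (f g : fps n K) (m : 'X_{1..n}).

(** Identities between series are proved on polynomials, modulo terms of high
    degree: coefficients up to degree [N] only involve truncations. *)
Definition eq_upto N p q := forall m, (mdeg m <= N)%N -> p@_m = q@_m.

Lemma eq_uptoM N p q p' q' : eq_upto N p p' -> eq_upto N q q' ->
  eq_upto N (p * q) (p' * q').
Proof. by move=> pp' qq' m mN; apply: (mcoeffM_low pp' qq'). Qed.

Lemma eq_uptoX N p p' j : eq_upto N p p' -> eq_upto N (p ^+ j) (p' ^+ j).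
Proof.
move=> pp'; elim: j => [|j IH]; first by rewrite !expr0.
by rewrite !exprS; apply: eq_uptoM.
Qed.

Lemma eq_upto_prod N I (r : seq I) (F G : I -> {mpoly K[n]}) :
  (forall i, eq_upto N (F i) (G i)) ->
  eq_upto N (\prod_(i <- r) F i) (\prod_(i <- r) G i).
Proof.
move=> FG; elim: r => [|i r IH]; first by rewrite !big_nil.
by rewrite !big_cons; apply: eq_uptoM.
Qed.

Lemma eq_upto_trans N q p r : eq_upto N p q -> eq_upto N q r -> eq_upto N p r.
Proof. by move=> pq qr m mN; rewrite pq ?qr. Qed.

Lemma eq_upto_sym N p q : eq_upto N p q -> eq_upto N q p.
Proof. by move=> pq m mN; rewrite pq. Qed.

Lemma taylor_poly_coef_gt N f m : (N < mdeg m)%N -> (taylor_poly N f)@_m = 0.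
Proof.
move=> Nm; rewrite (raddf_sum (mcoeff m)) big1 // => l _ /=.
rewrite mcoeffZ mcoeffX; case: eqP => [lm|]; last by rewrite mulr0.
by have := bmdeg l; rewrite lm ltnS leqNgt Nm.
Qed.

Lemma eq_upto_taylor N N' f : (N <= N')%N ->
  eq_upto N (taylor_poly N f) (taylor_poly N' f).
Proof.
move=> NN' m mN.
by rewrite !taylor_poly_coef // (leq_trans mN).
Qed.

Definition order_ge N p := forall m, (mdeg m < N)%N -> p@_m = 0.

Lemma order_geM M N p q : order_ge M p -> order_ge N q -> order_ge (M + N) (p * q).
Proof.
move=> pM qN m mMN; rewrite mcoeffM big1 // => -[k1 k2] /= /eqP mE.
have [k1M|k1M] := ltnP (mdeg k1) M; first by rewrite pM ?mul0r.
rewrite qN ?mulr0 //.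
have := congr1 (@mdeg n) mE; rewrite mdegD /= => mdE.
by rewrite mdE in mMN; rewrite -(ltn_add2l M) (leq_ltn_trans _ mMN) // leq_add2r.
Qed.

Lemma order_geX p j : order_ge 1 p -> order_ge j (p ^+ j).
Proof.
move=> p1; elim: j => [|j IH] //.
by rewrite exprS -add1n; apply: order_geM.
Qed.

Lemma order_ge_prod I (r : seq I) (F : I -> {mpoly K[n]}) (e : I -> nat) :
  (forall i, order_ge (e i) (F i)) ->
  order_ge (\sum_(i <- r) e i) (\prod_(i <- r) F i).
Proof.
move=> Fe; elim: r => [|i r IH]; first by rewrite !big_nil.
by rewrite !big_cons; apply: order_geM.
Qed.

Lemma order_ge1 p : p@_0 = 0 -> order_ge 1 p.
Proof. by move=> p0 m; rewrite ltnS leqn0 mdeg_eq0 => /eqP ->. Qed.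

End Truncation.

Section Composition.
Variables (n k : nat) (K : comNzRingType).
Implicit Types (p q : {mpoly K[n]}) (t : n.-tuple {mpoly K[k]}).

Lemma comp_mpoly_low N p q t : (forall i, (tnth t i)@_0 = 0) ->
  eq_upto N p q -> eq_upto N (p \mPo t) (q \mPo t).
Proof.
move=> t0 pq m mN; apply/eqP; rewrite -subr_eq0 -mcoeffB -comp_mpolyB.
rewrite comp_mpolyEX linear_sum /= big1_seq // => l _.
rewrite mcoeffZ; have [lN|lN] := leqP (mdeg l) N.
  by rewrite mcoeffB pq // subrr mul0r.
rewrite comp_mpolyX (_ : _@_m = 0) ?mulr0 //.
apply: (@order_ge_prod _ _ _ _ _ (fun i => l i)).
  by move=> i; apply: order_geX; apply: order_ge1.
by rewrite -mdegE (leq_ltn_trans mN).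
Qed.

Lemma comp_mpoly_low_r N p t t' : (forall i, eq_upto N (tnth t i) (tnth t' i)) ->
  eq_upto N (p \mPo t) (p \mPo t').
Proof.
move=> tt' m mN; rewrite !comp_mpolyE !(raddf_sum (mcoeff m)) /=.
apply: eq_bigr => l _; rewrite !mcoeffZ; congr (_ * _).
by apply: (eq_upto_prod (N := N)) => // i; apply: eq_uptoX.
Qed.

Lemma comp_mpolyM p q t : (p * q) \mPo t = (p \mPo t) * (q \mPo t).
Proof. exact: rmorphM. Qed.

(** The polynomials satisfying the chain rule form a subring that contains the
    constants and the variables. *)
Lemma mderiv_comp i p t :
  mderiv i (p \mPo t) = \sum_j (mderiv j p \mPo t) * mderiv i (tnth t j).
Proof.
pose chain p := mderiv i (p \mPo t) =
  \sum_j (mderiv j p \mPo t) * mderiv i (tnth t j).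
have chainM q r : chain q -> chain r -> chain (q * r).
  rewrite /chain comp_mpolyM mderivM => -> ->.
  rewrite mulr_suml mulr_sumr -big_split; apply: eq_bigr => j _.
  by rewrite mderivM comp_mpolyD !comp_mpolyM /=; ring.
have chainC c : chain c%:MP.
  rewrite /chain comp_mpolyC mderivC big1 // => j _.
  by rewrite mderivC comp_mpoly0 mul0r.
have chainXU j : chain 'X_j.
  rewrite /chain comp_mpolyX (bigD1 j) //= big1 => [|l lj]; last first.
    by rewrite mnm1E eq_sym (negPf lj) expr0.
  rewrite mnm1E eqxx mulr1 (bigD1 j) //= big1 ?addr0 => [|l lj].
    by rewrite mderivX mnm1E eqxx scale1r -{1}[U_(j)%MM]add0m addmK mpolyX0 comp_mpoly1 mul1r.
  by rewrite mderivX mnm1E eq_sym (negPf lj) scale0r comp_mpoly0 mul0r.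
have chainX q j : chain q -> chain (q ^+ j).
  move=> cq; elim: j => [|j IH]; first exact: (chainC 1).
  by rewrite exprS; apply: chainM.
rewrite -/(chain p); elim/mpolyind: p => [|c m p _ _ IH].
  exact: (chainC 0).
have -> : c *: 'X_[m] + p = c%:MP * 'X_[m] + p by rewrite mul_mpolyC.
have : chain (c%:MP * 'X_[m]).
  apply: (chainM); first exact: (chainC).
  rewrite mpolyXE_id.
  exact: (big_ind chain (chainC 1) chainM (fun j _ => chainX _ _ (chainXU j))).
rewrite /chain comp_mpolyD mderivD => ->; rewrite IH -big_split.
by apply: eq_bigr => j _; rewrite mderivD comp_mpolyD mulrDl.
Qed.

End Composition.

Section Series.
Variables (n : nat) (K : comNzRingType).
Implicit Types (f g : fps n K) (m : 'X_{1..n}) (i : 'I_n).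

Lemma coef_fpsD f g m : (f + g) m = f m + g m. Proof. by []. Qed.

Lemma coef_fps0 m : (0 : fps n K) m = 0. Proof. by []. Qed.

Lemma coef_fpsN f m : (- f) m = - f m. Proof. by []. Qed.

Lemma coef_fps1 m : (1 : fps n K) m = (m == 0%MM)%:R. Proof. by []. Qed.

Lemma coef_fps_sum I (r : seq I) (F : I -> fps n K) m :
  (\sum_(i <- r) F i) m = \sum_(i <- r) F i m.
Proof. exact: (big_morph (fun f : fps n K => f m)). Qed.

Lemma coef_fpsM N f g m : (mdeg m <= N)%N ->
  (f * g) m = (taylor_poly N f * taylor_poly N g)@_m.
Proof. exact: mulf_taylor_poly. Qed.

Lemma taylor_polyM N f g :
  eq_upto N (taylor_poly N (f * g)) (taylor_poly N f * taylor_poly N g).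
Proof. by move=> m mN; rewrite taylor_poly_coef // (coef_fpsM _ _ mN). Qed.

Lemma fps_constE f : fps_const f = f 0%MM. Proof. by []. Qed.

Lemma fps_const_nmod_morphism : nmod_morphism (@fps_const n K).
Proof. by []. Qed.

Lemma fps_const_monoid_morphism : monoid_morphism (@fps_const n K).
Proof.
split=> [|f g]; first by rewrite /fps_const coef_fps1 eqxx.
rewrite /fps_const (@coef_fpsM 0) ?mdeg0 // rmorphM /=.
by rewrite !taylor_poly_coef ?mdeg0.
Qed.

HB.instance Definition _ := GRing.isNmodMorphism.Build (fps n K) K
  (@fps_const n K) fps_const_nmod_morphism.
HB.instance Definition _ := GRing.isMonoidMorphism.Build (fps n K) K
  (@fps_const n K) fps_const_monoid_morphism.

Lemma fps_constD f g : fps_const (f + g) = fps_const f + fps_const g.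
Proof. exact: rmorphD. Qed.

Lemma fps_constM f g : fps_const (f * g) = fps_const f * fps_const g.
Proof. exact: rmorphM. Qed.

Lemma eq_upto_mderiv N f i :
  eq_upto N (mderiv i (taylor_poly N.+1 f)) (taylor_poly N (fderiv i f)).
Proof.
move=> m mN; rewrite mcoeff_deriv !taylor_poly_coef //.
by rewrite mdegD mdeg1 addn1.
Qed.

Lemma coef_fderivE i f m : fderiv i f m = f (m + U_(i))%MM *+ (m i).+1.
Proof. by []. Qed.

Lemma fderiv_derivation i : derivation (@fderiv n K i).
Proof.
split=> f g; apply: fpsP => m; first by rewrite /= mulrnDl.
have mN : (mdeg (m + U_(i)) <= (mdeg m).+1)%N by rewrite mdegD mdeg1 addn1.
rewrite coef_fderivE (coef_fpsM _ _ mN) -mcoeff_deriv mderivM mcoeffD.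
rewrite coef_fpsD !(coef_fpsM _ _ (leqnn _)); congr (_ + _).
  by apply: (eq_uptoM (eq_upto_mderiv _ _) (eq_upto_sym (eq_upto_taylor _ _))).
by apply: (eq_uptoM (eq_upto_sym (eq_upto_taylor _ _)) (eq_upto_mderiv _ _)).
Qed.

Lemma fderivC i j f : fderiv i (fderiv j f) = fderiv j (fderiv i f).
Proof.
apply: fpsP => m /=; rewrite -!mulrnA -!addmA [(U_(j) + _)%MM]addmC.
congr (_ *+ _); rewrite !mnmDE !mnm1E [j == i]eq_sym.
by case: eqP => [->|]; lia.
Qed.

Lemma fderiv_centered i f : fderiv i (fps_centered f) = fderiv i f.
Proof.
apply: fpsP => m /=; case: eqP => // /(congr1 mdeg).
by rewrite mdegD mdeg1 mdeg0 addn1.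
Qed.

Lemma fps_const_centered f : fps_const (fps_centered f) = 0.
Proof. by rewrite /fps_const /= eqxx. Qed.

Definition fps_eq_upto N f g := forall m, (mdeg m <= N)%N -> f m = g m.

Lemma fps_eq_uptoM N f g f' g' : fps_eq_upto N f f' -> fps_eq_upto N g g' ->
  fps_eq_upto N (f * g) (f' * g').
Proof.
move=> ff' gg' m mN; rewrite !(coef_fpsM _ _ mN).
by apply: (eq_uptoM (N := N)) => // l lN; rewrite !taylor_poly_coef ?(ff', gg').
Qed.

Lemma fps_eq_upto_sum N I (r : seq I) (F G : I -> fps n K) :
  (forall x, fps_eq_upto N (F x) (G x)) ->
  fps_eq_upto N (\sum_(i <- r) F i) (\sum_(i <- r) G i).
Proof.
by move=> FG m mN; rewrite !coef_fps_sum; apply: eq_bigr => x _; apply: FG.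
Qed.

Lemma fps_eq_upto_eq f g : (forall N, fps_eq_upto N f g) -> f = g.
Proof. by move=> fg; apply: fpsP => m; apply: (fg (mdeg m)). Qed.

(** Geometric series in [u = 1 - f / f(0)]; as [u^j] has order at least [j],
    each coefficient is that of a finite sum. *)
Lemma fps_inverse f c : fps_const f * c = 1 -> exists g, f * g = 1.
Proof.
move=> fc; pose C : fps n K := Fps (fun m => if m == 0%MM then c else 0).
pose u : fps n K := 1 - f * C.
have u0 : fps_const u = 0.
  have fC : fps_const (f * C) = 1.
    by rewrite rmorphM -[RHS]fc /fps_const /= eqxx.
  by rewrite rmorphB rmorph1; apply/eqP; rewrite subr_eq0; apply/eqP/esym.
have uX j m : (mdeg m < j)%N -> (u ^+ j) m = 0.
  elim: j m => // j IH m mj; rewrite exprS (coef_fpsM _ _ (leqnn _)).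
  apply: (@order_geM _ _ 1 j) => //; first apply: order_ge1.
    by rewrite taylor_poly_coef // mdeg0.
  move=> l lj; have [lm|lm] := leqP (mdeg l) (mdeg m).
    by rewrite taylor_poly_coef // IH.
  exact: taylor_poly_coef_gt.
pose G : fps n K := Fps (fun m => (\sum_(j < (mdeg m).+1) u ^+ j) m).
have GE N m : (mdeg m <= N)%N -> G m = (\sum_(j < N.+1) u ^+ j) m.
  move=> mN; rewrite /= !coef_fps_sum -(subnKC mN) -addSn big_split_ord /=.
  rewrite [X in _ = _ + X]big1 ?addr0 // => j _; apply: uX.
  by rewrite addSn ltnS leq_addr.
exists (C * G); rewrite mulrA; have -> : f * C = 1 - u by rewrite /u; ring.
apply: fps_eq_upto_eq => N m mN.
rewrite (_ : _ m = ((1 - u) * \sum_(j < N.+1) u ^+ j) m); last first.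
  by apply: (fps_eq_uptoM (N := N)) => // l lN; apply: GE.
have -> : (1 - u) * \sum_(j < N.+1) u ^+ j = 1 - u ^+ N.+1.
  by rewrite -{2}(expr1n _ N.+1) subrXX; congr (_ * _);
     apply: eq_bigr => j _; rewrite expr1n mul1r.
by rewrite coef_fpsD coef_fpsN uX ?subr0.
Qed.

End Series.

Section Substitution.
Variables (n k : nat) (K : comNzRingType).
Variable s : 'I_n -> fps k K.
Hypothesis s0 : forall i, fps_const (s i) = 0.
Implicit Types (F G : fps n K).

Local Notation trunc N := [tuple taylor_poly N (s i) | i < n].

Let trunc0 N i : (tnth (trunc N) i)@_0 = 0.
Proof. by rewrite tnth_mktuple taylor_poly_coef ?mdeg0 // -(s0 i). Qed.

(** Since the substituted series have no constant term, the truncation degree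
    may be any bound for the degree of the monomial. *)
Lemma coef_fps_subst N F m : (mdeg m <= N)%N ->
  fps_subst s F m = (taylor_poly N F \mPo trunc N)@_m.
Proof.
move=> mN /=; transitivity ((taylor_poly N F \mPo trunc (mdeg m))@_m).
  by apply: (comp_mpoly_low (trunc0 _) (eq_upto_taylor _ mN)).
apply: (@comp_mpoly_low_r _ _ _ (mdeg m)) => // i; rewrite !tnth_mktuple.
exact: eq_upto_taylor.
Qed.

Lemma fps_subst_nmod_morphism : nmod_morphism (fps_subst s).
Proof.
split=> [|F G]; apply: fpsP => m /=; set t := [tuple _ | _ < _].
  rewrite (comp_mpoly_low (trunc0 (mdeg m)) (q := 0) (N := mdeg m)) //.
    by rewrite comp_mpoly0 mcoeff0.
  by move=> l lm; rewrite taylor_poly_coef // mcoeff0.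
rewrite (comp_mpoly_low (trunc0 (mdeg m))
  (q := taylor_poly (mdeg m) F + taylor_poly (mdeg m) G) (N := mdeg m)) //.
  by rewrite comp_mpolyD mcoeffD.
by move=> l lm; rewrite mcoeffD !taylor_poly_coef.
Qed.

Lemma fps_subst_monoid_morphism : monoid_morphism (fps_subst s).
Proof.
split=> [|F G]; apply: fpsP => m.
  rewrite /= (comp_mpoly_low (trunc0 (mdeg m)) (q := 1) (N := mdeg m)) //.
    by rewrite comp_mpoly1 mcoeff1.
  by move=> l lm; rewrite taylor_poly_coef // mcoeff1.
rewrite (coef_fpsM _ _ (leqnn _)) /=.
rewrite (comp_mpoly_low (trunc0 (mdeg m)) (@taylor_polyM _ _ _ F G)) //.
rewrite comp_mpolyM; apply: (eq_uptoM _ _ (leqnn (mdeg m))) => l lm;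
  by rewrite (taylor_poly_coef _ lm) (coef_fps_subst _ lm).
Qed.

Lemma fps_const_subst F : fps_const (fps_subst s F) = fps_const F.
Proof.
rewrite fps_constE (@coef_fps_subst 0) ?mdeg0 //.
rewrite (comp_mpoly_low (trunc0 0) (q := (fps_const F)%:MP) (N := 0)) ?mdeg0 //.
  by rewrite comp_mpolyC mcoeffC eqxx mulr1.
move=> m; rewrite leqn0 mdeg_eq0 => /eqP ->.
by rewrite taylor_poly_coef ?mdeg0 // mcoeffC eqxx mulr1.
Qed.

Lemma fderiv_subst i F : fderiv i (fps_subst s F) =
  \sum_j fps_subst s (fderiv j F) * fderiv i (s j).
Proof.
apply: fpsP => m; rewrite coef_fderivE; set N := mdeg m.
have mN : (mdeg (m + U_(i)) <= N.+1)%N by rewrite mdegD mdeg1 addn1.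
rewrite (coef_fps_subst _ mN) -mcoeff_deriv mderiv_comp (raddf_sum (mcoeff m)) coef_fps_sum.
apply: eq_bigr => j _; rewrite [RHS](coef_fpsM _ _ (leqnn _)).
apply: (eq_uptoM (N := N)) => //; last first.
  by rewrite tnth_mktuple; apply: eq_upto_mderiv.
move=> l lN; rewrite (taylor_poly_coef _ lN) (coef_fps_subst _ (leqW lN)).
apply: (comp_mpoly_low (trunc0 _) (N := N)) => //.
apply: eq_upto_trans (eq_upto_mderiv _ _) (eq_upto_taylor _ _).
exact: leqnSn.
Qed.

End Substitution.

Section CharacteristicZero.
Variables (n : nat) (K : numFieldType).
Implicit Types (f g : fps n K).

Lemma fps_eq_upto0 f g : fps_const f = fps_const g -> fps_eq_upto 0 f g.
Proof. by move=> fg m; rewrite leqn0 mdeg_eq0 => /eqP ->. Qed.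

(** In characteristic zero a series is determined by its constant term and its
    derivatives; this turns identities of Taylor series into an induction on the
    degree. *)
Lemma fps_eq_uptoS N f g : fps_const f = fps_const g ->
  (forall i, fps_eq_upto N (fderiv i f) (fderiv i g)) -> fps_eq_upto N.+1 f g.
Proof.
move=> fg0 fg m mN; have [-> //|m0] := eqVneq m 0%MM.
have [i mi] : exists i, (0 < m i)%N.
  apply/existsP; apply: contra_neqT m0 => /existsPn m0; apply/mnmP => i.
  by rewrite mnm0E; apply/eqP; rewrite -leqn0 leqNgt m0.
have mE : (m - U_(i) + U_(i) = m)%MM.
  by rewrite submK //; apply/mnm_lepP => j; rewrite mnm1E; case: eqP => [<-|].
have lN : (mdeg (m - U_(i)) <= N)%N.
  by move: mN; rewrite -{1}mE mdegD mdeg1 addn1.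
have /= := fg i _ lN; rewrite mE => /eqP.
by rewrite eqrMn2r /= => /eqP.
Qed.

End CharacteristicZero.

Definition mshift n (i : 'I_n) (m : 'X_{1..n}) : 'X_{1..n} := (m + U_(i))%MM.

Lemma mexp_mshift n (i j : 'I_n) m : mexp (mshift i m) j = ((i == j) + mexp m j)%N.
Proof. by rewrite /mexp mnmDE mnm1E addnC. Qed.

Lemma coef_fderiv n (K : comNzRingType) i (f : fps n K) m :
  fderiv i f m = f (mshift i m) *+ (mexp m i).+1.
Proof. by []. Qed.

Lemma mexp0 n (i : 'I_n) : mexp 0%MM i = 0%N.
Proof. exact: mnm0E. Qed.

Definition conj_var (i : 'I_4) : 'I_4 := inord ((i + 2) %% 4).

Lemma conj_varK : involutive conj_var.
Proof.
move=> i; apply: val_inj; rewrite /conj_var /= !inordK ?ltn_pmod //.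
by rewrite modnDml -addnA modnDr modn_small.
Qed.

Lemma mexp_mswap m i : mexp (mswap m) i = mexp m (conj_var i).
Proof. by rewrite /mexp mnmE. Qed.

Lemma mswap0 : mswap 0%MM = 0%MM.
Proof. by apply/mnmP => i; rewrite mnmE !mnm0E. Qed.

Lemma mswap_mshift i m : mswap (mshift i m) = mshift (conj_var i) (mswap m).
Proof.
apply/mnmP => j; rewrite mnmE !mnmDE !mnm1E mnmE; congr (_ + _)%N.
by rewrite -[in RHS](inj_eq (inv_inj conj_varK)) conj_varK.
Qed.

End FormalSeries.

From mathcomp Require Import all_classical all_reals all_analysis.
From mathcomp Require Import complex.
Import numFieldNormedType.Exports.

Local Open Scope classical_set_scope.
Local Open Scope ring_scope.
Local Open Scope complex_scope.

(** * Differentiable and smooth real functions *)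

Section LocalDifferentiability.
Variables (R : realType) (V W : normedModType R).
Implicit Types (f g : V -> W) (p v : V).
(** The definition of the differential, with explicit estimates. *)
Lemma diff_near f p : differentiable f p -> forall e : R, 0 < e ->
  \forall h \near (0 : V), `|f (h + p) - (f p + 'd f p h)| <= e * `|h|.
Proof. by move=> /diff_locally /eqaddoP fp e e0; exact: (fp e e0). Qed.

Lemma near_eq_differentiable f g p : {near p, f =1 g} ->
  differentiable f p -> differentiable g p.
Proof.
move=> fg df; have fgp : f p = g p := nbhs_singleton fg.
have dfc : continuous ('d f p) by apply: diff_continuous.
have gE : g \o shift p = cst (g p) + 'd f p +o_ (0 : V) id.
  apply/eqaddoP => e e0.
  have fg0 : \forall h \near (0 : V), f (h + p) = g (h + p).
    have : \forall x \near p, f x = g x := fg.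
    by rewrite (near_shift 0) subr0.
  have := diff_near df e0; rewrite fgp; apply: filterS2 fg0 => h fgh.
  by rewrite fgh.
by apply/diff_locallyP; rewrite (diff_unique dfc gE).
Qed.

End LocalDifferentiability.
Section DifferentiableUpTo.
Variable R : realType.
Implicit Types (U V : set (C2 R)) (f g : C2 R -> R) (p q v : C2 R).

(** Truncation of [smooth] at order [k], on which closure properties are proved
    by induction. *)
Definition smooth_upto k U f := forall (s : seq 'I_4) p, (size s <= k)%N ->
  U p -> differentiable (foldr (@partial R) f s) p.

Lemma smooth_uptoP U f : smooth U f <-> forall k, smooth_upto k U f.
Proof.
split=> [sf k s p _ Up | sf s p Up]; first exact: sf.
exact: (sf (size s)).
Qed.

Lemma smooth_upto_le k l U f : (k <= l)%N -> smooth_upto l U f -> smooth_upto k U f.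
Proof. by move=> kl sf s p sk; apply: sf; apply: leq_trans kl. Qed.

Lemma smooth_upto0 U f :
  smooth_upto 0 U f <-> forall p, U p -> differentiable f p.
Proof.
split=> [sf p Up|sf s p]; first exact: (sf [::]).
by rewrite leqn0 size_eq0 => /eqP ->; apply: sf.
Qed.

Lemma smooth_uptoS k U f : smooth_upto k.+1 U f <->
  (forall p, U p -> differentiable f p) /\
  (forall i, smooth_upto k U (partial i f)).
Proof.
split=> [sf|[df sf] s p].
  split=> [p Up|i s p sk Up]; first exact: (sf [::]).
  have := sf (rcons s i) p; rewrite size_rcons foldr_rcons; exact.
case/lastP: s => [|s i]; first by move=> _; apply: df.
by rewrite size_rcons foldr_rcons ltnS => sk Up; apply: sf.
Qed.

Lemma eq_on_near U f g p : open U -> {in U, f =1 g} -> U p -> {near p, f =1 g}.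
Proof.
move=> oU fg Up; apply: filterS (open_nbhs_nbhs (conj oU Up)) => q Uq.
by apply: fg; rewrite inE.
Qed.

Lemma eq_on_partial U f g i : open U -> {in U, f =1 g} ->
  {in U, partial i f =1 partial i g}.
Proof.
move=> oU fg p; rewrite inE => Up; apply: near_eq_derive.
exact: eq_on_near oU fg Up.
Qed.

Lemma eq_on_smooth_upto k U f g : open U -> {in U, f =1 g} ->
  smooth_upto k U f -> smooth_upto k U g.
Proof.
move=> oU fg sf s p sk Up.
apply: near_eq_differentiable (sf s p sk Up).
apply: (eq_on_near oU _ Up); elim: s {sk} => //= i s IH.
exact: eq_on_partial.
Qed.

Lemma partialE i f p : differentiable f p -> partial i f p = 'd f p (delta_mx 0 i).
Proof. exact: deriveE. Qed.

Lemma partialD i f g p : differentiable f p -> differentiable g p ->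
  partial i (f \+ g) p = partial i f p + partial i g p.
Proof. by move=> df dg; rewrite /partial deriveD //; apply: diff_derivable. Qed.

Lemma partialM i f g p : differentiable f p -> differentiable g p ->
  partial i (f \* g) p = partial i f p * g p + f p * partial i g p.
Proof.
move=> df dg; rewrite /partial deriveM; try exact: diff_derivable.
by rewrite /GRing.scale /= addrC [g p * _]mulrC.
Qed.

Lemma smooth_uptoD k U f g : open U -> smooth_upto k U f -> smooth_upto k U g ->
  smooth_upto k U (f \+ g).
Proof.
move=> oU; elim: k f g => [|k IH] f g.
  move=> /smooth_upto0 sf /smooth_upto0 sg; apply/smooth_upto0 => p Up.
  exact: differentiableD (sf p Up) (sg p Up).
move=> /smooth_uptoS[df sf] /smooth_uptoS[dg sg]; apply/smooth_uptoS; split=> [p Up|i].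
  exact: differentiableD (df p Up) (dg p Up).
apply: (eq_on_smooth_upto oU _ (IH _ _ (sf i) (sg i))) => p; rewrite inE => Up.
by rewrite partialD //; [apply: df | apply: dg].
Qed.

Lemma smooth_uptoM k U f g : open U -> smooth_upto k U f -> smooth_upto k U g ->
  smooth_upto k U (f \* g).
Proof.
move=> oU; elim: k f g => [|k IH] f g.
  move=> /smooth_upto0 sf /smooth_upto0 sg; apply/smooth_upto0 => p Up.
  exact: differentiableM (sf p Up) (sg p Up).
move=> sf sg; have sf' := smooth_upto_le (leqnSn k) sf.
have sg' := smooth_upto_le (leqnSn k) sg.
move: sf sg => /smooth_uptoS[df sf] /smooth_uptoS[dg sg].
apply/smooth_uptoS; split=> [p Up|i].
  exact: differentiableM (df p Up) (dg p Up).
apply: (eq_on_smooth_upto oU _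
  (smooth_uptoD oU (IH _ _ (sf i) sg') (IH _ _ sf' (sg i)))) => p; rewrite inE => Up.
by rewrite partialM //; [apply: df | apply: dg].
Qed.

Lemma partial_cst i (c : R) p : partial i (cst c) p = 0.
Proof. exact: derive_cst. Qed.

Lemma smooth_upto_cst k U (c : R) : smooth_upto k U (cst c).
Proof.
move=> s p _ _; suff [c' ->] : exists c', foldr (@partial R) (cst c) s = cst c'.
  exact: differentiable_cst.
elim: s => [|i s [c' /= ->]]; first by exists c.
by exists 0; apply/funext => q; apply: partial_cst.
Qed.
Lemma delta_basis v : v = \sum_(i < 4) v 0 i *: delta_mx 0 i.
Proof. exact: row_sum_delta. Qed.

Lemma diff_partial f p v : differentiable f p ->
  'd f p v = \sum_(i < 4) v 0 i * partial i f p.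
Proof.
move=> df; rewrite {1}(delta_basis v) linear_sum; apply: eq_bigr => i _.
by rewrite linearZ /= partialE.
Qed.

Lemma differentiable_coords (H : C2 R -> C2 R) p :
  (forall i, differentiable (fun q => H q 0 i) p) -> differentiable H p.
Proof.
move=> dH; have -> : H = \sum_(i < 4) (fun q => H q 0 i *: delta_mx 0 i).
  by apply/funext => q; rewrite fct_sumE {1}(delta_basis (H q)).
by apply: differentiable_sum => i; apply: differentiableZl.
Qed.

Lemma diff_coord j p v : 'd (fun q : C2 R => q 0 j : R) p v = v 0 j.
Proof.
have @l : {linear C2 R -> R}.
  by exists (fun N : C2 R => N 0 j); do 2![eexists]; do ?[constructor];
     rewrite ?mxE// => ? *; rewrite ?mxE//; move=> ?; rewrite !mxE.
have lc : continuous l by exact: coord_continuous.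
by rewrite -[LHS]/('d l p v) diff_lin.
Qed.

Lemma partial_comp f (H : C2 R -> C2 R) p i :
  (forall j, differentiable (fun q => H q 0 j) p) -> differentiable f (H p) ->
  partial i (f \o H) p =
    \sum_(j < 4) partial j f (H p) * partial i (fun q => H q 0 j) p.
Proof.
move=> dHj df; have dH := differentiable_coords dHj.
rewrite partialE; last exact: differentiable_comp.
rewrite diff_comp // /= diff_partial //; apply: eq_bigr => j _.
rewrite mulrC; congr (_ * _); rewrite partialE //.
have -> : (fun q => H q 0 j) = (fun v : C2 R => v 0 j : R) \o H by [].
rewrite (diff_comp dH) /=; last exact: differentiable_coord.
by rewrite diff_coord.
Qed.

Lemma smooth_upto_comp k U V f (H : C2 R -> C2 R) : open U ->
  (forall p, U p -> V (H p)) -> (forall j, smooth U (fun q => H q 0 j)) ->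
  smooth_upto k V f -> smooth_upto k U (f \o H).
Proof.
move=> oU HV sH.
have dHj p : U p -> forall j, differentiable (fun q => H q 0 j) p.
  by move=> Up j; apply: (sH j [::]).
elim: k f => [|k IH] f.
  move=> /smooth_upto0 df; apply/smooth_upto0 => p Up.
  apply: differentiable_comp; last exact: df (HV _ Up).
  by apply: differentiable_coords; apply: dHj.
move=> /smooth_uptoS[df sf]; apply/smooth_uptoS; split=> [p Up|i].
  apply: differentiable_comp; last exact: df (HV _ Up).
  by apply: differentiable_coords; apply: dHj.
pose s := [seq (partial j f \o H) \* partial i (fun q => H q 0 j) | j <- enum 'I_4].
have ss : smooth_upto k U (foldr (fun g h => g \+ h) (cst 0) s).
  rewrite /s; elim: (enum _) => [|j e IHe]; first exact: smooth_upto_cst.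
  apply: smooth_uptoD => //=; apply: smooth_uptoM => //; first exact: IH.
  have /smooth_uptoP/(_ k.+1)/smooth_uptoS[_] := sH j; exact.
apply: eq_on_smooth_upto oU _ ss => p; rewrite inE => Up.
rewrite partial_comp; [|exact: dHj|exact: df (HV _ Up)].
rewrite /s -big_enum /=; elim: (enum _) => [|j e IHe]; first by rewrite big_nil.
by rewrite big_cons /= IHe.
Qed.
Lemma is_derive_line f p v (x : R) : differentiable f (x *: v + p) ->
  is_derive x 1 (fun t : R => f (t *: v + p)) ('d f (x *: v + p) v).
Proof.
move=> df; have dv : derivable f (x *: v + p) v by exact: diff_derivable.
have -> : 'd f (x *: v + p) v = 'D_v f (x *: v + p) by rewrite deriveE.
have E : (fun h : R => h^-1 *: (((fun t => f (t *: v + p)) \o shift x) (h *: 1)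
    - f (x *: v + p))) =
    (fun h : R => h^-1 *: ((f \o shift (x *: v + p)) (h *: v) - f (x *: v + p))).
  by apply/funext => h; rewrite /= [h *: 1]mulr1 scalerDl addrA.
apply: DeriveDef; first by rewrite /derivable E.
by rewrite /derive E.
Qed.

Lemma continuous_line f p v (a b : R) :
  (forall t, t \in `[a, b] -> differentiable f (t *: v + p)) ->
  {within `[a, b], continuous (fun t : R => f (t *: v + p))}.
Proof.
move=> df; apply: derivable_within_continuous => t /df dft.
by have := is_derive_line dft; case.
Qed.

Lemma norm_delta_mx (i : 'I_4) : `|delta_mx 0 i : C2 R| <= 1.
Proof.
rewrite /Num.Def.normr /= mx_normrE; apply: bigmax_le => // -[j k] _ /=.
by rewrite mxE; case: andP => _; rewrite ?normr1 ?normr0.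
Qed.
Lemma near0_ball (P : C2 R -> Prop) : (\forall w \near (0 : C2 R), P w) ->
  exists2 d : R, 0 < d & forall w, `|w| < d -> P w.
Proof.
move=> /nbhs_ballP[d /= d0 dP]; exists d => // w wd; apply: dP.
by rewrite -ball_normE /ball_ /= sub0r normrN.
Qed.

(** The mean value theorem along the first direction turns the second difference
    into a difference of values of [partial i f], to which differentiability at
    [p] applies. *)
Lemma second_difference f p i j (e : R) : 0 < e ->
  {near p, forall q, differentiable f q} -> differentiable (partial i f) p ->
  exists2 d : R, 0 < d & forall h : R, 0 < h < d ->
    `|f (h *: delta_mx 0 i + (h *: delta_mx 0 j + p)) - f (h *: delta_mx 0 i + p)
      - (f (h *: delta_mx 0 j + p) - f p)
      - h ^+ 2 * partial j (partial i f) p| <= e * h ^+ 2.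
Proof.
move=> e0 df dfi; set ei := delta_mx 0 i; set ej := delta_mx 0 j.
have df0 : \forall w \near (0 : C2 R), differentiable f (w + p).
  have : \forall q \near p, differentiable f q := df.
  by rewrite (near_shift 0) subr0.
have e30 : 0 < e / 4 by rewrite divr_gt0.
have [d d0 dP] := near0_ball (filterI df0 (diff_near dfi e30)).
exists (d / 2); first by rewrite divr_gt0.
move=> h /andP[h0 hd].
have nrm (t : R) w : t \in `[0, h] -> `|w| <= h -> `|t *: ei + w| <= 2 * h.
  rewrite in_itv /= => /andP[t0 th] wh; rewrite (le_trans (ler_normD _ _)) //.
  rewrite normrZ ger0_norm // mulr_natl mulr2n lerD //.
  by rewrite (le_trans (ler_wpM2l t0 (norm_delta_mx i))) // mulr1.
have hej : `|h *: ej| <= h.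
  by rewrite normrZ gtr0_norm // ler_piMr ?norm_delta_mx // ltW.
have h2d : 2 * h < d by lra.
have w1 (t : R) : t \in `[0, h] -> `|t *: ei + h *: ej| < d.
  by move=> tI; rewrite (le_lt_trans (nrm _ _ tI hej)).
have w2 (t : R) : t \in `[0, h] -> `|t *: ei| < d.
  by move=> tI; rewrite -[t *: ei]addr0 (le_lt_trans (nrm _ _ tI _)) ?normr0 ?ltW.
have [t tI E] : exists2 t : R, t \in `[0, h] &
    f (h *: ei + (h *: ej + p)) - f (h *: ei + p) - (f (h *: ej + p) - f p) =
    h * (partial i f (t *: ei + h *: ej + p) - partial i f (t *: ei + p)).
  pose g (t : R) : R := f (t *: ei + (h *: ej + p)) - f (t *: ei + p).
  pose g' (t : R) : R := 'd f (t *: ei + (h *: ej + p)) ei - 'd f (t *: ei + p) ei.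
  have dg (t : R) : t \in `[0, h] -> is_derive t 1 g (g' t).
    move=> tI; apply: is_deriveB; apply: is_derive_line.
      by rewrite addrA; apply: (dP _ (w1 t tI)).1.
    exact: (dP _ (w2 t tI)).1.
  have gder (t : R) : t \in `]0, h[ -> is_derive t 1 g (g' t).
    by move=> tI; apply: dg; apply: subset_itv_oo_cc.
  have gcont : {within `[0, h], continuous g}.
    by apply: derivable_within_continuous => t /dg [].
  have [t tI gE] := MVT h0 gder gcont.
  exists t; first exact: subset_itv_oo_cc tI.
  move: gE; rewrite /g /g' subr0 !scale0r !add0r => ->.
  have tI' : t \in `[0, h] by exact: subset_itv_oo_cc tI.
  rewrite mulrC addrA !partialE //; first exact: (dP _ (w2 t tI')).1.
  exact: (dP _ (w1 t tI')).1.
rewrite E; have [_ E1] := dP _ (w1 t tI); have [_ E2] := dP _ (w2 t tI).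
have A1 : partial j (partial i f) p = 'd (partial i f) p ej by exact: partialE.
have LD : 'd (partial i f) p (t *: ei + h *: ej) =
    'd (partial i f) p (t *: ei) + h * 'd (partial i f) p ej.
  by rewrite linearD; congr (_ + _); rewrite linearZ.
rewrite LD in E1; rewrite A1.
have N1 := nrm _ _ tI hej.
have N2 : `|t *: ei| <= 2 * h.
  by rewrite -[t *: ei]addr0; apply: nrm; rewrite ?normr0 ?ltW.
have {E1 N1} := le_trans E1 (ler_wpM2l (ltW e30) N1).
have {E2 N2} := le_trans E2 (ler_wpM2l (ltW e30) N2).
move: ('d _ _ (t *: ei)) ('d _ _ ej) (partial i f p) => D D' Y.
move: (partial i f _) (partial i f _) => Y1 Y2.
rewrite !ler_norml => /andP[B1 B2] /andP[B3 B4].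
apply/andP; split; nra.
Qed.

(** The second difference is symmetric in the two directions. *)
Lemma partialC f p i j : {near p, forall q, differentiable f q} ->
  differentiable (partial i f) p -> differentiable (partial j f) p ->
  partial i (partial j f) p = partial j (partial i f) p.
Proof.
move=> df dfi dfj; apply/eqP; rewrite -subr_eq0 -normr_eq0; apply/eqP.
apply/eqP; rewrite eq_le normr_ge0 andbT; apply/ler_addgt0Pr => e e0.
rewrite add0r.
have e20 : 0 < e / 2 by rewrite divr_gt0.
have [d d0 dP] := second_difference j e20 df dfi.
have [d' d'0 dP'] := second_difference i e20 df dfj.
pose h := Num.min d d' / 2.
have h0 : 0 < h by rewrite divr_gt0 // lt_min d0 d'0.
have hm : h < Num.min d d' by rewrite /h ltr_pdivrMr // ltr_pMr ?ltr1n // lt_min d0.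
move: hm; rewrite lt_min => /andP[hd hd'].
have := dP h; have := dP' h; rewrite h0 hd hd' => /(_ isT) H1 /(_ isT) H2.
move: H1 H2; rewrite !addrA [h *: delta_mx 0 j + h *: delta_mx 0 i]addrC.
move: (f _) (f _) (f _) (f _) (partial _ _ _) (partial _ _ _) => a b c d1 A B.
have h20 : 0 < h ^+ 2 by rewrite exprn_gt0.
rewrite !ler_norml => /andP[H1 H2] /andP[H3 H4].
by apply/andP; split; rewrite -(ler_pM2r h20); lra.
Qed.
(** Near [p] the line through [p + t v] in the direction [u] meets the zero set
    of [rho], at a distance [s = o(t)], by the intermediate value theorem.  There
    [f] vanishes, so its first order expansion [s df(u) + t df(v)] is [o(t)]. *)
Lemma tangent_vanish U (rho : C2 R -> R) f p u v : open U -> U p ->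
  (forall q, U q -> differentiable rho q) -> differentiable f p ->
  (forall q, U q -> rho q = 0 -> f q = 0) -> rho p = 0 ->
  'd rho p u = 1 -> 'd rho p v = 0 -> 'd f p v = 0.
Proof.
move=> oU Up drho df f0 rho0 du dv.
apply/eqP; rewrite -normr_eq0 eq_le normr_ge0 andbT.
apply/ler_addgt0Pr => e e0; rewrite add0r.
pose a : R := `|'d f p u|; pose N : R := `|v| + `|u|.
have a0 : 0 <= a by exact: normr_ge0.
have N0 : 0 <= N by rewrite addr_ge0.
have N1 : 0 < N + 1 by lra.
have a1 : 0 < a + 1 by lra.
(* Of the total error [e t], half is allotted to the term [s df(u)], where
   [s] is at most [eps t], and half to the remainder of [f]. *)
pose eps : R := Num.min 1 (e / 2 / (a + 1)).
have eps0 : 0 < eps by rewrite lt_min ltr01 !divr_gt0.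
have eps1 : eps <= 1 by rewrite ge_min lexx.
have epsa : eps * a <= e / 2.
  rewrite (@le_trans _ _ (e / 2 / (a + 1) * (a + 1))) //.
    by apply: ler_pM => //; [exact: ltW | rewrite ge_min lexx orbT | lra].
  by rewrite divfK // gt_eqF.
pose eta : R := eps / 2 / (N + 1); pose eta' : R := e / 2 / (N + 1).
have eta0 : 0 < eta by rewrite !divr_gt0.
have eta'0 : 0 < eta' by rewrite !divr_gt0.
have etaN : eta * N <= eps / 2.
  rewrite -[leRHS](@divfK _ (N + 1)) ?gt_eqF // ler_wpM2l ?ltW //; lra.
have eta'N : eta' * N <= e / 2.
  rewrite -[leRHS](@divfK _ (N + 1)) ?gt_eqF // ler_wpM2l ?ltW //; lra.
have U0 : \forall w \near (0 : C2 R), U (w + p).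
  have : \forall q \near p, U q by exact: open_nbhs_nbhs (conj oU Up).
  by rewrite (near_shift 0) subr0.
have [d d0 dP] := near0_ball (filterI U0
  (filterI (diff_near (drho p Up) eta0) (diff_near df eta'0))).
(* A step small enough for [s u + t v] to stay in the ball of radius [d]. *)
pose t : R := d / 2 / (N + 1).
have t0 : 0 < t by rewrite !divr_gt0.
have tN : t * N < d.
  apply: (@le_lt_trans _ _ (d / 2)); last by lra.
  rewrite -[leRHS](@divfK _ (N + 1)) ?gt_eqF // ler_wpM2l ?ltW //; lra.
have wN (s : R) : `|s| <= eps * t -> `|s *: u + t *: v| <= t * N.
  move=> se; apply: (le_trans (ler_normD _ _)).
  have -> : `|t *: v| = t * `|v| by rewrite normrZ gtr0_norm.
  have -> : `|s *: u| = `|s| * `|u| by rewrite normrZ.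
  rewrite /N mulrDr addrC lerD2l ler_wpM2r // (le_trans se) // ler_piMl // ltW //.
have wP s (se : `|s| <= eps * t) := dP _ (le_lt_trans (wN s se) tN).
have itvE (s : R) : s \in `[- (eps * t), eps * t] -> `|s| <= eps * t.
  by rewrite in_itv /= ler_norml.
have et0 : 0 < eps * t by rewrite mulr_gt0.
have rhoE (s : R) : `|s| <= eps * t ->
    `|rho (s *: u + (t *: v + p)) - s| <= eps * t / 2.
  move=> se; have [_ [+ _]] := wP s se.
  have -> : 'd rho p (s *: u + t *: v) = s.
    rewrite linearD; have -> : 'd rho p (s *: u) = s * 1 by rewrite linearZ /= du.
    have -> : 'd rho p (t *: v) = t * 0 by rewrite linearZ /= dv.
    by rewrite mulr1 mulr0 addr0.
  rewrite rho0 add0r addrA => H; apply: (le_trans H).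
  apply: (le_trans (ler_wpM2l (ltW eta0) (wN s se))).
  have -> : eta * (t * N) = t * (eta * N) by ring.
  have -> : eps * t / 2 = t * (eps / 2) by ring.
  by rewrite ler_wpM2l // ltW.
have [s sI s0] : exists2 s : R, s \in `[- (eps * t), eps * t] &
    rho (s *: u + (t *: v + p)) = 0.
  apply: IVT; first by lra.
    apply: continuous_line => s /itvE se; apply: drho.
    by have [+ _] := wP s se; rewrite addrA.
  have := rhoE (eps * t); rewrite ger0_norm ?(ltW et0) // lexx => /(_ isT).
  have := rhoE (- (eps * t)); rewrite normrN ger0_norm ?(ltW et0) // lexx => /(_ isT).
  move: (rho _) (rho _) => r1 r2; rewrite !ler_norml => /andP[A1 A2] /andP[A3 A4].
  by rewrite ge_min le_max; apply/andP; split; apply/orP; [left|right]; lra.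
have se := itvE _ sI; have [Uw [_ fw]] := wP s se.
have fs0 : f (s *: u + t *: v + p) = 0 by apply: f0 => //; rewrite -addrA.
rewrite fs0 (f0 _ Up rho0) !add0r normrN in fw.
have fE : 'd f p (s *: u + t *: v) = s * 'd f p u + t * 'd f p v.
  by rewrite linearD; congr (_ + _); rewrite linearZ.
have := le_trans fw (ler_wpM2l (ltW eta'0) (wN s se)); rewrite fE.
have sa : `|s * 'd f p u| <= eps * t * a by rewrite normrM ler_wpM2r.
have tf : t * `|'d f p v| <= `|s * 'd f p u + t * 'd f p v| + `|s * 'd f p u|.
  have -> : t * `|'d f p v| = `|t * 'd f p v| by rewrite normrM gtr0_norm.
  by have := ler_normB (s * 'd f p u + t * 'd f p v) (s * 'd f p u); rewrite addrAC subrr add0r.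
move=> H; rewrite -(ler_pM2l t0); apply: (le_trans tf).
apply: (le_trans (lerD H sa)).
have -> : eta' * (t * N) + eps * t * a = t * (eta' * N + eps * a) by ring.
apply: ler_wpM2l; first exact: ltW.
by rewrite [leRHS]splitr lerD.
Qed.

(** Apply [tangent_vanish] to the projection of a basis vector to the tangent
    space along [u]. *)
Lemma proportional_partials U (rho : C2 R -> R) f p u i : open U -> U p ->
  (forall q, U q -> differentiable rho q) -> differentiable f p ->
  (forall q, U q -> rho q = 0 -> f q = 0) -> rho p = 0 ->
  'd rho p u = 1 -> partial i f p = 'd f p u * partial i rho p.
Proof.
move=> oU Up drho df f0 rho0 du; set e : C2 R := delta_mx 0 i.
have lin (g : C2 R -> R) c : 'd g p (e - c *: u) = 'd g p e - c * 'd g p u.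
  by rewrite linearB; congr (_ - _); rewrite linearZ.
have Hv : 'd rho p (e - partial i rho p *: u) = 0.
  by rewrite lin du mulr1 partialE ?subrr //; apply: drho.
have := tangent_vanish oU Up drho df f0 rho0 du Hv.
by rewrite lin (partialE _ df) mulrC => /eqP; rewrite subr_eq0 => /eqP.
Qed.

End DifferentiableUpTo.

Section Smooth.
Variable R : realType.
Implicit Types (U V : set (C2 R)) (f g : C2 R -> R) (p q : C2 R).

Lemma smooth_differentiable U f p : smooth U f -> U p -> differentiable f p.
Proof. by move=> sf; apply: (sf [::]). Qed.

Lemma smooth_partial U f i : smooth U f -> smooth U (partial i f).
Proof.
by move=> sf s p Up; have := sf (rcons s i) p Up; rewrite foldr_rcons.
Qed.

Lemma eq_on_smooth U f g : open U -> {in U, f =1 g} -> smooth U f -> smooth U g.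
Proof.
move=> oU fg /smooth_uptoP sf; apply/smooth_uptoP => k.
exact: eq_on_smooth_upto (sf k).
Qed.

Lemma smoothD U f g : open U -> smooth U f -> smooth U g -> smooth U (f \+ g).
Proof.
move=> oU /smooth_uptoP sf /smooth_uptoP sg; apply/smooth_uptoP => k.
exact: smooth_uptoD.
Qed.

Lemma smoothM U f g : open U -> smooth U f -> smooth U g -> smooth U (f \* g).
Proof.
move=> oU /smooth_uptoP sf /smooth_uptoP sg; apply/smooth_uptoP => k.
exact: smooth_uptoM.
Qed.

Lemma smooth_cst U (c : R) : smooth U (cst c).
Proof. by apply/smooth_uptoP => k; apply: smooth_upto_cst. Qed.

Lemma smoothN U f : open U -> smooth U f -> smooth U (fun q => - f q).
Proof.
move=> oU sf; have := smoothM oU (smooth_cst (U := U) (-1)) sf.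
by apply: eq_on_smooth => // q _ /=; rewrite mulN1r.
Qed.

Lemma smooth_comp U V f (H : C2 R -> C2 R) : open U ->
  (forall p, U p -> V (H p)) -> (forall j, smooth U (fun q => H q 0 j)) ->
  smooth V f -> smooth U (f \o H).
Proof.
move=> oU HV sH /smooth_uptoP sf; apply/smooth_uptoP => k.
exact: smooth_upto_comp (sf k).
Qed.

Lemma smooth_partialC U f i j p : open U -> smooth U f -> U p ->
  partial i (partial j f) p = partial j (partial i f) p.
Proof.
move=> oU sf Up; apply: partialC.
- apply: filterS (open_nbhs_nbhs (conj oU Up)) => q.
  exact: smooth_differentiable.
- exact: smooth_differentiable (smooth_partial i sf) Up.
- exact: smooth_differentiable (smooth_partial j sf) Up.
Qed.

Lemma partialN i f p : differentiable f p ->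
  partial i (fun q => - f q) p = - partial i f p.
Proof.
by move=> df; apply: deriveN; apply: diff_derivable.
Qed.

End Smooth.

(** * Smooth complex functions *)

Section ComplexSmooth.
Variable R : realType.
Local Notation C := R[i].
Local Notation Re := complex.Re.
Local Notation Im := complex.Im.
Implicit Types (U V : set (C2 R)) (f g : C2 R -> C) (p q : C2 R).

Lemma complex_ReD (x y : C) : Re (x + y) = Re x + Re y.
Proof. by case: x y => [a b] [c d]. Qed.

Lemma complex_ImD (x y : C) : Im (x + y) = Im x + Im y.
Proof. by case: x y => [a b] [c d]. Qed.

Lemma complex_ReM (x y : C) : Re (x * y) = Re x * Re y - Im x * Im y.
Proof. by case: x y => [a b] [c d]. Qed.

Lemma complex_ImM (x y : C) : Im (x * y) = Re x * Im y + Im x * Re y.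
Proof. by case: x y => [a b] [c d]. Qed.

Lemma eq_ReIm (x y : C) : Re x = Re y -> Im x = Im y -> x = y.
Proof. by case: x y => [a b] [c d] /= -> ->. Qed.

Lemma csmoothD U f g : open U -> csmooth U f -> csmooth U g -> csmooth U (f + g).
Proof.
move=> oU [sf1 sf2] [sg1 sg2]; split.
  apply: eq_on_smooth (smoothD oU sf1 sg1) => // q _.
  by rewrite -[(f + g) q]/(f q + g q) complex_ReD.
apply: eq_on_smooth (smoothD oU sf2 sg2) => // q _.
by rewrite -[(f + g) q]/(f q + g q) complex_ImD.
Qed.

Lemma csmoothM U f g : open U -> csmooth U f -> csmooth U g -> csmooth U (f * g).
Proof.
move=> oU [sf1 sf2] [sg1 sg2]; split.
  apply: eq_on_smooth (smoothD oU (smoothM oU sf1 sg1)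
    (smoothN oU (smoothM oU sf2 sg2))) => // q _.
  by rewrite -[(f * g) q]/(f q * g q) complex_ReM.
apply: eq_on_smooth (smoothD oU (smoothM oU sf1 sg2) (smoothM oU sf2 sg1)) => // q _.
by rewrite -[(f * g) q]/(f q * g q) complex_ImM.
Qed.

Lemma csmooth_cst U (c : C) : csmooth U (fun=> c).
Proof. by split; apply: smooth_cst. Qed.

Lemma csmoothN U f : open U -> csmooth U f -> csmooth U (- f).
Proof.
by move=> oU sf; rewrite -mulN1r; apply: csmoothM => //; apply: csmooth_cst.
Qed.

Lemma csmooth_toC U (f : C2 R -> R) : smooth U f -> csmooth U (toC f).
Proof. by move=> sf; split=> //; apply: smooth_cst. Qed.

Definition conjf f : C2 R -> C := fun q => conjc (f q).

Lemma csmooth_conj U f : open U -> csmooth U f -> csmooth U (conjf f).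
Proof.
move=> oU [sf1 sf2]; split.
  by apply: eq_on_smooth sf1 => // q _; rewrite /conjf; case: (f q).
by apply: eq_on_smooth (smoothN oU sf2) => // q _; rewrite /conjf; case: (f q).
Qed.

Lemma csmooth_cpartial U f i : csmooth U f -> csmooth U (cpartial i f).
Proof. by move=> [sf1 sf2]; split; apply: smooth_partial. Qed.

Lemma csmooth_comp U V f (H : C2 R -> C2 R) : open U ->
  (forall p, U p -> V (H p)) -> (forall j, smooth U (fun q => H q 0 j)) ->
  csmooth V f -> csmooth U (f \o H).
Proof.
move=> oU HV sH [sf1 sf2].
by split; [apply: (smooth_comp oU HV sH sf1) | apply: (smooth_comp oU HV sH sf2)].
Qed.

Lemma eq_on_cpartial U f g i : open U -> {in U, f =1 g} ->
  {in U, cpartial i f =1 cpartial i g}.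
Proof.
move=> oU fg p Up; congr (_ +i* _)%C; apply: (eq_on_partial _ oU) => // q Uq;
  by rewrite fg.
Qed.

Lemma cpartialD U f g i p : open U -> csmooth U f -> csmooth U g -> U p ->
  cpartial i (f + g) p = cpartial i f p + cpartial i g p.
Proof.
move=> oU [sf1 sf2] [sg1 sg2] Up.
have d h : smooth U h -> differentiable h p.
  by move=> sh; apply: smooth_differentiable sh Up.
apply: eq_ReIm; rewrite ?complex_ReD ?complex_ImD /=.
  rewrite -partialD; [|exact: d|exact: d].
  by congr (partial i _ p); apply/funext => q; exact: complex_ReD.
rewrite -partialD; [|exact: d|exact: d].
by congr (partial i _ p); apply/funext => q; exact: complex_ImD.
Qed.

Lemma cpartialM U f g i p : open U -> csmooth U f -> csmooth U g -> U p ->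
  cpartial i (f * g) p = cpartial i f p * g p + f p * cpartial i g p.
Proof.
move=> oU [sf1 sf2] [sg1 sg2] Up.
have d h : smooth U h -> differentiable h p.
  by move=> sh; apply: smooth_differentiable sh Up.
have E1 : (fun q => Re ((f * g) q)) = ((fun q => Re (f q)) \* (fun q => Re (g q)))
   \+ (fun q => - ((fun q => Im (f q)) \* (fun q => Im (g q))) q).
  by apply/funext => q; rewrite -[(f * g) q]/(f q * g q) complex_ReM.
have E2 : (fun q => Im ((f * g) q)) = ((fun q => Re (f q)) \* (fun q => Im (g q)))
   \+ ((fun q => Im (f q)) \* (fun q => Re (g q))).
  by apply/funext => q; rewrite -[(f * g) q]/(f q * g q) complex_ImM.
have sm h1 h2 : smooth U h1 -> smooth U h2 -> differentiable (h1 \* h2) p.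
  by move=> s1 s2; apply/d/smoothM.
apply: eq_ReIm; rewrite ?(complex_ReD, complex_ReM, complex_ImD, complex_ImM) /= ?E1 ?E2.
  rewrite partialD; [|exact: sm|]; last first.
    by apply: d; apply: smoothN => //; apply: smoothM.
  by rewrite partialN ?partialM; try exact: sm; try exact: d; rewrite /=; ring.
rewrite partialD; [|exact: sm|exact: sm].
by rewrite !partialM; try exact: d; rewrite /=; ring.
Qed.

Lemma cpartial_cst i (c : C) p : cpartial i (fun=> c) p = 0.
Proof. by apply: eq_ReIm => /=; apply: partial_cst. Qed.

Lemma cpartialC U f i j p : open U -> csmooth U f -> U p ->
  cpartial i (cpartial j f) p = cpartial j (cpartial i f) p.
Proof.
by move=> oU [sf1 sf2] Up; apply: eq_ReIm => /=; apply: (smooth_partialC _ _ oU).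
Qed.

Lemma cpartial_conj U f i p : csmooth U f -> U p ->
  cpartial i (conjf f) p = conjc (cpartial i f p).
Proof.
move=> [sf1 sf2] Up; apply: eq_ReIm => /=.
  by congr (partial i _ p); apply/funext => q; rewrite /conjf; case: (f q).
rewrite -partialN; last exact: smooth_differentiable sf2 Up.
by congr (partial i _ p); apply/funext => q; rewrite /conjf; case: (f q).
Qed.

Lemma cpartial_comp U V f (H : C2 R -> C2 R) p i : csmooth V f ->
  (forall p, U p -> V (H p)) -> (forall j, smooth U (fun q => H q 0 j)) -> U p ->
  cpartial i (f \o H) p =
    \sum_(j < 4) cpartial j f (H p) * (partial i (fun q => H q 0 j) p)%:C%C.
Proof.
move=> [sf1 sf2] HV sH Up.
have dH j : differentiable (fun q => H q 0 j) p.
  exact: smooth_differentiable (sH j) Up.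
have ReS (F : 'I_4 -> C) : Re (\sum_j F j) = \sum_j Re (F j).
  by elim/big_rec2: _ => // j x y _ <-; rewrite complex_ReD.
have ImS (F : 'I_4 -> C) : Im (\sum_j F j) = \sum_j Im (F j).
  by elim/big_rec2: _ => // j x y _ <-; rewrite complex_ImD.
apply: eq_ReIm; rewrite ?ReS ?ImS.
  rewrite [LHS]/= (partial_comp (f := fun q => Re (f q))) //; last first.
    exact: smooth_differentiable sf1 (HV _ Up).
  by apply: eq_bigr => j _; rewrite complex_ReM /= mulr0 subr0.
rewrite [LHS]/= (partial_comp (f := fun q => Im (f q))) //; last first.
  exact: smooth_differentiable sf2 (HV _ Up).
by apply: eq_bigr => j _; rewrite complex_ImM /= mulr0 add0r.
Qed.

End ComplexSmooth.

(** * Wirtinger operators *)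

Lemma ord4_ind (P : 'I_4 -> Prop) : P (inord 0) -> P (inord 1) -> P (inord 2) ->
  P (inord 3) -> forall i, P i.
Proof.
move=> P0 P1 P2 P3 i; rewrite -(inord_val i); move: (nat_of_ord i) (ltn_ord i).
by case=> [|[|[|[|k]]]].
Qed.

Lemma sum4 (V : nmodType) (F : 'I_4 -> V) :
  \sum_j F j = F (inord 0) + F (inord 1) + F (inord 2) + F (inord 3).
Proof.
rewrite 4!big_ord_recl big_ord0 addr0 !addrA.
by congr (F _ + F _ + F _ + F _); apply: val_inj; rewrite /= inordK.
Qed.

Section Wirtinger.
Variable R : realType.
Local Notation C := R[i].
Implicit Types (U V : set (C2 R)) (f g : C2 R -> C) (p q : C2 R).

(** The four operators indexed by the variables [z, w, zbar, wbar], in the order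
    used for formal power series. *)
Definition wirtinger_op (S : comPzRingType) (d : wirtinger S) (i : 'I_4) : S -> S :=
  nth (d_z d) [:: d_z d; d_w d; d_zb d; d_wb d] i.

Lemma wirtinger_opE (S : comPzRingType) (d : wirtinger S) :
  [/\ d_z d = wirtinger_op d (inord 0), d_w d = wirtinger_op d (inord 1),
      d_zb d = wirtinger_op d (inord 2) & d_wb d = wirtinger_op d (inord 3)].
Proof. by rewrite /wirtinger_op !inordK. Qed.

Definition dfun := wirtinger_op (wirtinger_fun R).

Definition re_var (i : 'I_4) : 'I_4 := inord (2 * (i %% 2)).
Definition im_var (i : 'I_4) : 'I_4 := inord (2 * (i %% 2)).+1.
Definition im_coef (i : 'I_4) : C := (-1) ^+ (i < 2)%N * 'i / 2%:R.

(** A common expression for the four operators, from which their rules follow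
    by linearity from those of the real partial derivatives. *)
Lemma dfunE i f p :
  dfun i f p = 2%:R^-1 * cpartial (re_var i) f p + im_coef i * cpartial (im_var i) f p.
Proof.
have E1 (K : fieldType) (h I a b : K) :
    (a - I * b) / h = h^-1 * a + (-1) ^+ 1 * I / h * b by ring.
have E2 (K : fieldType) (h I a b : K) :
    (a + I * b) / h = h^-1 * a + (-1) ^+ 0 * I / h * b by ring.
rewrite /dfun /wirtinger_op /re_var /im_var /im_coef.
by move: i; apply: ord4_ind; rewrite !inordK //=; [exact: E1|exact: E1|exact: E2|exact: E2].
Qed.

Lemma dfun_fun i f : dfun i f =
  (fun=> 2%:R^-1) * cpartial (re_var i) f + (fun=> im_coef i) * cpartial (im_var i) f.
Proof. by apply/funext => p; rewrite dfunE. Qed.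

Lemma eq_on_dfun U f g i : open U -> {in U, f =1 g} -> {in U, dfun i f =1 dfun i g}.
Proof.
by move=> oU fg p Up; rewrite !dfunE !(eq_on_cpartial _ oU fg).
Qed.

Lemma csmooth_dfun U f i : open U -> csmooth U f -> csmooth U (dfun i f).
Proof.
move=> oU sf; rewrite dfun_fun.
by apply: csmoothD => //; apply: csmoothM => //;
  by [apply: csmooth_cst | apply: csmooth_cpartial].
Qed.

Lemma dfunD U f g i p : open U -> csmooth U f -> csmooth U g -> U p ->
  dfun i (f + g) p = dfun i f p + dfun i g p.
Proof.
have alg (K : comNzRingType) (h a x y z w : K) :
  h * (x + y) + a * (z + w) = (h * x + a * z) + (h * y + a * w) by ring.
move=> oU sf sg Up; rewrite !dfunE !(cpartialD _ oU sf sg Up); exact: alg.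
Qed.

Lemma dfunM U f g i p : open U -> csmooth U f -> csmooth U g -> U p ->
  dfun i (f * g) p = dfun i f p * g p + f p * dfun i g p.
Proof.
have alg (K : comNzRingType) (h a f0 g0 x y z w : K) :
  h * (x * g0 + f0 * y) + a * (z * g0 + f0 * w) =
  (h * x + a * z) * g0 + f0 * (h * y + a * w) by ring.
move=> oU sf sg Up; rewrite !dfunE !(cpartialM _ oU sf sg Up); exact: alg.
Qed.

Lemma dfun_cst i (c : C) p : dfun i (fun=> c) p = 0.
Proof. by rewrite dfunE !cpartial_cst !mulr0 addr0. Qed.

Lemma cpartialZ U k (c : C) f p : open U -> csmooth U f -> U p ->
  cpartial k ((fun=> c) * f) p = c * cpartial k f p.
Proof.
move=> oU sf Up; rewrite (cpartialM _ oU (csmooth_cst U c) sf Up).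
by rewrite cpartial_cst mul0r add0r.
Qed.

Lemma dfunC U f i j p : open U -> csmooth U f -> U p ->
  dfun i (dfun j f) p = dfun j (dfun i f) p.
Proof.
move=> oU sf Up.
have E k l : cpartial k (dfun l f) p = 2%:R^-1 * cpartial k (cpartial (re_var l) f) p
    + im_coef l * cpartial k (cpartial (im_var l) f) p.
  have sc (c : C) m : csmooth U ((fun=> c) * cpartial m f).
    by apply: csmoothM => //; [apply: csmooth_cst | apply: csmooth_cpartial].
  rewrite dfun_fun (cpartialD _ oU (sc _ _) (sc _ _) Up).
  by congr (_ + _); apply: (cpartialZ _ _ oU _ Up); apply: csmooth_cpartial.
rewrite !dfunE !E.
have cC k l := cpartialC k l oU sf Up.
rewrite (cC (re_var i) (re_var j)) (cC (im_var i) (re_var j)).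
rewrite (cC (re_var i) (im_var j)) (cC (im_var i) (im_var j)).
have swap (K : comNzRingType) (h a b x y z w : K) :
  h * (h * x + a * y) + b * (h * z + a * w) =
  h * (h * x + b * z) + a * (h * y + b * w) by ring.
exact: swap.
Qed.

Lemma dfun_conj U f i p : csmooth U f -> U p ->
  dfun i (conjf f) p = conjc (dfun (FormalSeries.conj_var i) f p).
Proof.
have cl (h c A B : C) :
    conjc (h * A + c * B) = conjc h * conjc A + conjc c * conjc B.
  by rewrite rmorphD !rmorphM.
move=> sf Up; rewrite !dfunE !(cpartial_conj _ sf Up) cl.
have -> : re_var (FormalSeries.conj_var i) = re_var i.
  rewrite /re_var; congr inord; rewrite /FormalSeries.conj_var inordK ?ltn_mod //.
  by move: i; apply: ord4_ind; rewrite !inordK.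
have -> : im_var (FormalSeries.conj_var i) = im_var i.
  rewrite /im_var; congr inord; rewrite /FormalSeries.conj_var inordK ?ltn_mod //.
  by move: i; apply: ord4_ind; rewrite !inordK.
have -> : conjc (im_coef (FormalSeries.conj_var i)) = im_coef i.
  rewrite /im_coef /FormalSeries.conj_var inordK ?ltn_mod //.
  have ci : conjc ('i : C) = - 'i by exact: conjCi.
  have cm (x y z : C) : conjc (x * y * z) = conjc x * conjc y * conjc z.
    by rewrite !rmorphM.
  have cs b : conjc ((-1) ^+ b : C) = (-1) ^+ b.
    by rewrite rmorphXn rmorphN rmorph1.
  have c2 : conjc (2%:R^-1 : C) = 2%:R^-1 by rewrite fmorphV rmorph_nat.
  rewrite cm cs ci c2.
  by move: i; apply: ord4_ind; rewrite !inordK //= ?expr1 ?expr0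
    ?mul1r ?mulrN ?mulN1r ?opprK ?mulNr ?opprK.
have -> // : conjc (2%:R^-1 : C) = 2%:R^-1 by rewrite fmorphV rmorph_nat.
Qed.

Definition coords_and_conj (H : C2 R -> C2 R) (j : 'I_4) : C2 R -> C :=
  let h1 := @z_of R \o H in let h2 := @w_of R \o H in
  nth h1 [:: h1; h2; conjf h1; conjf h2] j.

(** The chain rule is linear in the outer derivative, so it holds for
    the real partial derivatives first, where the coordinates of [H] have to be
    recombined into the [coords_and_conj H j]. *)
Lemma dfun_comp U V f (H : C2 R -> C2 R) p i : csmooth V f ->
  (forall p, U p -> V (H p)) -> (forall j, smooth U (fun q => H q 0 j)) -> U p ->
  dfun i (f \o H) p = \sum_j dfun j f (H p) * dfun i (coords_and_conj H j) p.
Proof.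
move=> sf HV sH Up.
pose D k l : C := (partial k (fun q => H q 0 l) p)%:C%C.
have ii : ('i : C) * 'i = -1 by rewrite -expr2 sqrCi.
have cz k : cpartial k (@z_of R \o H) p = D k (inord 0) + 'i * D k (inord 1).
  by rewrite [LHS]complexE.
have cw k : cpartial k (@w_of R \o H) p = D k (inord 2) + 'i * D k (inord 3).
  by rewrite [LHS]complexE.
have sz : csmooth U (@z_of R \o H) by split; apply: sH.
have sw : csmooth U (@w_of R \o H) by split; apply: sH.
have cj k l : conjc (D k l) = D k l by exact: conjc_real.
have ci : conjc ('i : C) = - 'i by exact: conjCi.
have cl (x y z : C) : conjc (x + y * z) = conjc x + conjc y * conjc z.
  by rewrite rmorphD rmorphM.
have czb k : cpartial k (conjf (@z_of R \o H)) p = D k (inord 0) - 'i * D k (inord 1).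
  by rewrite (cpartial_conj _ sz Up) cz cl !cj ci mulNr.
have cwb k : cpartial k (conjf (@w_of R \o H)) p = D k (inord 2) - 'i * D k (inord 3).
  by rewrite (cpartial_conj _ sw Up) cw cl !cj ci mulNr.
have alg (K : fieldType) (I d0 d1 d2 d3 c0 c1 c2 c3 : K) :
    I * I = -1 -> (2%:R : K) != 0 ->
    c0 * d0 + c1 * d1 + c2 * d2 + c3 * d3 =
    (2%:R^-1 * c0 + (-1) ^+ 1 * I / 2%:R * c1) * (d0 + I * d1) +
    (2%:R^-1 * c2 + (-1) ^+ 1 * I / 2%:R * c3) * (d2 + I * d3) +
    (2%:R^-1 * c0 + (-1) ^+ 0 * I / 2%:R * c1) * (d0 - I * d1) +
    (2%:R^-1 * c2 + (-1) ^+ 0 * I / 2%:R * c3) * (d2 - I * d3).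
  move=> II n2; transitivity (c0 * d0 - I * I * (c1 * d1) + c2 * d2
    - I * I * (c3 * d3)); first by rewrite II !mulN1r !opprK.
  by field; rewrite n2.
have key k : cpartial k (f \o H) p = \sum_j dfun j f (H p) * cpartial k (coords_and_conj H j) p.
  rewrite (cpartial_comp _ sf HV sH Up) !sum4 -!/(D _ _).
  rewrite /coords_and_conj !inordK //= cz cw czb cwb !dfunE /re_var /im_var /im_coef.
  rewrite !inordK //=.
  by apply: alg; rewrite ?pnatr_eq0.
rewrite dfunE !key !mulr_sumr -big_split; apply: eq_bigr => j _ /=.
by rewrite (dfunE i) mulrDr [X in X + _]mulrCA [X in _ + X]mulrCA.
Qed.

End Wirtinger.

(** * Taylor series *)

Section Taylor.
Import FormalSeries.
Variable R : realType.
Local Notation C := R[i].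
Implicit Types (U V : set (C2 R)) (f g : C2 R -> C) (p q : C2 R).

Definition dword (s : seq 'I_4) f := foldr (@dfun R) f s.

Lemma csmooth_dword U f s : open U -> csmooth U f -> csmooth U (dword s f).
Proof. by move=> oU sf; elim: s => //= i s IH; apply: csmooth_dfun. Qed.

Lemma eq_on_dword U f g s : open U -> {in U, f =1 g} ->
  {in U, dword s f =1 dword s g}.
Proof. by move=> oU fg; elim: s => //= i s IH; apply: eq_on_dfun. Qed.

(** Symmetry of second derivatives, applied repeatedly. *)
Lemma dword_move U f s1 i s2 : open U -> csmooth U f ->
  {in U, dword (s1 ++ i :: s2) f =1 dword (i :: s1 ++ s2) f}.
Proof.
move=> oU sf; elim: s1 => //= j s1 IH p Up.
rewrite (eq_on_dfun j oU IH Up) /= (dfunC _ _ oU _ (set_mem Up)) //.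
exact: csmooth_dword.
Qed.

Definition monom_word (m : mpoly.multinom 4) : seq 'I_4 :=
  let e k := mexp m (inord k) in
  nseq (e 0%N) (inord 0) ++ nseq (e 1%N) (inord 1) ++
  nseq (e 2%N) (inord 2) ++ nseq (e 3%N) (inord 3).

Definition monom_fact (m : mpoly.multinom 4) : nat :=
  let e k := mexp m (inord k) in
  (e 0%N)`! * (e 1%N)`! * (e 2%N)`! * (e 3%N)`!.

Lemma taylorE f p m :
  taylor f p m = dword (monom_word m) f p / (monom_fact m)%:R.
Proof.
have [E0 E1 E2 E3] := wirtinger_opE (wirtinger_fun R).
have iterE n i g : foldr (@dfun R) g (nseq n i) = iter n (dfun i) g.
  by elim: n => //= n ->.
rewrite /monom_word /dword !foldr_cat !iterE /dfun -E0 -E1 -E2 -E3.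
by [].
Qed.

Lemma monom_word_mshift m i : exists s1 s2,
  monom_word (mshift i m) = s1 ++ i :: s2 /\ monom_word m = s1 ++ s2.
Proof.
rewrite /monom_word !mexp_mshift.
set e0 := mexp m _; set e1 := mexp m _; set e2 := mexp m _; set e3 := mexp m _.
move: i; apply: ord4_ind; rewrite -!val_eqE /= !inordK //= !add0n ?add1n.
- by exists [::]; eexists.
- by exists (nseq e0 (inord 0)); eexists.
- exists (nseq e0 (inord 0) ++ nseq e1 (inord 1)); eexists.
  by rewrite /= -!catA.
- exists (nseq e0 (inord 0) ++ nseq e1 (inord 1) ++ nseq e2 (inord 2)); eexists.
  by rewrite /= -!catA.
Qed.

Lemma monom_fact_mshift m i :
  monom_fact (mshift i m) = ((mexp m i).+1 * monom_fact m)%N.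
Proof.
rewrite /monom_fact !mexp_mshift.
move: i; apply: ord4_ind; rewrite -!val_eqE /= !inordK //= !add0n ?add1n factS; lia.
Qed.

(** The factorials in [taylor] absorb the exponent produced by the derivation. *)
Lemma taylor_fderiv U f i p : open U -> csmooth U f -> U p ->
  fderiv i (taylor f p) = taylor (dfun i f) p.
Proof.
move=> oU sf Up; apply: fpsP => m; rewrite coef_fderiv !taylorE.
have [s1 [s2 [-> ->]]] := monom_word_mshift m i.
have UP : p \in U by rewrite inE.
rewrite (dword_move _ _ _ oU sf UP).
have -> : dword (s1 ++ s2) (dfun i f) = dword ((s1 ++ s2) ++ i :: [::]) f.
  by rewrite /dword !foldr_cat.
rewrite (dword_move _ _ _ oU sf UP) cats0 monom_fact_mshift.
have cancel (K : numFieldType) (x : K) k l : x / (k.+1 * l)%:R *+ k.+1 = x / l%:R.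
  by rewrite -mulr_natr natrM invfM -mulrA mulrAC mulVf ?mul1r // pnatr_eq0.
exact: cancel.
Qed.

Lemma taylor_const f p : fps_const (taylor f p) = f p.
Proof.
rewrite fps_constE taylorE /monom_word /monom_fact !mexp0 /=.
by rewrite divr1.
Qed.

Lemma eq_on_taylor U f g p : open U -> U p -> {in U, f =1 g} ->
  taylor f p = taylor g p.
Proof.
move=> oU Up fg; apply: fpsP => m; rewrite !taylorE (eq_on_dword _ oU fg) //.
by rewrite inE.
Qed.

Lemma taylorD U f g p : open U -> csmooth U f -> csmooth U g -> U p ->
  taylor (f + g) p = taylor f p + taylor g p.
Proof.
move=> oU sf sg Up; apply: fps_eq_upto_eq => N.
elim: N f g sf sg => [|N IH] f g sf sg.
  by apply: fps_eq_upto0; rewrite fps_constD !taylor_const.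
apply: fps_eq_uptoS => [|i]; first by rewrite fps_constD !taylor_const.
rewrite (derD (@fderiv_derivation 4 C i)).
rewrite !(taylor_fderiv _ oU _ Up) //; last exact: csmoothD.
rewrite (@eq_on_taylor U _ (dfun i f + dfun i g)) //; last first.
  by move=> q Uq; apply: (dfunD _ oU sf sg); rewrite inE in Uq.
by apply: IH; apply: csmooth_dfun.
Qed.

Lemma taylorM U f g p : open U -> csmooth U f -> csmooth U g -> U p ->
  taylor (f * g) p = taylor f p * taylor g p.
Proof.
move=> oU sf sg Up; apply: fps_eq_upto_eq => N.
elim: N f g sf sg => [|N IH] f g sf sg.
  by apply: fps_eq_upto0; rewrite fps_constM !taylor_const.
apply: fps_eq_uptoS => [|i]; first by rewrite fps_constM !taylor_const.
rewrite (derM (@fderiv_derivation 4 C i)).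
rewrite !(taylor_fderiv _ oU _ Up) //; last exact: csmoothM.
rewrite (@eq_on_taylor U _ (dfun i f * g + f * dfun i g)) //; last first.
  by move=> q Uq; apply: (dfunM _ oU sf sg); rewrite inE in Uq.
have [sf' sg'] := (csmooth_dfun i oU sf, csmooth_dfun i oU sg).
rewrite (taylorD oU _ _ Up); try exact: csmoothM.
by move=> m mN; rewrite !coef_fpsD !IH.
Qed.

Lemma taylor0 p : taylor (0 : C2 R -> C) p = 0.
Proof.
have s0 : csmooth setT (0 : C2 R -> C) by apply: csmooth_cst.
by apply: (addrI (taylor 0 p)); rewrite -(taylorD openT s0 s0) // !addr0.
Qed.

Lemma taylorN U f p : open U -> csmooth U f -> U p ->
  taylor (- f) p = - taylor f p.
Proof.
move=> oU sf Up; apply: (addrI (taylor f p)).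
by rewrite -(taylorD oU sf (csmoothN oU sf) Up) !subrr taylor0.
Qed.

Lemma coef_fps_conj (F : fps 4 C) m : fps_conj F m = conjc (F (mswap m)).
Proof. by []. Qed.

Lemma taylor_conj U f p : open U -> csmooth U f -> U p ->
  taylor (conjf f) p = fps_conj (taylor f p).
Proof.
move=> oU sf Up; apply: fps_eq_upto_eq => N.
have c0 g : fps_const (taylor (conjf g) p) = fps_const (fps_conj (taylor g p)).
  by rewrite taylor_const fps_constE coef_fps_conj mswap0 -fps_constE taylor_const.
elim: N f sf => [|N IH] f sf; first exact: fps_eq_upto0.
apply: fps_eq_uptoS => // i; rewrite (taylor_fderiv _ oU (csmooth_conj oU sf) Up).
rewrite (@eq_on_taylor U _ (conjf (dfun (conj_var i) f))) //; last first.
  by move=> q Uq; apply: (dfun_conj _ sf); rewrite inE in Uq.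
move=> m mN; rewrite IH //; last exact: csmooth_dfun.
rewrite coef_fderiv !coef_fps_conj mswap_mshift.
rewrite -(taylor_fderiv _ oU sf Up) coef_fderiv mexp_mswap conj_varK.
by rewrite rmorphMn.
Qed.

Lemma csmooth_coords_and_conj U (H : C2 R -> C2 R) j : open U ->
  csmooth U (@z_of R \o H) -> csmooth U (@w_of R \o H) ->
  csmooth U (coords_and_conj H j).
Proof.
move=> oU sz sw; rewrite /coords_and_conj.
by move: j; apply: ord4_ind; rewrite !inordK //=; apply: csmooth_conj.
Qed.

Lemma smooth_coords U (H : C2 R -> C2 R) :
  csmooth U (@z_of R \o H) -> csmooth U (@w_of R \o H) ->
  forall j, smooth U (fun q => H q 0 j).
Proof. by move=> [s0 s1] [s2 s3]; apply: ord4_ind. Qed.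

Lemma taylor_coords_and_conj U (H : C2 R -> C2 R) j p : open U ->
  csmooth U (@z_of R \o H) -> csmooth U (@w_of R \o H) -> U p ->
  let h1 := taylor (@z_of R \o H) p in let h2 := taylor (@w_of R \o H) p in
  taylor (coords_and_conj H j) p = nth h1 [:: h1; h2; fps_conj h1; fps_conj h2] j.
Proof.
move=> oU sz sw Up /=; rewrite /coords_and_conj.
by move: j; apply: ord4_ind; rewrite !inordK //=; apply: taylor_conj Up.
Qed.

(** Both sides have the same constant term and, by the two chain rules, their
    derivatives are given by the same formula from Taylor series of derivatives
    of [f]. *)
Lemma taylor_comp U V f (H : C2 R -> C2 R) p : open U -> open V -> csmooth V f ->
  (forall p, U p -> V (H p)) ->
  csmooth U (@z_of R \o H) -> csmooth U (@w_of R \o H) -> U p ->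
  taylor (f \o H) p =
    formal_pullback (taylor (@z_of R \o H) p) (taylor (@w_of R \o H) p)
      (taylor f (H p)).
Proof.
move=> oU oV sf HV sz sw Up; have sH := smooth_coords sz sw.
set h1 := taylor (@z_of R \o H) p; set h2 := taylor (@w_of R \o H) p.
have s0 (j : 'I_4) : fps_const
   (fps_centered (nth h1 [:: h1; h2; fps_conj h1; fps_conj h2] j)) = 0.
  exact: fps_const_centered.
have c0 g : fps_const (taylor (g \o H) p) =
    fps_const (formal_pullback h1 h2 (taylor g (H p))).
  by rewrite /formal_pullback (fps_const_subst s0) !taylor_const.
apply: fps_eq_upto_eq => N; elim: N f sf => [|N IH] f sf; first exact: fps_eq_upto0.
have scomp g : csmooth V g -> csmooth U (g \o H).
  by move=> sg; apply: csmooth_comp sg.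
apply: fps_eq_uptoS => // i; rewrite (taylor_fderiv _ oU (scomp _ sf) Up).
rewrite (fderiv_subst s0).
rewrite (@eq_on_taylor U _
   (\sum_j (dfun j f \o H) * dfun i (coords_and_conj H j))) //; last first.
  move=> q /set_mem Uq; rewrite (dfun_comp i sf HV sH Uq) fct_sumE.
  by apply: eq_bigr.
have ssum (r : seq 'I_4) (G : 'I_4 -> C2 R -> C) :
    (forall j, csmooth U (G j)) -> csmooth U (\sum_(j <- r) G j).
  move=> sG; elim/big_ind: _ => // [|g1 g2]; first exact: csmooth_cst.
  exact: csmoothD.
have tsum (r : seq 'I_4) (G : 'I_4 -> C2 R -> C) : (forall j, csmooth U (G j)) ->
    taylor (\sum_(j <- r) G j) p = \sum_(j <- r) taylor (G j) p.
  move=> sG; elim: r => [|j r IHr]; first by rewrite !big_nil taylor0.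
  by rewrite !big_cons (taylorD oU) ?IHr //; apply: ssum.
have s1 j : csmooth U (dfun j f \o H) by apply/scomp/csmooth_dfun.
have s2 j : csmooth U (dfun i (coords_and_conj H j)).
  by apply: csmooth_dfun => //; apply: csmooth_coords_and_conj.
rewrite tsum => [|j]; last exact: csmoothM.
apply: fps_eq_upto_sum => j; rewrite (taylorM oU (s1 j) (s2 j) Up).
apply: fps_eq_uptoM.
  rewrite (taylor_fderiv _ oV sf (HV _ Up)); apply: IH; exact: csmooth_dfun.
rewrite fderiv_centered -(taylor_coords_and_conj _ oU sz sw Up).
by rewrite (taylor_fderiv _ oU) //; apply: csmooth_coords_and_conj.
Qed.

End Taylor.

(** * Formal changes of coordinates *)

Section FormalTransformation.
Import FormalSeries.
Variable R : realType.
Local Notation C := R[i].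
Local Notation fps4 := (fps 4 C).
Local Notation d := (wirtinger_fps R).

Lemma commuting_wirtinger_fps : commuting_wirtinger d.
Proof.
by split; rewrite /=; try exact: fderiv_derivation; move=> f; rewrite fderivC.
Qed.

Lemma fderiv_fps_conj i (f : fps4) :
  fderiv i (fps_conj f) = fps_conj (fderiv (conj_var i) f).
Proof.
apply: fpsP => m; rewrite coef_fderiv !coef_fps_conj coef_fderiv.
by rewrite mswap_mshift mexp_mswap conj_varK rmorphMn.
Qed.

Lemma fps_conj0 : fps_conj (0 : fps4) = 0.
Proof. by apply: fpsP => m; rewrite coef_fps_conj coef_fps0 rmorph0. Qed.

Lemma fps_constB (f g : fps4) : fps_const (f - g) = fps_const f - fps_const g.
Proof. exact: rmorphB. Qed.

Lemma fps_const_conj (f : fps4) : fps_const (fps_conj f) = conjc (fps_const f).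
Proof. by rewrite !fps_constE coef_fps_conj mswap0. Qed.

Lemma conj_var_inord : [/\ conj_var (inord 0) = inord 2, conj_var (inord 1) = inord 3,
  conj_var (inord 2) = inord 0 & conj_var (inord 3) = inord 1].
Proof. by rewrite /conj_var !inordK. Qed.

Lemma fps_conj_antihol h : dbar_closed d h ->
  fderiv (inord 0) (fps_conj h) = 0 /\ fderiv (inord 1) (fps_conj h) = 0.
Proof.
move=> [hzb hwb]; have [q0 q1 _ _] := conj_var_inord.
by rewrite !fderiv_fps_conj q0 q1 [fderiv _ _]hzb [fderiv _ _]hwb fps_conj0.
Qed.


Section FormalPullback.
Variables (h1 h2 : fps4).

Let series (j : 'I_4) : fps4 :=
  fps_centered (nth h1 [:: h1; h2; fps_conj h1; fps_conj h2] j).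

Let series0 j : fps_const (series j) = 0.
Proof. exact: fps_const_centered. Qed.

Lemma formal_pullback_nmod_morphism : nmod_morphism (formal_pullback h1 h2).
Proof. exact: (fps_subst_nmod_morphism series0). Qed.

Lemma formal_pullback_monoid_morphism : monoid_morphism (formal_pullback h1 h2).
Proof. exact: (fps_subst_monoid_morphism series0). Qed.

HB.instance Definition _ := GRing.isNmodMorphism.Build fps4 fps4
  (formal_pullback h1 h2) formal_pullback_nmod_morphism.
HB.instance Definition _ := GRing.isMonoidMorphism.Build fps4 fps4
  (formal_pullback h1 h2) formal_pullback_monoid_morphism.

Lemma fps_const_pullback F : fps_const (formal_pullback h1 h2 F) = fps_const F.
Proof. exact: (fps_const_subst series0). Qed.

Lemma fderiv_pullback i F : fderiv i (formal_pullback h1 h2 F) =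
  formal_pullback h1 h2 (d_z d F) * fderiv i h1
  + formal_pullback h1 h2 (d_w d F) * fderiv i h2
  + formal_pullback h1 h2 (d_zb d F) * fderiv i (fps_conj h1)
  + formal_pullback h1 h2 (d_wb d F) * fderiv i (fps_conj h2).
Proof.
rewrite [LHS](fderiv_subst series0) sum4 /series !fderiv_centered.
by rewrite !inordK.
Qed.

End FormalPullback.

Definition along_word (r : fps4) : fps4 -> seq bool -> fps4 :=
  foldl (fun g (b : bool) => if b then Lbar d r g else Lhol d r g).

(** The largest set of series with zero constant term that is stable under [L]
    and [Lbar] of [r]; the formal counterpart of the functions vanishing on [M]. *)
Definition tangent_ideal (r f : fps4) := forall w, fps_const (along_word r f w) = 0.

Let L_der r (b : bool) : derivation (if b then Lbar d r else Lhol d r).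
Proof.
have dW := commuting_wirtinger_fps; case: b.
  exact: LbarD_der _ (der_zb dW) (der_wb dW).
exact: (@LbarD_der _ (bar_wirtinger d) _ (der_z dW) (der_w dW)).
Qed.

Let along_cons r f b w :
  along_word r f (b :: w) = along_word r ((if b then Lbar d r else Lhol d r) f) w.
Proof. by case: b. Qed.

Lemma tangent_ideal_step r f (b : bool) : tangent_ideal r f ->
  tangent_ideal r ((if b then Lbar d r else Lhol d r) f).
Proof. by move=> If w; rewrite -along_cons; apply: If. Qed.

Lemma tangent_ideal0 r : tangent_ideal r 0.
Proof.
elim=> [|b w IH]; first exact: rmorph0.
by rewrite along_cons (der0 (L_der r b)).
Qed.

Lemma along_wordD r f g w :
  along_word r (f + g) w = along_word r f w + along_word r g w.
Proof.
by elim: w f g => // b w IH f g; rewrite !along_cons (derD (L_der r b)) IH.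
Qed.

(** Stability under multiplication is the Leibniz rule. *)
Lemma tangent_ideal_is_ideal r : is_ideal (tangent_ideal r).
Proof.
split=> [|f g If Ig w|f g If w]; first exact: tangent_ideal0.
  by rewrite along_wordD fps_constD If Ig addr0.
elim: w f g If => [|b w IH] f g If; first by rewrite fps_constM (If [::]) mulr0.
rewrite along_cons (derM (L_der r b)) along_wordD fps_constD IH // IH ?addr0 //.
exact: tangent_ideal_step.
Qed.

Lemma tangent_ideal_self r : fps_const r = 0 -> tangent_ideal r r.
Proof.
move=> r0 [|b w] //; rewrite along_cons.
have -> : (if b then Lbar d r else Lhol d r) r = 0.
  by case: b; [apply: Lbar_self | apply: (@Lbar_self _ (bar_wirtinger d))].
exact: tangent_ideal0.
Qed.

(** The hypothesis is weaker than proportionality of the pullback of [F] to [r];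
    it covers at once the case of a multiple and that of another defining function. *)
Theorem formal_transformation n (h1 h2 F r a : fps4) : (3 <= n)%N ->
  formal_coordinates h1 h2 ->
  (forall i, tangent_ideal r
     (fderiv i (formal_pullback h1 h2 F) - a * fderiv i r)) ->
  fjac h1 h2 ^+ (n ^ 2 - 1) * conjc (fjac h1 h2) ^+ ((n - 1) * (2 * n - 1))
    * fdetA n F = fps_const a ^+ ((2 * n - 1) ^ 2) * fdetA n r /\
  `|fjac h1 h2| ^+ (n * (n + 1)) * fdetD n F
    = fps_const a ^+ ((3 * n * (n + 1)) %/ 2) * fdetD n r.
Proof.
move=> n3 [hol1 hol2 jac0] Ia; set P := formal_pullback h1 h2.
have dW := commuting_wirtinger_fps.
pose k1 := fps_conj h1; pose k2 := fps_conj h2.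
have [h1zb h1wb] := hol1; have [h2zb h2wb] := hol2.
have [k1z k1w] := fps_conj_antihol hol1; have [k2z k2w] := fps_conj_antihol hol2.
have drop2 (x y u v p q s t : fps4) : s = 0 -> t = 0 ->
    x * p + y * q + u * s + v * t = x * p + y * q.
  by move=> -> ->; rewrite !mulr0 !addr0.
have drop1 (x y u v p q s t : fps4) : p = 0 -> q = 0 ->
    x * p + y * q + u * s + v * t = u * s + v * t.
  by move=> -> ->; rewrite !mulr0 !add0r.
have cz f : d_z d (P f) = P (d_z d f) * d_z d h1 + P (d_w d f) * d_z d h2.
  exact: etrans (fderiv_pullback _ _ _ _) (drop2 _ _ _ _ _ _ _ _ k1z k2z).
have cw f : d_w d (P f) = P (d_z d f) * d_w d h1 + P (d_w d f) * d_w d h2.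
  exact: etrans (fderiv_pullback _ _ _ _) (drop2 _ _ _ _ _ _ _ _ k1w k2w).
have czb f : d_zb d (P f) = P (d_zb d f) * d_zb d k1 + P (d_wb d f) * d_zb d k2.
  exact: etrans (fderiv_pullback _ _ _ _) (drop1 _ _ _ _ _ _ _ _ h1zb h2zb).
have cwb f : d_wb d (P f) = P (d_zb d f) * d_wb d k1 + P (d_wb d f) * d_wb d k2.
  exact: etrans (fderiv_pullback _ _ _ _) (drop1 _ _ _ _ _ _ _ _ h1wb h2wb).
pose dl := jacobian_det d h1 h2; pose dlb := jacobian_det (bar_wirtinger d) k1 k2.
have dlb_const : fps_const dlb = conjc (fjac h1 h2).
  have conj_const i (h : fps4) : fps_const (fderiv i (fps_conj h)) =
      conjc (fps_const (fderiv (conj_var i) h)).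
    by rewrite fderiv_fps_conj fps_const_conj.
  have -> : dlb = fderiv (inord 2) k1 * fderiv (inord 3) k2
    - fderiv (inord 3) k1 * fderiv (inord 2) k2 by [].
  have -> : fjac h1 h2 = fps_const (fderiv (inord 0) h1 * fderiv (inord 1) h2
    - fderiv (inord 1) h1 * fderiv (inord 0) h2) by [].
  rewrite !fps_constB !fps_constM !conj_const.
  have [_ _ -> ->] := conj_var_inord.
  have cl (x y z w : C) : conjc (x * y - z * w) =
    conjc x * conjc y - conjc z * conjc w by rewrite rmorphB !rmorphM.
  by rewrite cl.
have [e de] := fps_inverse (divff jac0).
have jacb0 : fps_const dlb != 0 by rewrite dlb_const conjc_eq0.
have [eb dbeb] := fps_inverse (divff jacb0).
have Iid := tangent_ideal_is_ideal r.
have ILb f : tangent_ideal r f -> tangent_ideal r (Lbar d r f).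
  exact: (tangent_ideal_step true).
have ILh f : tangent_ideal r f -> tangent_ideal r (Lhol d r f).
  exact: (tangent_ideal_step false).
have Ik f : tangent_ideal r f -> fps_const f = 0 by move=> If; apply: (If [::]).
have Fzw : d_z d (d_w d F) = d_w d (d_z d F) by exact: (der_zw dW).
have HA : fjac h1 h2 ^+ (n ^ 2 - 1) * fps_const dlb ^+ ((n - 1) * (2 * n - 1))
    * fps_const (P (\det (A_mx d n F))) =
    fps_const a ^+ ((2 * n - 1) ^ 2) * fps_const (\det (A_mx d n r)) :=
  det_A_pullback dW Fzw hol1 hol2 cz cw czb cwb de dbeb Iid ILb ILh Ik
  (Ia _) (Ia _) (Ia _) (Ia _) n3.
have HD : fjac h1 h2 ^+ 'C(n.+1, 2) * fps_const dlb ^+ 'C(n.+1, 2)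
    * fps_const (P (\det (D_mx d n F))) =
    fps_const a ^+ (3 * 'C(n.+1, 2)) * fps_const (\det (D_mx d n r)) :=
  det_D_pullback dW hol1 hol2 cz cw czb cwb de dbeb Iid ILb Ik
  (Ia _) (Ia _) (Ia _) (Ia _) n.
rewrite fps_const_pullback dlb_const in HA.
rewrite fps_const_pullback dlb_const in HD.
split; first exact: HA.
have n2 : (n * (n + 1) = 2 * 'C(n.+1, 2))%N.
  by have := mul_bin_diag n.+1 1; rewrite bin1; lia.
have -> : ((3 * n * (n + 1)) %/ 2 = 3 * 'C(n.+1, 2))%N.
  by rewrite -mulnA n2 mulnCA mulKn.
have -> : `|fjac h1 h2| ^+ (n * (n + 1)) =
    fjac h1 h2 ^+ 'C(n.+1, 2) * conjc (fjac h1 h2) ^+ 'C(n.+1, 2).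
  by rewrite n2 exprM normCK exprMn.
exact: HD.
Qed.

End FormalTransformation.

(** * The determinants computed on Taylor series *)

Section TaylorOfDeterminants.
Import FormalSeries.
Variable R : realType.
Local Notation C := R[i].
Local Notation W := (wirtinger_fun R).
Local Notation d := (wirtinger_fps R).

(** Evaluation, as a ring morphism, commutes with determinants. *)
Definition eval_at (p : C2 R) (f : C2 R -> C) : C := f p.

Lemma eval_at_nmod_morphism p : nmod_morphism (eval_at p).
Proof. by []. Qed.

Lemma eval_at_monoid_morphism p : monoid_morphism (eval_at p).
Proof. by []. Qed.

HB.instance Definition _ p := GRing.isNmodMorphism.Build (C2 R -> C) C
  (eval_at p) (eval_at_nmod_morphism p).
HB.instance Definition _ p := GRing.isMonoidMorphism.Build (C2 R -> C) C
  (eval_at p) (eval_at_monoid_morphism p).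

Variables (U : set (C2 R)) (p : C2 R) (oU : open U) (Up : U p).
Implicit Types (f g rho : C2 R -> C) (F G r : fps 4 C).

Definition has_taylor f F := csmooth U f /\ taylor f p = F.

Lemma has_taylorD f g F G : has_taylor f F -> has_taylor g G ->
  has_taylor (f + g) (F + G).
Proof.
by move=> [sf <-] [sg <-]; split; [apply: csmoothD | apply: taylorD oU sf sg Up].
Qed.

Lemma has_taylorM f g F G : has_taylor f F -> has_taylor g G ->
  has_taylor (f * g) (F * G).
Proof.
by move=> [sf <-] [sg <-]; split; [apply: csmoothM | apply: taylorM oU sf sg Up].
Qed.

Lemma has_taylorN f F : has_taylor f F -> has_taylor (- f) (- F).
Proof.
by move=> [sf <-]; split; [apply: csmoothN | apply: taylorN oU sf Up].
Qed.

Lemma has_taylor1 : has_taylor 1 1.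
Proof.
have s1 : csmooth U (1 : C2 R -> C) by apply: csmooth_cst.
split=> //; apply: fps_eq_upto_eq => -[|N].
  by apply: fps_eq_upto0; rewrite taylor_const (rmorph1 (@fps_const 4 C)).
apply: fps_eq_uptoS => [|i].
  by rewrite taylor_const (rmorph1 (@fps_const 4 C)).
rewrite (taylor_fderiv _ oU s1 Up) (der1 (@fderiv_derivation 4 C i)).
have -> : dfun i (1 : C2 R -> C) = 0 by apply/funext => q; apply: dfun_cst.
by rewrite taylor0.
Qed.

Lemma has_taylorX f F n : has_taylor f F -> has_taylor (f ^+ n) (F ^+ n).
Proof.
move=> fF; elim: n => [|n IH]; first exact: has_taylor1.
by rewrite !exprS; apply: has_taylorM.
Qed.

Lemma has_taylor_dfun i f F : has_taylor f F -> has_taylor (dfun i f) (fderiv i F).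
Proof.
move=> [sf <-]; split; first exact: csmooth_dfun.
by rewrite (taylor_fderiv _ oU sf Up).
Qed.

Lemma has_taylor_wirtinger f F : has_taylor f F ->
  [/\ has_taylor (d_z W f) (d_z d F), has_taylor (d_w W f) (d_w d F),
      has_taylor (d_zb W f) (d_zb d F) & has_taylor (d_wb W f) (d_wb d F)].
Proof.
have [-> -> -> ->] := wirtinger_opE W.
by move=> fF; split; apply: has_taylor_dfun.
Qed.

Lemma has_taylor_Lbar rho r f F : has_taylor rho r -> has_taylor f F ->
  has_taylor (Lbar W rho f) (Lbar d r F).
Proof.
move=> /has_taylor_wirtinger[_ _ rzb rwb] /has_taylor_wirtinger[_ _ fzb fwb].
by apply: has_taylorD; apply: has_taylorM => //; apply: has_taylorN.
Qed.

Lemma has_taylor_Lhol rho r f F : has_taylor rho r -> has_taylor f F ->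
  has_taylor (Lhol W rho f) (Lhol d r F).
Proof.
move=> /has_taylor_wirtinger[rz rw _ _] /has_taylor_wirtinger[fz fw _ _].
by apply: has_taylorD; apply: has_taylorM => //; apply: has_taylorN.
Qed.

Lemma has_taylor_rhoZ2LL rho r : has_taylor rho r ->
  has_taylor (rhoZ2LL W rho) (rhoZ2LL d r).
Proof.
move=> /has_taylor_wirtinger[rz rw _ _].
have [rzz rzw _ _] := has_taylor_wirtinger rz.
have [_ rww _ _] := has_taylor_wirtinger rw.
have h2 : has_taylor 2%:R 2%:R by apply: has_taylorD; apply: has_taylor1.
apply: has_taylorD; last by apply: has_taylorM => //; apply: has_taylorX.
apply: has_taylorD; first by apply: has_taylorM => //; apply: has_taylorX.
by apply: has_taylorN; do 3 apply: has_taylorM => //.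
Qed.

Lemma has_taylor_A_col0 n rho r i : has_taylor rho r ->
  has_taylor (A_col0 W n rho i) (A_col0 d n r i).
Proof.
move=> rr; have [rz rw _ _] := has_taylor_wirtinger rr; rewrite /A_col0.
have mono k l : has_taylor (d_z W rho ^+ k * d_w W rho ^+ l) (d_z d r ^+ k * d_w d r ^+ l).
  by apply: has_taylorM; apply: has_taylorX.
case: ifP => _; first exact: mono.
by apply: has_taylorM; [apply: mono | apply: has_taylor_rhoZ2LL].
Qed.

Lemma has_taylor_iter_Lbar rho r f F j : has_taylor rho r -> has_taylor f F ->
  has_taylor (iter j (Lbar W rho) f) (iter j (Lbar d r) F).
Proof. by move=> rr fF; elim: j => //= j IH; apply: has_taylor_Lbar. Qed.

Lemma det_has_taylor N (M : 'M[C2 R -> C]_N) (M' : 'M[fps 4 C]_N) :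
  (forall i j, has_taylor (M i j) (M' i j)) -> (\det M) p = fps_const (\det M').
Proof.
move=> MM'; rewrite -[LHS]/(eval_at p (\det M)) -!det_map_mx; congr (\det _).
apply/matrixP => i j; rewrite !mxE; have [_ <-] := MM' i j.
exact: esym (taylor_const _ _).
Qed.

Lemma detA_taylor n (rho : C2 R -> R) : smooth U rho ->
  detA n rho p = fdetA n (taylor (toC rho) p).
Proof.
move=> srho; have rr : has_taylor (toC rho) (taylor (toC rho) p).
  by split=> //; apply: csmooth_toC.
apply: det_has_taylor => i j; rewrite !mxE.
by apply: has_taylor_iter_Lbar => //; apply: has_taylor_A_col0.
Qed.

Lemma detD_taylor n (rho : C2 R -> R) : smooth U rho ->
  detD n rho p = fdetD n (taylor (toC rho) p).
Proof.
move=> srho; have rr : has_taylor (toC rho) (taylor (toC rho) p).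
  by split=> //; apply: csmooth_toC.
have [rz rw _ _] := has_taylor_wirtinger rr.
apply: det_has_taylor => i j; rewrite !mxE.
apply: has_taylor_iter_Lbar => //.
by apply: has_taylorM; apply: has_taylorX.
Qed.

End TaylorOfDeterminants.

(** * Functions vanishing on the hypersurface *)

Section Hypersurface.
Import FormalSeries.
Variable R : realType.
Local Notation C := R[i].
Local Notation W := (wirtinger_fun R).
Local Notation d := (wirtinger_fps R).
Variables (U M : set (C2 R)) (rho : C2 R -> R).
Hypothesis hrho : defining_function U M rho.
Implicit Types (f g : C2 R -> C) (p q : C2 R).

Let oU : open U. Proof. by case: hrho. Qed.
Let srho : smooth U rho. Proof. by case: hrho. Qed.
Let ME q : M q <-> U q /\ rho q = 0.
Proof. by case: hrho => _ _ -> _; split. Qed.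
Let MU q : M q -> U q. Proof. by move=> /ME[]. Qed.
Let crho : csmooth U (toC rho). Proof. exact: csmooth_toC. Qed.

(** Apply [proportional_partials] to the real and the imaginary part of [f]. *)
Lemma dfun_proportional f p : csmooth U f -> (forall q, M q -> f q = 0) -> M p ->
  exists c, forall i, dfun i f p = c * dfun i (toC rho) p.
Proof.
move=> [sf1 sf2] f0 Mp; have [Up rho0] := (ME p).1 Mp.
have [_ _ _ /(_ p Mp)[v v0]] := hrho.
pose u := ('d rho p v)^-1 *: v.
have du : 'd rho p u = 1 by rewrite /u linearZ; exact: mulVf.
have key (g : C2 R -> R) i : smooth U g -> (forall q, M q -> g q = 0) ->
    partial i g p = 'd g p u * partial i rho p.
  move=> sg g0; apply: (@proportional_partials R U rho g p u i oU Up) => //.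
  - by move=> q; apply: smooth_differentiable.
  - exact: smooth_differentiable sg Up.
  - by move=> q Uq rq; apply: g0; apply/ME.
pose c : C := ('d (fun q => complex.Re (f q)) p u +i* 'd (fun q => complex.Im (f q)) p u)%C.
exists c => i.
have cp k : cpartial k f p = c * cpartial k (toC rho) p.
  have im0 : partial k (fun q => complex.Im (toC rho q)) p = 0.
    exact: (partial_cst k 0 p).
  apply: eq_ReIm.
    rewrite complex_ReM [X in _ - _ * X]im0 mulr0 subr0; apply: key => // q Mq.
    by rewrite f0.
  rewrite complex_ImM [X in _ * X + _]im0 mulr0 add0r; apply: key => // q Mq.
  by rewrite f0.
have alg (K : comNzRingType) (h b x y z : K) :
  h * (x * y) + b * (x * z) = x * (h * y + b * z) by ring.
by rewrite !dfunE !cp; exact: alg.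
Qed.

(** [L] and [Lbar] of a function vanishing on [M] are two by two minors of two
    proportional gradients, so they vanish on [M] as well. *)
Lemma tangent_ideal_vanish f p : csmooth U f -> (forall q, M q -> f q = 0) -> M p ->
  tangent_ideal (taylor (toC rho) p) (taylor f p).
Proof.
move=> sf f0 Mp w; have Up := MU Mp.
elim: w f sf f0 => [|b w IH] f sf f0; 
  first by rewrite -[along_word _ _ _]/(taylor f p) taylor_const f0.
have rr : has_taylor U p (toC rho) (taylor (toC rho) p) by [].
have ff : has_taylor U p f (taylor f p) by [].
have [_ _ E2 E3] := wirtinger_opE W; have [E0 E1 _ _] := wirtinger_opE W.
case: b.
  have [sL LE] := has_taylor_Lbar oU Up rr ff.
  rewrite -[along_word _ _ _]/(along_word (taylor (toC rho) p)
    (Lbar d (taylor (toC rho) p) (taylor f p)) w) -LE; apply: IH => // q Mq.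
  have [c ce] := dfun_proportional sf f0 Mq.
  have -> : Lbar W (toC rho) f q = - dfun (inord 3) (toC rho) q * dfun (inord 2) f q
     + dfun (inord 2) (toC rho) q * dfun (inord 3) f q by rewrite /Lbar E2 E3.
  by rewrite !ce mulrCA mulNr addrC mulrCA [X in _ * X]mulrC mulrN subrr.
have [sL LE] := has_taylor_Lhol oU Up rr ff.
rewrite -[along_word _ _ _]/(along_word (taylor (toC rho) p)
  (Lhol d (taylor (toC rho) p) (taylor f p)) w) -LE; apply: IH => // q Mq.
have [c ce] := dfun_proportional sf f0 Mq.
have -> : Lhol W (toC rho) f q = - dfun (inord 1) (toC rho) q * dfun (inord 0) f q
   + dfun (inord 0) (toC rho) q * dfun (inord 1) f q by
  rewrite -[LHS]/(- d_w W (toC rho) q * d_z W f q + d_z W (toC rho) q * d_w W f q)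
    E0 E1.
by rewrite !ce mulrCA mulNr addrC mulrCA [X in _ * X]mulrC mulrN subrr.
Qed.

Lemma cpartial_dfun0 f p : (forall i, dfun i f p = 0) -> forall k, cpartial k f p = 0.
Proof.
move=> f0.
have alg (K : numFieldType) (h b x y : K) : h != 0 -> b != 0 ->
    h * x + b * y = 0 -> h * x + - b * y = 0 -> x = 0 /\ y = 0.
  move=> h0 b0 e1 e2; have e3 : 2%:R * (h * x) = 0.
    have -> : 2%:R * (h * x) = (h * x + b * y) + (h * x + - b * y) by ring.
    by rewrite e1 e2 addr0.
  have e4 : 2%:R * (b * y) = 0.
    have -> : 2%:R * (b * y) = (h * x + b * y) - (h * x + - b * y) by ring.
    by rewrite e1 e2 subrr.
  by move: e3 e4 => /eqP; rewrite !mulf_eq0 pnatr_eq0 /= (negPf h0) => /eqP ->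
    /eqP; rewrite !mulf_eq0 pnatr_eq0 /= (negPf b0) => /eqP ->.
have h0 : (2%:R^-1 : C) != 0 by rewrite invr_eq0 pnatr_eq0.
have b0 : ('i / 2%:R : C) != 0 by rewrite mulf_neq0 // neq0Ci.
have c01 : im_coef R (inord 0) = - ('i / 2%:R).
  by rewrite /im_coef inordK //= expr1 mulN1r mulNr.
have c2 : im_coef R (inord 2) = 'i / 2%:R.
  by rewrite /im_coef inordK //= expr0 mul1r.
have c1 : im_coef R (inord 1) = - ('i / 2%:R).
  by rewrite /im_coef inordK //= expr1 mulN1r mulNr.
have c3 : im_coef R (inord 3) = 'i / 2%:R.
  by rewrite /im_coef inordK //= expr0 mul1r.
have := f0 (inord 2); have := f0 (inord 0); have := f0 (inord 3); have := f0 (inord 1).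
rewrite !dfunE c01 c1 c2 c3 /re_var /im_var !inordK //=.
move=> F1 F3 F0 F2.
have [x0 x1] := alg _ _ _ _ _ h0 b0 F2 F0.
have [x2 x3] := alg _ _ _ _ _ h0 b0 F3 F1.
exact: (ord4_ind (P := fun k => cpartial k f p = 0) x0 x1 x2 x3).
Qed.

Lemma dfun_defining_neq0 p : M p -> exists i, dfun i (toC rho) p != 0.
Proof.
move=> Mp; apply: contrapT => nex.
have f0 i : dfun i (toC rho) p = 0.
  by apply: contrapT => /eqP fi; apply: nex; exists i.
have [_ _ _ /(_ p Mp)[v /eqP]] := hrho; apply.
rewrite diff_partial; last exact: smooth_differentiable srho (MU Mp).
rewrite big1 // => i _; have := cpartial_dfun0 f0 i => /(congr1 (@complex.Re R)) /=.
by move=> ->; rewrite mulr0.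
Qed.

Lemma tangent_ideal_multiple (a : C2 R -> R) p i : smooth U a -> M p ->
  tangent_ideal (taylor (toC rho) p)
    (fderiv i (taylor (toC (fun q => a q * rho q)) p)
     - taylor (toC a) p * fderiv i (taylor (toC rho) p)).
Proof.
move=> sa Mp; have Up := MU Mp; have ca := csmooth_toC sa.
have -> : toC (fun q => a q * rho q) = toC a * toC rho.
  by apply/funext => q; apply: rmorphM.
rewrite (taylorM oU ca crho Up) (derM (@fderiv_derivation 4 C i)) addrK.
apply: (idealM (tangent_ideal_is_ideal _)); apply: tangent_ideal_self.
by rewrite taylor_const /toC; have [_ ->] := (ME p).1 Mp.
Qed.

End Hypersurface.

(** * Independence of the defining function and of the coordinates *)

Section Independence.
Import FormalSeries.
Variable R : realType.
Local Notation C := R[i].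
Local Notation W := (wirtinger_fun R).
Local Notation d := (wirtinger_fps R).
Implicit Types (U V M : set (C2 R)).

(** Take [a] to be a quotient of derivatives in a direction transversal to [M].
    The minors of the two gradients vanish on [M]. *)
Lemma tangent_ideal_defining U M (rho rho1 : C2 R -> R) p :
  defining_function U M rho -> defining_function U M rho1 -> M p ->
  exists2 a : fps 4 C, fps_const a != 0 &
    forall i, tangent_ideal (taylor (toC rho) p)
      (fderiv i (taylor (toC rho1) p) - a * fderiv i (taylor (toC rho) p)).
Proof.
move=> hrho hrho1 Mp; have [oU srho MU _] := hrho; have [_ srho1 MU1 _] := hrho1.
have Up : U p by move: Mp; rewrite MU => -[].
have [crho crho1] := (csmooth_toC srho, csmooth_toC srho1).
have rho10 q : M q -> toC rho1 q = 0 by rewrite MU1 /toC => -[_ /= ->].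
have [i0 ri0] := dfun_defining_neq0 hrho Mp.
have [i1 ri1] := dfun_defining_neq0 hrho1 Mp.
set r := taylor _ p; set phi := taylor (toC rho1) p.
have rE i : fderiv i r = taylor (dfun i (toC rho)) p by apply: taylor_fderiv Up.
have phiE i : fderiv i phi = taylor (dfun i (toC rho1)) p.
  by apply: taylor_fderiv Up.
have rc i : fps_const (fderiv i r) = dfun i (toC rho) p by rewrite rE taylor_const.
have phic i : fps_const (fderiv i phi) = dfun i (toC rho1) p.
  by rewrite phiE taylor_const.
have [b rb] : exists b, fderiv i0 r * b = 1.
  by apply: (@fps_inverse _ _ _ (dfun i0 (toC rho) p)^-1); rewrite rc divff.
(* [b] inverts a nonzero derivative of [r], so that the difference is [b] times
   a minor of the two gradients. *)
have Ia i : tangent_ideal r (fderiv i phi - (fderiv i0 phi * b) * fderiv i r).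
  have -> : fderiv i phi - (fderiv i0 phi * b) * fderiv i r =
      b * (fderiv i0 r * fderiv i phi - fderiv i0 phi * fderiv i r).
    by rewrite -[X in X - _ = _](mul1r (fderiv i phi)) -rb; ring.
  apply: (idealM (tangent_ideal_is_ideal r)).
  pose g := dfun i0 (toC rho) * dfun i (toC rho1) - dfun i0 (toC rho1) * dfun i (toC rho).
  have tay f : csmooth U f -> has_taylor U p f (taylor f p) by [].
  have [sg gE] : has_taylor U p g
      (fderiv i0 r * fderiv i phi - fderiv i0 phi * fderiv i r).
    rewrite !rE !phiE; apply: has_taylorD => //; last apply: has_taylorN => //.
      by apply: has_taylorM => //; apply: tay; apply: csmooth_dfun.
    by apply: has_taylorM => //; apply: tay; apply: csmooth_dfun.
  rewrite -gE; apply: (tangent_ideal_vanish hrho) => // q Mq.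
  have [c ce] := dfun_proportional hrho crho1 rho10 Mq.
  rewrite -[LHS]/(dfun i0 (toC rho) q * dfun i (toC rho1) q
    - dfun i0 (toC rho1) q * dfun i (toC rho) q) !ce.
  by rewrite mulrCA -mulrA subrr.
exists (fderiv i0 phi * b) => //; apply: contraNneq ri1 => a0.
have := Ia i1 [::]; rewrite -[along_word _ _ _]/(fderiv i1 phi - _ * fderiv i1 r).
by rewrite fps_constB fps_constM a0 mul0r subr0 phic => ->.
Qed.

Lemma transfer_zero (K : fieldType) (u v x y : K) : u != 0 -> v != 0 ->
  u * x = v * y -> (x = 0 <-> y = 0).
Proof.
move=> u0 v0 E; split=> [x0|y0].
  by move/eqP: E; rewrite x0 mulr0 eq_sym mulf_eq0 (negPf v0) => /eqP.
by move/eqP: E; rewrite y0 mulr0 mulf_eq0 (negPf u0) => /eqP.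
Qed.

Lemma formal_independence n U M (rho rho1 : C2 R -> R) p (h1 h2 F : fps 4 C) :
  (3 <= n)%N -> defining_function U M rho -> defining_function U M rho1 -> M p ->
  formal_coordinates h1 h2 ->
  formal_pullback h1 h2 F = taylor (toC rho1) p ->
  (fdetA n F = 0 <-> detA n rho p = 0) /\ (fdetD n F = 0 <-> detD n rho p = 0).
Proof.
move=> n3 hrho hrho1 Mp hh FE; have [oU srho MU _] := hrho.
have Up : U p by move: Mp; rewrite MU => -[].
have [a a0 Ia] := tangent_ideal_defining hrho hrho1 Mp.
rewrite -FE in Ia; have [EA ED] := formal_transformation n3 hh Ia.
have [_ _ jac0] := hh.
have jac0' : fjac h1 h2 != 0 by [].
rewrite (detA_taylor oU Up _ srho) (detD_taylor oU Up _ srho); split.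
  apply: transfer_zero EA; last by rewrite expf_neq0.
  by rewrite mulf_neq0 ?expf_neq0 ?conjc_eq0.
by apply: transfer_zero ED; rewrite expf_neq0 // normr_eq0.
Qed.

Lemma formal_rule n U M (rho a : C2 R -> R) p (h1 h2 F : fps 4 C) :
  (3 <= n)%N -> defining_function U M rho -> smooth U a -> M p ->
  formal_coordinates h1 h2 ->
  formal_pullback h1 h2 F = taylor (toC (fun q => a q * rho q)) p ->
  fjac h1 h2 ^+ (n ^ 2 - 1) * conjc (fjac h1 h2) ^+ ((n - 1) * (2 * n - 1))
    * fdetA n F = (a p)%:C%C ^+ ((2 * n - 1) ^ 2) * detA n rho p /\
  `|fjac h1 h2| ^+ (n * (n + 1)) * fdetD n F
    = (a p)%:C%C ^+ ((3 * n * (n + 1)) %/ 2) * detD n rho p.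
Proof.
move=> n3 hrho sa Mp hh FE; have [oU srho MU _] := hrho.
have Up : U p by move: Mp; rewrite MU => -[].
have Ia i := tangent_ideal_multiple hrho i sa Mp.
rewrite -FE in Ia.
have := formal_transformation n3 hh Ia.
by rewrite taylor_const (detA_taylor oU Up _ srho) (detD_taylor oU Up _ srho).
Qed.

Lemma det_neq0_of_left_inverse (K : fieldType) (b11 b12 b21 b22 x y z w : K) :
  b11 * x + b12 * y = 1 -> b11 * z + b12 * w = 0 ->
  b21 * x + b22 * y = 0 -> b21 * z + b22 * w = 1 -> x * w - z * y != 0.
Proof.
move=> e1 e2 e3 e4; apply/eqP => det0.
have alg : (b11 * x + b12 * y) * (b21 * z + b22 * w)
    - (b11 * z + b12 * w) * (b21 * x + b22 * y) =
  (b11 * b22 - b12 * b21) * (x * w - z * y) by ring.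
by move/eqP: alg; rewrite e1 e2 e3 e4 det0 !mulr0 mulr1 subr0 oner_eq0.
Qed.

Lemma dfun_coord p : [/\ dfun (inord 0) (@z_of R) p = 1, dfun (inord 1) (@z_of R) p = 0,
  dfun (inord 0) (@w_of R) p = 0 & dfun (inord 1) (@w_of R) p = 1].
Proof.
have pd i j : partial i (fun q : C2 R => q 0 j) p = (i == j)%:R.
  rewrite partialE; last exact: differentiable_coord.
  by rewrite diff_coord mxE eqxx eq_sym.
have cz k : cpartial k (@z_of R) p = ((k == inord 0)%:R +i* (k == inord 1)%:R)%C.
  by rewrite -!pd.
have cw k : cpartial k (@w_of R) p = ((k == inord 2)%:R +i* (k == inord 3)%:R)%C.
  by rewrite -!pd.
have iE : ((0 : R) +i* 1)%C = 'i :> C by [].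
have oE : ((1 : R) +i* 0)%C = 1 :> C by [].
have zE : ((0 : R) +i* 0)%C = 0 :> C by [].
have ii : ('i : C) * 'i = -1 by rewrite -expr2 sqrCi.
rewrite !dfunE /im_coef /re_var /im_var !inordK //= !cz !cw -!val_eqE /= !inordK //=.
have alg (K : fieldType) (I : K) : (2%:R : K) != 0 -> I * I = -1 ->
    2%:R^-1 * 1 + (-1) ^+ 1 * I / 2%:R * I = 1.
  move=> n2 II; transitivity ((1 - I * I) / 2%:R); first by field.
  by rewrite II opprK divff.
have two : (2%:R : C) != 0 by rewrite pnatr_eq0.
by split; rewrite ?iE ?oE ?zE ?mulr0 ?addr0 //; apply: alg.
Qed.

(** The Jacobian does not vanish because the derivatives of the inverse map
    provide a left inverse of the Jacobian matrix. *)
Lemma formal_coordinates_taylor U V (H : C2 R -> C2 R) p :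
  holomorphic_coordinates U V H -> U p ->
  formal_coordinates (taylor (@z_of R \o H) p) (taylor (@w_of R \o H) p) /\
  fjac (taylor (@z_of R \o H) p) (taylor (@w_of R \o H) p) = jac H p.
Proof.
move=> [oU oV [[sz hz] [sw hw]] HU [G [[[sGz hGz] [sGw hGw]] GH]]] Up.
have [E0 E1 E2 E3] := wirtinger_opE W.
have td i f : csmooth U f -> fderiv i (taylor f p) = taylor (dfun i f) p.
  by move=> sf; apply: taylor_fderiv sf Up.
have hol f : csmooth U f -> (forall q, U q -> d_zb W f q = 0 /\ d_wb W f q = 0) ->
    dbar_closed d (taylor f p).
  rewrite E2 E3 => sf hf; split; rewrite [LHS]td // -(taylor0 p);
    apply: (eq_on_taylor oU Up) => q /set_mem Uq; by have [] := hf q Uq.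
have jacE : fjac (taylor (@z_of R \o H) p) (taylor (@w_of R \o H) p) = jac H p.
  rewrite -[LHS]/(fps_const (fderiv (inord 0) (taylor (@z_of R \o H) p)
      * fderiv (inord 1) (taylor (@w_of R \o H) p)
      - fderiv (inord 1) (taylor (@z_of R \o H) p)
      * fderiv (inord 0) (taylor (@w_of R \o H) p))).
  by rewrite fps_constB !fps_constM !td // !taylor_const /jac /jacobian_det E0 E1.
have HV q : U q -> V (H q) by move=> Uq; rewrite -HU; exists q.
have sH := smooth_coords sz sw.
have chain f g i : csmooth V f -> dfun (inord 2) f (H p) = 0 ->
    dfun (inord 3) f (H p) = 0 -> {in U, f \o H =1 g} ->
    dfun i g p = dfun (inord 0) f (H p) * dfun i (@z_of R \o H) p
      + dfun (inord 1) f (H p) * dfun i (@w_of R \o H) p.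
  move=> sf f2 f3 fg; rewrite -(eq_on_dfun i oU fg); last by rewrite inE.
  rewrite (dfun_comp i sf HV sH Up) sum4 f2 f3 !mul0r !addr0.
  by rewrite /coords_and_conj !inordK.
have jac0 : jac H p != 0.
  have [zz zw wz ww] := dfun_coord p.
  have HVp := HV _ Up.
  have gz2 : dfun (inord 2) (@z_of R \o G) (H p) = 0.
    by have [] := hGz _ HVp; rewrite E2.
  have gz3 : dfun (inord 3) (@z_of R \o G) (H p) = 0.
    by have [] := hGz _ HVp; rewrite E3.
  have gw2 : dfun (inord 2) (@w_of R \o G) (H p) = 0.
    by have [] := hGw _ HVp; rewrite E2.
  have gw3 : dfun (inord 3) (@w_of R \o G) (H p) = 0.
    by have [] := hGw _ HVp; rewrite E3.
  have GHz : {in U, (@z_of R \o G) \o H =1 @z_of R}.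
    by move=> q /set_mem Uq; rewrite /= GH.
  have GHw : {in U, (@w_of R \o G) \o H =1 @w_of R}.
    by move=> q /set_mem Uq; rewrite /= GH.
  rewrite (chain _ _ _ sGz gz2 gz3 GHz) in zz.
  rewrite (chain _ _ _ sGz gz2 gz3 GHz) in zw.
  rewrite (chain _ _ _ sGw gw2 gw3 GHw) in wz.
  rewrite (chain _ _ _ sGw gw2 gw3 GHw) in ww.
  have -> : jac H p = dfun (inord 0) (@z_of R \o H) p * dfun (inord 1) (@w_of R \o H) p
      - dfun (inord 1) (@z_of R \o H) p * dfun (inord 0) (@w_of R \o H) p.
    by rewrite /jac /jacobian_det E0 E1.
  exact: det_neq0_of_left_inverse zz zw wz ww.
split=> //; split; [exact: hol | exact: hol | ].
by rewrite -[fps_const _]/(fjac _ _) jacE.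
Qed.

Lemma holomorphic_coords_smooth U (H : C2 R -> C2 R) : holomorphic_map U H ->
  forall j, smooth U (fun q => H q 0 j).
Proof. by move=> [[sz _] [sw _]]; apply: smooth_coords. Qed.

Lemma near_eq_diff (f g : C2 R -> R) p v : {near p, f =1 g} ->
  differentiable f p -> 'd f p v = 'd g p v.
Proof.
move=> fg df; rewrite -!deriveE //; first exact: near_eq_derive.
exact: near_eq_differentiable fg df.
Qed.

(** The differential stays nonzero because [rho] is recovered from its pullback by
    composing with the inverse map. *)
Lemma defining_function_comp U V M (H : C2 R -> C2 R) (rho' : C2 R -> R) :
  holomorphic_coordinates U V H -> open U -> M `<=` U ->
  defining_function V (H @` M) rho' -> defining_function U M (rho' \o H).
Proof.
move=> [_ oV holH HU [G [holG GH]]] oU MU [_ srho' HME drho'].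
have HV q : U q -> V (H q) by move=> Uq; rewrite -HU; exists q.
have srho1 : smooth U (rho' \o H).
  exact: smooth_comp (holomorphic_coords_smooth holH) srho'.
have GV q : V q -> U (G q) /\ H (G q) = q.
  by rewrite -HU => -[u Uu <-]; rewrite GH.
split=> // [|p Mp].
  apply/seteqP; split=> [q Mq|q [Uq rq]].
    split; first exact: MU.
    have : (H @` M) (H q) by exists q.
    by rewrite HME => -[].
  have : (H @` M) (H q) by rewrite HME; split; [apply: HV | ].
  by move=> [m Mm Hm]; rewrite -(GH q Uq) -Hm GH //; apply: MU.
have Up := MU _ Mp; have HVp := HV _ Up.
have [v v0] : exists v, 'd rho' (H p) v != 0 by apply: drho'; exists p.
exists ('d G (H p) v); apply: contra_neq v0 => d0.
have dG : differentiable G (H p).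
  apply: differentiable_coords => j.
  exact: smooth_differentiable (holomorphic_coords_smooth holG j) HVp.
have d1 : differentiable (rho' \o H) (G (H p)).
  by rewrite GH //; apply: smooth_differentiable srho1 Up.
have E : {near H p, (rho' \o H) \o G =1 rho'}.
  apply: (@eq_on_near _ V) => // q /set_mem Vq /=.
  by have [_ ->] := GV _ Vq.
rewrite -(near_eq_diff v E); last exact: differentiable_comp.
by rewrite (diff_comp dG d1) /= GH.
Qed.

(** The function [f'] is [f] composed with the inverse coordinate change. *)
Lemma smooth_of_pullback U V (H : C2 R -> C2 R) (f f' : C2 R -> R) :
  holomorphic_coordinates U V H -> smooth U f ->
  (forall q, U q -> f' (H q) = f q) -> smooth V f'.
Proof.
move=> [oU oV _ HU [G [holG GH]]] sf ff'.
have GV q : V q -> U (G q) /\ H (G q) = q.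
  by rewrite -HU => -[u Uu <-]; rewrite GH.
have : smooth V (f \o G).
  by apply: smooth_comp (holomorphic_coords_smooth holG) sf => // q /GV[].
apply: eq_on_smooth => // q /set_mem /GV[UG HG] /=.
by rewrite -ff' // HG.
Qed.

End Independence.

Theorem theorem2p1 (R : realType) (n : nat) (U M : set (C2 R))
    (rho : C2 R -> R) (hn : (3 <= n)%N) (hrho : defining_function U M rho) :
  (* holomorphic coordinates on U *)
  (forall (V : set (C2 R)) (H : C2 R -> C2 R),
    holomorphic_coordinates U V H ->
    (* independence of the vanishing conditions *)
    (forall rho' : C2 R -> R, defining_function V (H @` M) rho' ->
      forall p, M p ->
        (detA n rho' (H p) = 0 <-> detA n rho p = 0) /\
        (detD n rho' (H p) = 0 <-> detD n rho p = 0)) /\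
    (* transformation rules *)
    (forall a rho' : C2 R -> R, smooth U a -> (forall p, U p -> a p != 0) ->
      (forall p, U p -> rho' (H p) = a p * rho p) ->
      forall p, M p ->
        jac H p ^+ (n ^ 2 - 1) * (jac H p)^* ^+ ((n - 1) * (2 * n - 1))
          * detA n rho' (H p)
        = (a p)%:C ^+ ((2 * n - 1) ^ 2) * detA n rho p /\
        `|jac H p| ^+ (n * (n + 1)) * detD n rho' (H p)
        = (a p)%:C ^+ ((3 * n * (n + 1)) %/ 2) * detD n rho p)) /\
  (* formal holomorphic coordinates at a point p of M *)
  (forall (p : C2 R) (h1 h2 : fps 4 R[i]), M p -> formal_coordinates h1 h2 ->
    (forall (rho1 : C2 R -> R) (F : fps 4 R[i]),
      defining_function U M rho1 ->
      formal_pullback h1 h2 F = taylor (toC rho1) p ->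
        (fdetA n F = 0 <-> detA n rho p = 0) /\
        (fdetD n F = 0 <-> detD n rho p = 0)) /\
    (forall (a : C2 R -> R) (F : fps 4 R[i]),
      smooth U a -> (forall q, U q -> a q != 0) ->
      formal_pullback h1 h2 F = taylor (toC (fun q => a q * rho q)) p ->
        fjac h1 h2 ^+ (n ^ 2 - 1) * (fjac h1 h2)^* ^+ ((n - 1) * (2 * n - 1))
          * fdetA n F
        = (a p)%:C ^+ ((2 * n - 1) ^ 2) * detA n rho p /\
        `|fjac h1 h2| ^+ (n * (n + 1)) * fdetD n F
        = (a p)%:C ^+ ((3 * n * (n + 1)) %/ 2) * detD n rho p)).
Proof.
have [oU srho ME _] := hrho.
have MU : M `<=` U by rewrite ME => q [].
split; last first.
  move=> p h1 h2 Mp hh; split=> [rho1 F hrho1 FE|a F sa _ FE].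
    exact: (formal_independence hn hrho hrho1 Mp hh FE).
  exact: (formal_rule hn hrho sa Mp hh FE).
move=> V H HUV; have [_ oV holH HU _] := HUV.
have HV q : U q -> V (H q) by move=> Uq; rewrite -HU; exists q.
have [[sz _] [sw _]] := holH.
have pullbackE rho' p : smooth V rho' -> M p ->
    formal_pullback (taylor (@z_of R \o H) p) (taylor (@w_of R \o H) p)
      (taylor (toC rho') (H p)) = taylor (toC (rho' \o H)) p.
  move=> srho' Mp; apply/esym.
  by apply: (taylor_comp oU oV (csmooth_toC srho') HV sz sw (MU _ Mp)).
split=> [rho' hrho' p Mp|a rho' sa _ rhoE p Mp].
  have [_ srho' _ _] := hrho'; have HVp := HV _ (MU _ Mp).
  have [hh _] := formal_coordinates_taylor HUV (MU _ Mp).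
  have hrho1 := defining_function_comp HUV oU MU hrho'.
  rewrite (detA_taylor oV HVp _ srho') (detD_taylor oV HVp _ srho').
  exact: (formal_independence hn hrho hrho1 Mp hh (pullbackE _ _ srho' Mp)).
have srho' : smooth V rho'.
  exact: (smooth_of_pullback HUV (smoothM oU sa srho)).
have HVp := HV _ (MU _ Mp).
have [hh <-] := formal_coordinates_taylor HUV (MU _ Mp).
rewrite (detA_taylor oV HVp _ srho') (detD_taylor oV HVp _ srho').
apply: (formal_rule hn hrho sa Mp hh); rewrite pullbackE //.
apply: (eq_on_taylor oU (MU _ Mp)) => q /set_mem Uq.
by rewrite /toC /= rhoE.
Qed.
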